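(* Let $\mu$ be a positive Borel measure on $[0,1)$, $\beta>0$, $\gamma>0$, $1\le p\le\infty$, $1/p'=1-1/p$ and $0<q<\infty$. Then $\mathcal C_{\mu,\beta}$ maps $H(p,\infty,\gamma)$ into $H(p,q,\gamma)$ if and only if $D_{\beta+\gamma-1/p'}F_\mu\in H(p,q,\gamma)$.
   Context: $\mathbb D$ is the open unit disc of $\mathbb C$ and $\mathcal H(\mathbb D)$ the space of analytic functions on $\mathbb D$. Positive Borel measures on $[0,1)$ are understood to be finite. For $\beta>0$ and $f\in\mathcal H(\mathbb D)$, $\mathcal C_{\mu,\beta}(f)(z)=\int_0^1 \frac{f(tz)}{(1-tz)^\beta}\,d\mu(t)$, $z\in\mathbb D$; this belongs to $\mathcal H(\mathbb D)$. Put $\mu_n=\int_0^1t^n\,d\mu(t)$ and $F_\mu(z)=\sum_{n=0}^\infty\mu_nz^n=\int_0^1\frac{d\mu(t)}{1-tz}$. For $\alpha>-1$ and $f(z)=\sum_{n\ge0} a_nz^n\in\mathcal H(\mathbb D)$, the fractional derivative is $D_\alpha f(z)=\sum_{n=0}^\infty\frac{\Gamma(n+\alpha+1)}{n!\,\Gamma(\alpha+1)}a_nz^n$. For $f\in\mathcal H(\mathbb D)$ and $0<r<1$: $M_p(f,r)=\left(\int_0^{2\pi}|f(re^{i\theta})|^p\frac{d\theta}{2\pi}\right)^{1/p}$ for $0<p<\infty$, and $M_\infty(f,r)=\max_{|z|=r}|f(z)|$. For $0<p\le\infty$ and $\gamma>0$, $H(p,q,\gamma)$ is the space of $f\in\mathcal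 H(\mathbb D)$ with $\|f\|_{(p,q,\gamma)}<\infty$, where $\|f\|_{(p,q,\gamma)}=\left(\int_0^1(1-r)^{\gamma q-1}M_p^q(f,r)\,dr\right)^{1/q}$ if $0<q<\infty$, and $\|f\|_{(p,\infty,\gamma)}=\sup_{0<r<1}(1-r)^\gamma M_p(f,r)$. *)

(* Defs.v *)
From HB Require Import structures.
From mathcomp Require Import all_boot all_order all_algebra.
From mathcomp Require Import complex.
From mathcomp Require Import all_classical all_reals all_analysis.
Set Implicit Arguments.
Unset Strict Implicit.
Unset Printing Implicit Defensive.
Import Order.TTheory GRing.Theory Num.Theory.
Import ComplexField.Normc.
Import numFieldNormedType.Exports.
Local Open Scope classical_set_scope.
Local Open Scope ring_scope.
Local Open Scope complex_scope.

(* [R[i]^o] is [R[i]] seen as a normed module over itself; it is this alias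
   which carries the topology.  The norm [`|z|] is valued in [R[i]] (where [<]
   forces equality of imaginary parts), while [normc z] is the same modulus
   valued in [R]. *)

Section AnalyticFunctions.
Variable R : realType.
Local Notation C := (R[i]^o).
Implicit Types (f : C -> C) (a : nat -> C).

Definition unit_disc : set C := [set z | `|z| < 1].

Definition expands f (w : C) (rho : R) a :=
  forall z : C, `|z - w| < rho%:C ->
    series (fun n => a n * (z - w) ^+ n) @ \oo --> f z.

(* Functions on the disc are total functions whose values off the disc are
   irrelevant. *)
Definition disc_analytic f :=
  forall w : C, unit_disc w ->
    exists (rho : R) a, 0 < rho /\ expands f w rho a.

(* The sequence a with f(z) = \sum_n a_n z^n on the unit disc. *)
Definition taylor_coef f : nat -> C := get [set a | expands f 0 1 a].

Definition Gamma (s : R) : R :=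
  \int[lebesgue_measure]_(x in `]0, +oo[) (x `^ (s - 1) * expR (- x)).

Definition fracD (alpha : R) f : C -> C := fun z =>
  limn (series (fun n =>
    (Gamma (n%:R + alpha + 1) / (n`!%:R * Gamma (alpha + 1)))%:C
    * taylor_coef f n * z ^+ n) : nat -> C).

End AnalyticFunctions.

Section MixedNormSpaces.
Variable R : realType.
Local Notation C := (R[i]^o).
Implicit Types (f : C -> C) (p q : \bar R).

Definition circle_pt (r theta : R) : C := (r * cos theta) +i* (r * sin theta).

(* The value at p = -oo is irrelevant. *)
Definition integral_mean p f (r : R) : \bar R :=
  match p with
  | s%:E => (\int[lebesgue_measure]_(theta in `[0%R, (2 * pi)%R]%classic)
              (normc (f (circle_pt r theta)) `^ s / (2 * pi))%R%:E) `^ s^-1%R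
  | +oo => ereal_sup [set (normc (f z))%:E | z in [set z : C | `|z|%R = r%:C]]
  | -oo => 0
  end%E.

(* The value at q = -oo is irrelevant. *)
Definition mixed_norm p q (gamma : R) f : \bar R :=
  match q with
  | s%:E => (\int[lebesgue_measure]_(r in `]0%R, 1%R[%classic)
              (((1 - r) `^ (gamma * s - 1))%R%:E * integral_mean p f r `^ s))
            `^ s^-1%R
  | +oo => ereal_sup [set (((1 - r) `^ gamma)%R%:E * integral_mean p f r)
                     | r in `]0%R, 1%R[%classic]
  | -oo => 0
  end%E.

Definition mixed_space p q (gamma : R) : set (C -> C) :=
  [set f | disc_analytic f /\ (mixed_norm p q gamma f < +oo)%E].

End MixedNormSpaces.

Section CesaroOperator.
Variable R : realType.
Local Notation C := (R[i]^o).

(* Principal branch of w ^ s for w != 0, with argument in ]-pi, pi]. *)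
Definition carg (w : C) : R :=
  if 0 <= complex.Im w then acos (complex.Re w / normc w)
  else - acos (complex.Re w / normc w).

Definition cpowR (w : C) (s : R) : C :=
  (normc w `^ s)%:C * (cos (s * carg w) +i* sin (s * carg w)).

(* A finite Borel measure on [0, 1[ is represented by a finite Borel measure
   on R, of which only the restriction to [0, 1[ is ever used. *)
Variable mu : {finite_measure set (measurableTypeR R) -> \bar R}.

Definition cintegral01 (g : R -> C) : C :=
  (\int[mu]_(t in `[0, 1[) complex.Re (g t))
  +i* (\int[mu]_(t in `[0, 1[) complex.Im (g t)).

Definition cesaro_op (beta : R) (f : C -> C) : C -> C := fun z =>
  cintegral01 (fun t => f (t%:C * z) / cpowR (1 - t%:C * z) beta).

Definition moment (n : nat) : R := \int[mu]_(t in `[0, 1[) (t ^+ n).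

Definition moment_gf : C -> C := fun z =>
  limn (series (fun n => (moment n)%:C * z ^+ n) : nat -> C).

End CesaroOperator.

(* Main.v *)
Require Import Defs.
From mathcomp Require Import all_boot all_order all_algebra.
From mathcomp Require Import complex ring lra.
From mathcomp Require Import all_classical all_reals all_analysis.
From mathcomp Require Import measurable_realfun.
Set Implicit Arguments.
Unset Strict Implicit.
Unset Printing Implicit Defensive.
Import Order.TTheory GRing.Theory Num.Theory.
Import ComplexField.Normc.
Import numFieldNormedType.Exports.
Local Open Scope classical_set_scope.
Local Open Scope ring_scope.
Local Open Scope complex_scope.

(** Write [s = 1/p], [a = beta + gamma] and [h_b(r) = \int (1 - t r)^-b dmu(t)].
    The binomial series and [Gamma (x + 1) = x Gamma x] give
    [D_(b-1) F_mu (z) = \int (1 - t z)^-b dmu(t)], so the fractional derivative of the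
    theorem, call it [G], has [b = a + s].

    Necessity: [(1 - z)^-(gamma + s)] lies in [H(p, oo, gamma)], and the operator maps it
    exactly to [G].

    Sufficiency: on the arc [0 <= theta <= c (1 - r)] the real part of [(1 - t r e^(i theta))^-b]
    is comparable to [(1 - t r)^-b], whence [(1 - r)^s h_(a+s)(r) <= C M_p(G, r)].
    Minkowski's inequality gives [M_p(C_(mu,beta) f, r) <= C h_a(r)].  It remains to pass
    from [w = (1 - r)^s h_(a+s)] to [h_a] in [L^q((1 - r)^(gamma q - 1) dr)]: since
    [(1 - r) h_a' <= a w] and [w <= h_a], this is a Hardy inequality, obtained by integrating
    the derivative of [((1 - r)^gamma h_a)^q]; it holds for every [q > 0]. *)

(** * Complex moduli, limits and power series *)

(** [disc_analytic] only provides a power series around each point. What is used about analytic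
    functions (re-expansion at another centre, uniqueness of coefficients, products, continuity,
    integration in a parameter) is therefore derived from absolutely convergent series. The obstacle
    in sufficiency is that the hypothesis controls [w], which for [s > 0] can be far smaller than
    [h_a] at a given radius; only the integral over [r] recovers [h_a]. The Hardy argument moves a
    multiple of the integral of [h_a^q] to the other side, which is legitimate only where that
    integral is finite. It is run on [[0, x]] with [x < 1], with a bound independent of [x]. The
    length of the arc, proportional to [1 - r], has two effects: [|1 - t z|] is comparable to
    [1 - t r] and its argument stays small for all [t] at once, so that no cancellation occurs under
    the integral; and the length to the power [1/p] is, up to a constant, the factor [(1 - r)^s].
    For [p = oo] one has [s = 0] and [w = h_a]. *)

Section ComplexNorm.
Variable R : realType.
Local Notation C := (R[i]^o).
Implicit Types (z w : C) (u : nat -> C).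
Local Notation Re := (@complex.Re R).
Local Notation Im := (@complex.Im R).

Lemma normrCE z : `|z| = (normc z)%:C.
Proof. by case: z => a b; rewrite (normc_def (a +i* b)). Qed.

Lemma normc_ltE z (r : R) : (`|z| < r%:C) = (normc z < r).
Proof. by rewrite normrCE ltcR. Qed.

Lemma normc_ge0 z : 0 <= normc z.
Proof. by case: z => a b; rewrite sqrtr_ge0. Qed.

Lemma normcD z w : normc (z + w) <= normc z + normc w.
Proof. exact: le_normcD. Qed.

Lemma normcX z n : normc (z ^+ n) = normc z ^+ n.
Proof. by elim: n => [|n ih]; rewrite ?normc1 // !exprS normcM ih. Qed.

Lemma normcR (x : R) : normc x%:C = `|x|.
Proof. by rewrite /= expr0n addr0 sqrtr_sqr. Qed.

Lemma normc_Re z : `|Re z| <= normc z.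
Proof.
case: z => a b /=; rewrite -sqrtr_sqr ler_wsqrtr// lerDl; exact: sqr_ge0.
Qed.

Lemma normc_Im z : `|Im z| <= normc z.
Proof.
case: z => a b /=; rewrite -sqrtr_sqr ler_wsqrtr// lerDr; exact: sqr_ge0.
Qed.

Lemma normc_ReIm z : normc z <= `|Re z| + `|Im z|.
Proof.
case: z => a b /=; rewrite -[leRHS]ger0_norm ?addr_ge0// -sqrtr_sqr ler_wsqrtr//.
by rewrite sqrrD !real_normK ?num_real// addrAC lerDl mulrn_wge0// mulr_ge0.
Qed.

Lemma normcB z w : normc (z - w) = normc (w - z).
Proof. by rewrite -normcN opprB. Qed.

Lemma normc_sum (I : Type) (s : seq I) (P : pred I) (F : I -> C) :
  normc (\sum_(i <- s | P i) F i) <= \sum_(i <- s | P i) normc (F i).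
Proof.
elim/big_rec2: _ => [|i y x _ h]; first by rewrite normc0.
by apply: (le_trans (normcD _ _)); rewrite lerD2l.
Qed.

Lemma ReD z w : Re (z + w) = Re z + Re w. Proof. by case: z; case: w. Qed.
Lemma ImD z w : Im (z + w) = Im z + Im w. Proof. by case: z; case: w. Qed.
Lemma ReB z w : Re (z - w) = Re z - Re w. Proof. by case: z; case: w. Qed.
Lemma ImB z w : Im (z - w) = Im z - Im w. Proof. by case: z; case: w. Qed.
Lemma ReM z w : Re (z * w) = Re z * Re w - Im z * Im w.
Proof. by case: z; case: w. Qed.
Lemma ImM z w : Im (z * w) = Re z * Im w + Im z * Re w.
Proof. by case: z; case: w. Qed.
Lemma ReZ (x : R) z : Re (x%:C * z) = x * Re z.
Proof. by rewrite ReM/= mul0r subr0. Qed.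
Lemma ImZ (x : R) z : Im (x%:C * z) = x * Im z.
Proof. by rewrite ImM/= mul0r addr0. Qed.

Lemma Re_sum (I : Type) (s : seq I) (P : pred I) (F : I -> C) :
  Re (\sum_(i <- s | P i) F i) = \sum_(i <- s | P i) Re (F i).
Proof. by apply: (big_morph Re) => //; exact: ReD. Qed.

Lemma Im_sum (I : Type) (s : seq I) (P : pred I) (F : I -> C) :
  Im (\sum_(i <- s | P i) F i) = \sum_(i <- s | P i) Im (F i).
Proof. by apply: (big_morph Im) => //; exact: ImD. Qed.

Lemma complex_eq z w : Re z = Re w -> Im z = Im w -> z = w.
Proof. by case: z => a b; case: w => c d /= -> ->. Qed.

Lemma cvgC_normP u z :
  u @ \oo --> z <-> (fun n => normc (u n - z)) @ \oo --> (0 : R).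
Proof.
split=> [/cvgrPdist_lt h|/cvgrPdist_lt h]; apply/cvgrPdist_lt => e e0.
- have e0' : (0 : C) < e%:C by rewrite ltcR.
  near=> n; rewrite sub0r normrN ger0_norm ?normc_ge0// normcB -normc_ltE.
  by near: n; exact: h.
(* The order on [R[i]] makes a positive [e] real, so the complex radius can be traded for [Re e]. *)
- have eE : e = (Re e)%:C.
    by rewrite RRe_real// realE ltW.
  have e0' : 0 < Re e by rewrite -ltcR -eE.
  near=> n; rewrite eE normc_ltE normcB -[ltLHS]ger0_norm ?normc_ge0//.
  by rewrite -normrN -sub0r; near: n; exact: h.
Unshelve. all: by end_near. Qed.

Lemma cvgC_ReImP u z : u @ \oo --> z <->
  (fun n => Re (u n)) @ \oo --> Re z /\ (fun n => Im (u n)) @ \oo --> Im z.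
Proof.
rewrite cvgC_normP; split=> [h|[h1 h2]].
  split; apply/cvgrPdist_lt => e e0; near=> n.
    rewrite distrC -ReB (le_lt_trans (normc_Re _))//.
    rewrite -[ltLHS]ger0_norm ?normc_ge0// -normrN -sub0r.
    by near: n; move/cvgrPdist_lt : h; exact.
  rewrite distrC -ImB (le_lt_trans (normc_Im _))//.
  rewrite -[ltLHS]ger0_norm ?normc_ge0// -normrN -sub0r.
  by near: n; move/cvgrPdist_lt : h; exact.
apply: (@squeeze_cvgr _ _ _ _ (fun=> 0)
   (fun n => `|Re (u n) - Re z| + `|Im (u n) - Im z|)).
- by near=> n; rewrite normc_ge0/= -ReB -ImB normc_ReIm.
- exact: cvg_cst.
- rewrite -[0]addr0; apply: cvgD.
    rewrite -(normr0 R) -(subrr (Re z)); apply: cvg_norm; apply: cvgB => //.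
    exact: cvg_cst.
  rewrite -(normr0 R) -(subrr (Im z)); apply: cvg_norm; apply: cvgB => //.
  exact: cvg_cst.
Unshelve. all: by end_near. Qed.

Lemma cvgC_unique u z w : u @ \oo --> z -> u @ \oo --> w -> z = w.
Proof.
move=> /cvgC_ReImP[h1 h2] /cvgC_ReImP[h3 h4].
by apply: complex_eq; [exact: (cvg_unique _ h1 h3)|exact: (cvg_unique _ h2 h4)].
Qed.

Lemma cvgC_lim u z : u @ \oo --> z -> limn u = z.
Proof. by move=> h; apply/cvg_lim. Qed.

Lemma series_Re u n : Re (series u n) = series (fun k => Re (u k)) n.
Proof. by rewrite /series/= Re_sum. Qed.

Lemma series_Im u n : Im (series u n) = series (fun k => Im (u k)) n.
Proof. by rewrite /series/= Im_sum. Qed.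

Lemma seriesC_ReImP u z : series u @ \oo --> z <->
  series (fun k => Re (u k)) @ \oo --> Re z /\
  series (fun k => Im (u k)) @ \oo --> Im z.
Proof.
rewrite cvgC_ReImP.
under eq_cvg do rewrite series_Re.
by under [in X in _ /\ X]eq_cvg do rewrite series_Im.
Qed.

Lemma series_dom_cvg (v : nat -> R) (y : nat -> R) (K : R) :
  (forall n, `|v n| <= y n) -> (forall n, series y n <= K) -> cvgn (series v).
Proof.
move=> vy yK; apply: normed_cvg; apply: nondecreasing_is_cvgn.
  by apply: nondecreasing_series => n _ _ /=.
exists K => _ [n _ <-]; apply: le_trans (yK n).
by rewrite /normed_series_of /series/=; apply: ler_sum => i _.
Qed.

Lemma seriesC_dom_cvg u (y : nat -> R) (K : R) :
  (forall n, normc (u n) <= y n) -> (forall n, series y n <= K) ->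
  exists z, series u @ \oo --> z.
Proof.
move=> uy yK.
have h1 : cvgn (series (fun n => Re (u n))).
  by apply: series_dom_cvg yK => n; rewrite (le_trans (normc_Re _)).
have h2 : cvgn (series (fun n => Im (u n))).
  by apply: series_dom_cvg yK => n; rewrite (le_trans (normc_Im _)).
exists (limn (series (fun n => Re (u n))) +i* limn (series (fun n => Im (u n)))).
by apply/seriesC_ReImP.
Qed.

End ComplexNorm.

(** * Double series and local power series expansions *)

Section DoubleSeries.
Variable R : realType.
Local Notation C := (R[i]^o).
Local Notation Re := (@complex.Re R).
Local Notation Im := (@complex.Im R).

Lemma cvg_sum_nat (T : Type) (F : set_system T) (N : nat) (u : nat -> T -> R)
    (l : nat -> R) : Filter F -> (forall i, u i x @[x --> F] --> l i) ->
  \sum_(0 <= i < N) u i x @[x --> F] --> \sum_(0 <= i < N) l i.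
Proof. by move=> FF h; apply: cvg_big => //; exact: add_continuous. Qed.

Lemma cvg_le_cst (u : nat -> R) (l K : R) :
  u @ \oo --> l -> (forall n, u n <= K) -> l <= K.
Proof.
move=> ul uK; rewrite -(cvg_lim _ ul)//; apply: limr_le; first exact: cvgP ul.
exact: nearW.
Qed.

(** Fubini for absolutely summable families. The error made by keeping [N] rows is at most the tail
    of the series of absolute row sums [y], uniformly in the number [M] of columns ([cN]); for fixed
    [N] the truncated rows converge as [M] grows. *)
Lemma double_series (x : nat -> nat -> R) (r c : nat -> R) (s K : R) :
  (forall N M, \sum_(0 <= i < N) \sum_(0 <= j < M) `|x i j| <= K) ->
  (forall i, series (x i) @ \oo --> r i) ->
  (forall j, series (x ^~ j) @ \oo --> c j) ->
  series r @ \oo --> s -> series c @ \oo --> s.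
Proof.
move=> xK xr xc rs.
have cy i : cvgn (series (fun j => `|x i j|)).
  apply: nondecreasing_is_cvgn; first by apply: nondecreasing_series.
  exists K => _ [M _ <-]; apply: le_trans (xK i.+1 M).
  rewrite big_nat_recr//= lerDr.
  by apply: sumr_ge0 => ? _; apply: sumr_ge0.
pose y i := limn (series (fun j => `|x i j|)).
have xy i M : series (fun j => `|x i j|) M <= y i.
  by apply: nondecreasing_cvgn_le => //; apply: nondecreasing_series.
have y0 i : 0 <= y i by apply: le_trans (xy i 0%N); rewrite /series/= big_geq.
have yK N : series y N <= K.
  have h : (fun M => \sum_(0 <= i < N) series (fun j => `|x i j|) M) @ \oo
      --> series y N.
    by apply: cvg_sum_nat => i; exact: cy.
  by apply: (cvg_le_cst h) => M; exact: xK.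
have ynd : nondecreasing_seq (series y) by apply: nondecreasing_series.
have cY : cvgn (series y).
  by apply: nondecreasing_is_cvgn => //; exists K => _ [n _ <-]; exact: yK.
set Y := limn (series y).
have yY n : series y n <= Y by exact: nondecreasing_cvgn_le.
have dY N N' : (N <= N')%N -> \sum_(N <= i < N') y i <= Y - series y N.
  by move=> NN'; rewrite -(sub_series_geq y NN') lerD2r.
have cN N M :
    `|\sum_(0 <= j < M) c j - \sum_(0 <= i < N) \sum_(0 <= j < M) x i j|
      <= Y - series y N.
  have h : (fun N' => `|\sum_(0 <= j < M) series (x ^~ j) (N' + N)%N -
      \sum_(0 <= i < N) \sum_(0 <= j < M) x i j|) @ \oo -->
      `|\sum_(0 <= j < M) c j - \sum_(0 <= i < N) \sum_(0 <= j < M) x i j|.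
    apply: cvg_norm; apply: cvgB; last exact: cvg_cst.
    by apply: cvg_sum_nat => j; rewrite (cvg_shiftn N); exact: xc.
  apply: (cvg_le_cst h) => N'; rewrite /series/= exchange_big/=.
  rewrite (@big_cat_nat _ _ _ N)//= ?leq_addl// addrAC subrr add0r.
  apply: le_trans (dY N _ (leq_addl N' N)).
  apply: (le_trans (ler_norm_sum _ _ _)); apply: ler_sum => i _.
  by apply: (le_trans (ler_norm_sum _ _ _)); exact: xy.
apply/cvgrPdist_lt => e e0.
have e3 : 0 < e / 3 by rewrite divr_gt0.
have [N [sN YN]] : exists N, `|s - series r N| < e / 3 /\ `|Y - series y N| < e / 3.
  have : \forall N \near \oo,
      `|s - series r N| < e / 3 /\ `|Y - series y N| < e / 3.
    near=> N; split; near: N.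
      by move/cvgrPdist_lt : rs; exact.
    by move/cvgrPdist_lt : cY; exact.
  by move=> [N _ h]; exists N; apply: h => /=.
have hM : (fun M => \sum_(0 <= i < N) \sum_(0 <= j < M) x i j) @ \oo
    --> series r N.
  by apply: cvg_sum_nat => i; exact: xr.
near=> M.
have h1 := cN N M.
have h2 : `|series r N - \sum_(0 <= i < N) \sum_(0 <= j < M) x i j| < e / 3.
  by near: M; move/cvgrPdist_lt : hM; exact.
have YN' := ler_norm (Y - series y N).
rewrite /series/= in sN YN YN' h1 h2 *.
move: (le_lt_trans h1 (le_lt_trans YN' YN)) sN h2.
rewrite !ltr_norml => /andP[a1 a2] /andP[a3 a4] /andP[a5 a6].
by apply/andP; split; lra.
Unshelve. all: by end_near. Qed.

Lemma double_seriesC (x : nat -> nat -> C) (r c : nat -> C) (s : C) (K : R) :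
  (forall N M, \sum_(0 <= i < N) \sum_(0 <= j < M) normc (x i j) <= K) ->
  (forall i, series (x i) @ \oo --> r i) ->
  (forall j, series (x ^~ j) @ \oo --> c j) ->
  series r @ \oo --> s -> series c @ \oo --> s.
Proof.
move=> xK xr xc /seriesC_ReImP[rs1 rs2]; apply/seriesC_ReImP; split.
- apply: (@double_series (fun i j => Re (x i j)) (fun i => Re (r i)) _ _ K) => //.
  + move=> N M; apply: le_trans (xK N M).
    by apply: ler_sum => i _; apply: ler_sum => j _; exact: normc_Re.
  + by move=> i; have /seriesC_ReImP[] := xr i.
  + by move=> i; have /seriesC_ReImP[] := xc i.
- apply: (@double_series (fun i j => Im (x i j)) (fun i => Im (r i)) _ _ K) => //.
  + move=> N M; apply: le_trans (xK N M).
    by apply: ler_sum => i _; apply: ler_sum => j _; exact: normc_Im.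
  + by move=> i; have /seriesC_ReImP[] := xr i.
  + by move=> i; have /seriesC_ReImP[] := xc i.
Qed.

Lemma expandsP (f : C -> C) w (rho : R) a : expands f w rho a <->
  forall z : C, normc (z - w) < rho ->
    series (fun n => a n * (z - w) ^+ n) @ \oo --> f z.
Proof. by split=> h z zw; apply: h; rewrite ?normc_ltE// -normc_ltE. Qed.

Lemma expands_le (f : C -> C) w (rho rho' : R) a :
  rho' <= rho -> expands f w rho a -> expands f w rho' a.
Proof.
move=> h /expandsP fa; apply/expandsP => z zw; apply: fa.
exact: lt_le_trans h.
Qed.

Lemma eq_expands (f g : C -> C) w (rho : R) a :
  (forall z, normc (z - w) < rho -> f z = g z) ->
  expands f w rho a -> expands g w rho a.
Proof. by move=> h /expandsP fa; apply/expandsP => z zw; rewrite -h//; exact: fa. Qed.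

Lemma geometric_sum_le (x : R) n : 0 <= x < 1 ->
  \sum_(0 <= i < n) x ^+ i <= (1 - x)^-1.
Proof.
move=> /andP[x0 x1]; rewrite big_mkord -[leRHS]mul1r ler_pdivlMr ?subr_gt0//.
rewrite mulrC -opprB mulNr -subrX1 opprB gerBl; exact: exprn_ge0.
Qed.

(** Abel's lemma: convergence at an intermediate radius [r'] bounds the terms [a_n r'^n], and the
    sum at [r] is dominated by a geometric series of ratio [r / r']. *)
Lemma expands_abs (f : C -> C) w (rho r : R) a :
  expands f w rho a -> 0 <= r < rho ->
  exists2 K, 0 <= K & forall N, \sum_(0 <= n < N) normc (a n) * r ^+ n <= K.
Proof.
move=> /expandsP fa /andP[r0 rr].
pose r' := (r + rho) / 2.
have [rr' r'r] : r < r' /\ r' < rho by rewrite /r'; split; lra.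
have r'0 : 0 < r' by exact: le_lt_trans rr'.
have := fa (w + r'%:C); rewrite addrAC subrr add0r normcR gtr0_norm//.
move=> /(_ r'r) /seriesC_ReImP[/cvgP/cvg_series_cvg_0 h1 /cvgP/cvg_series_cvg_0 h2].
have [K1 [_ /(_ (K1 + 1))]] := cvg_seq_bounded (cvgP _ h1).
rewrite ltrDl ltr01 => /(_ isT) hK1.
have [K2 [_ /(_ (K2 + 1))]] := cvg_seq_bounded (cvgP _ h2).
rewrite ltrDl ltr01 => /(_ isT) hK2.
have aK n : normc (a n) * r' ^+ n <= `|K1 + 1| + `|K2 + 1|.
  have -> : normc (a n) * r' ^+ n = normc (a n * r'%:C ^+ n).
    by rewrite normcM normcX normcR gtr0_norm.
  apply: (le_trans (normc_ReIm _)); apply: lerD.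
    by apply: le_trans (ler_norm _); apply: hK1.
  by apply: le_trans (ler_norm _); apply: hK2.
pose q := r / r'.
have q01 : 0 <= q < 1 by rewrite /q divr_ge0 ?(ltW r'0)//= ltr_pdivrMr// mul1r.
exists ((`|K1 + 1| + `|K2 + 1|) * (1 - q)^-1).
  by rewrite mulr_ge0// invr_ge0 subr_ge0; case/andP: q01 => _ /ltW.
move=> N; apply: (@le_trans _ _
   (\sum_(0 <= n < N) (`|K1 + 1| + `|K2 + 1|) * q ^+ n)).
  apply: ler_sum => n _.
  have -> : r ^+ n = r' ^+ n * q ^+ n by rewrite -exprMn /q mulrCA divff ?mulr1// gt_eqF.
  rewrite mulrA ler_wpM2r// exprn_ge0//; by case/andP : q01.
rewrite -mulr_sumr ler_wpM2l//; exact: geometric_sum_le.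
Qed.

(** The [k]-th Taylor coefficient after moving the centre by [u]. For [n < k] the binomial
    coefficient vanishes, which makes the truncated subtraction harmless. *)
Definition shift_coef (a : nat -> C) (u : C) (k : nat) : C :=
  limn (series (fun n => a n * 'C(n, k)%:R * u ^+ (n - k)) : nat -> C).

Lemma normc_nat n : normc (n%:R : C) = n%:R.
Proof. by rewrite -(rmorph_nat (real_complex R)) normcR ger0_norm. Qed.

Lemma binomial_term_le (x y : R) n k : 0 <= x -> 0 <= y ->
  'C(n, k)%:R * x ^+ (n - k) * y ^+ k <= (x + y) ^+ n.
Proof.
move=> x0 y0; have [nk|kn] := ltnP n k.
  by rewrite bin_small// !mul0r exprn_ge0// addr_ge0.
rewrite exprDn (bigD1 (Ordinal (kn : (k < n.+1)%N)))//=.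
rewrite -mulrA mulr_natl lerDl sumr_ge0// => i _.
by rewrite mulrn_wge0// mulr_ge0// exprn_ge0.
Qed.

(** [C(n, k) sigma^(n - k) r^k] is one term of the expansion of [(sigma + r)^n], so the hypothesis
    dominates the series. The factor 2 comes from passing to the limit in real and imaginary parts
    separately. *)
Lemma shift_coefP (a : nat -> C) (u : C) (sigma r K : R) k :
  (forall N, \sum_(0 <= n < N) normc (a n) * (sigma + r) ^+ n <= K) ->
  normc u <= sigma -> 0 < r ->
  series (fun n => a n * 'C(n, k)%:R * u ^+ (n - k)) @ \oo --> shift_coef a u k
  /\ normc (shift_coef a u k) * r ^+ k <= 2 * K.
Proof.
move=> aK us r0.
have rk0 : 0 < r ^+ k by rewrite exprn_gt0.
have hb n : normc (a n * 'C(n, k)%:R * u ^+ (n - k)) * r ^+ k <=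
    normc (a n) * (sigma + r) ^+ n.
  rewrite !normcM normcX normc_nat -!mulrA ler_wpM2l ?normc_ge0// mulrA.
  apply: (le_trans (binomial_term_le _ _ _ _)); rewrite ?normc_ge0 ?(ltW r0)//.
  by rewrite lerXn2r ?nnegrE ?addr_ge0 ?normc_ge0 ?(ltW r0)// ?lerD2r// (le_trans _ us) ?normc_ge0.
have hb' n : normc (a n * 'C(n, k)%:R * u ^+ (n - k)) <=
    normc (a n) * (sigma + r) ^+ n / r ^+ k by rewrite ler_pdivlMr.
have hK N : series (fun n => normc (a n) * (sigma + r) ^+ n / r ^+ k) N <= K / r ^+ k.
  by rewrite /series/= -mulr_suml ler_pM2r ?invr_gt0//; exact: aK.
have [z hz] := seriesC_dom_cvg hb' hK.
have -> : shift_coef a u k = z by exact: cvgC_lim.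
split=> //; rewrite -ler_pdivlMr//.
have hn N : normc (series (fun n => a n * 'C(n, k)%:R * u ^+ (n - k)) N) <= K / r ^+ k.
  apply: (le_trans (normc_sum _ _ _)); apply: le_trans (hK N).
  by apply: ler_sum => n _; exact: hb'.
move: hz => /cvgC_ReImP[h1 h2].
apply: (le_trans (normc_ReIm _)).
rewrite mulr2n mulrDl mul1r mulrDl; apply: lerD.
  apply: (cvg_le_cst (cvg_norm h1)) => N; exact: le_trans (normc_Re _) (hn N).
apply: (cvg_le_cst (cvg_norm h2)) => N; exact: le_trans (normc_Im _) (hn N).
Qed.

Lemma finite_series_cvg (u : nat -> C) n :
  (forall k, (n <= k)%N -> u k = 0) ->
  series u @ \oo --> \sum_(0 <= k < n) u k.
Proof.
move=> u0; apply: cvg_near_cst; exists n => // N /= nN.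
by rewrite /series/= (@big_cat_nat _ _ _ n)//= [X in _ + X]big1_seq ?addr0// => i; rewrite mem_index_iota => /andP[_ /andP[ni _]]; exact: u0.
Qed.

(** In the double series [a_n C(n, k) u^(n - k) v^k] the rows sum to [a_n (u + v)^n] by the binomial
    theorem and the columns to the shifted coefficients times [v^k]; absolute values sum to at most
    the absolute series at radius [|u| + |v|]. *)
Lemma expands_shift (f : C -> C) (w w1 : C) (rho : R) a :
  expands f w rho a -> normc (w1 - w) < rho ->
  expands f w1 (rho - normc (w1 - w)) (shift_coef a (w1 - w)).
Proof.
move=> fa w1w; apply/expandsP => z zw1.
set u := w1 - w in w1w zw1 *; set v := z - w1 in zw1 *.
have uvE : z - w = u + v by rewrite /u /v; ring.
have [K K0 aK] : exists2 K, 0 <= K &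
    forall N, \sum_(0 <= n < N) normc (a n) * (normc u + normc v) ^+ n <= K.
  by apply: (expands_abs fa); rewrite addr_ge0 ?normc_ge0//= addrC -ltrBrDr.
(* The columns are handled at a radius beyond [|v|], positive even when [v = 0]. *)
have [r vr ru] : exists2 r, normc v < r & normc u + r < rho.
  by exists ((normc v + (rho - normc u)) / 2); lra.
have r0 : 0 < r by rewrite (le_lt_trans _ vr) ?normc_ge0.
have [K' _ aK'] : exists2 K, 0 <= K &
    forall N, \sum_(0 <= n < N) normc (a n) * (normc u + r) ^+ n <= K.
  by apply: (expands_abs fa); rewrite addr_ge0 ?normc_ge0 ?(ltW r0).
have rowE n : \sum_(0 <= k < n.+1) a n * 'C(n, k)%:R * u ^+ (n - k) * v ^+ k
    = a n * (z - w) ^+ n.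
  rewrite uvE exprDn mulr_sumr big_mkord; apply: eq_bigr => k _.
  by rewrite -[in RHS]mulr_natl; ring.
apply: (@double_seriesC (fun n k => a n * 'C(n, k)%:R * u ^+ (n - k) * v ^+ k)
  (fun n => a n * (z - w) ^+ n) _ (f z) K).
- move=> N M; apply: le_trans (aK N); apply: ler_sum => n _.
  have -> : normc (a n) * (normc u + normc v) ^+ n =
    \sum_(0 <= k < n.+1) normc (a n * 'C(n, k)%:R * u ^+ (n - k) * v ^+ k).
    rewrite exprDn mulr_sumr big_mkord; apply: eq_bigr => k _.
    by rewrite !normcM !normcX normc_nat -mulr_natl; ring.
  have [Mn|nM] := leqP M n.+1.
    rewrite [leRHS](@big_cat_nat _ _ _ M)//= lerDl sumr_ge0// => k _.
    exact: normc_ge0.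
  rewrite [leLHS](@big_cat_nat _ _ _ n.+1)//=; last exact: ltnW.
  rewrite [X in _ + X]big1_seq ?addr0//.
  move=> k; rewrite mem_index_iota => /andP[_ /andP[nk _]].
  by rewrite bin_small// mulr0 !mul0r normc0.
- move=> n; rewrite -rowE; apply: finite_series_cvg => k nk.
  by rewrite bin_small// mulr0 !mul0r.
- move=> k; have [h _] := shift_coefP k aK' (lexx _) r0.
  move: h => /cvgC_ReImP[h1 h2]; apply/cvgC_ReImP.
  have E n : series (fun n => a n * 'C(n, k)%:R * u ^+ (n - k) * v ^+ k) n =
    series (fun n => a n * 'C(n, k)%:R * u ^+ (n - k)) n * v ^+ k.
    by rewrite /series/= mulr_suml.
  split.
    under eq_cvg do rewrite E ReM.
    by rewrite ReM; apply: cvgB; apply: cvgMl.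
  under eq_cvg do rewrite E ImM.
  by rewrite ImM; apply: cvgD; apply: cvgMl.
- by move/expandsP: fa; apply; rewrite uvE (le_lt_trans (normcD _ _))// addrC -ltrBrDr.
Qed.


Lemma cvgC_mulr (u : nat -> C) (l v : C) :
  u @ \oo --> l -> (fun n => u n * v) @ \oo --> l * v.
Proof.
move=> /cvgC_ReImP[h1 h2]; apply/cvgC_ReImP; split.
  by under eq_cvg do rewrite ReM; rewrite ReM; apply: cvgB; apply: cvgMl.
by under eq_cvg do rewrite ImM; rewrite ImM; apply: cvgD; apply: cvgMl.
Qed.

Lemma eq_cvgC (u v : nat -> C) (l : C) :
  (forall n, u n = v n) -> v @ \oo --> l -> u @ \oo --> l.
Proof. by move=> /funext ->. Qed.

Lemma cvgC_add (u v : nat -> C) (l m : C) : u @ \oo --> l -> v @ \oo --> m ->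
  (fun n => u n + v n) @ \oo --> l + m.
Proof.
move=> /cvgC_ReImP[h1 h2] /cvgC_ReImP[h3 h4]; apply/cvgC_ReImP; split.
  by under eq_cvg do rewrite ReD; rewrite ReD; apply: cvgD.
by under eq_cvg do rewrite ImD; rewrite ImD; apply: cvgD.
Qed.

Lemma cvgC_sub (u v : nat -> C) (l m : C) : u @ \oo --> l -> v @ \oo --> m ->
  (fun n => u n - v n) @ \oo --> l - m.
Proof.
move=> /cvgC_ReImP[h1 h2] /cvgC_ReImP[h3 h4]; apply/cvgC_ReImP; split.
  by under eq_cvg do rewrite ReB; rewrite ReB; apply: cvgB.
by under eq_cvg do rewrite ImB; rewrite ImB; apply: cvgB.
Qed.

Lemma expandsD (f g : C -> C) (w : C) (rho : R) a b :
  expands f w rho a -> expands g w rho b ->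
  expands (fun z => f z + g z) w rho (fun k => a k + b k).
Proof.
move=> /expandsP fa /expandsP gb; apply/expandsP => z zw.
have E n : series (fun n => (a n + b n) * (z - w) ^+ n) n =
  series (fun n => a n * (z - w) ^+ n) n + series (fun n => b n * (z - w) ^+ n) n.
  by rewrite /series/= -big_split; apply: eq_bigr => i _; rewrite mulrDl.
by apply: (eq_cvgC E); apply: cvgC_add; [exact: fa|exact: gb].
Qed.

(** The Cauchy product as a double series: the entry [(i, k)] is [a_i b_(k - i) v^k] for [i <= k]
    and 0 otherwise, so rows sum to [a_i v^i g(z)] and columns are finite. *)
Lemma expandsM (f g : C -> C) (w : C) (rho : R) a b :
  expands f w rho a -> expands g w rho b ->
  expands (fun z => f z * g z) w rho (fun k => \sum_(0 <= i < k.+1) a i * b (k - i)%N).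
Proof.
move=> fa gb; apply/expandsP => z zw; set v := z - w in zw *.
have v0 : 0 <= normc v < rho by rewrite normc_ge0.
have [Ka Ka0 hKa] := expands_abs fa v0.
have [Kb Kb0 hKb] := expands_abs gb v0.
pose x (i k : nat) : C := if (i <= k)%N then a i * b (k - i)%N * v ^+ k else 0.
have xE i j : x i (j + i)%N = a i * v ^+ i * (b j * v ^+ j).
  by rewrite /x leq_addl addnK exprD; ring.
have xsum i M : \sum_(0 <= k < M) normc (x i k) <= normc (a i) * normc v ^+ i * Kb.
  have h0 : 0 <= normc (a i) * normc v ^+ i by rewrite mulr_ge0 ?exprn_ge0 ?normc_ge0.
  have [Mi|iM] := leqP M i.
    rewrite big1_seq; first by rewrite mulr_ge0.
    move=> k; rewrite mem_index_iota => /andP[_ /andP[_ kM]].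
    have -> : x i k = 0 by rewrite /x leqNgt (leq_trans kM Mi).
    exact: normc0.
  rewrite [leLHS](@big_cat_nat _ _ _ i)//=; last exact: ltnW.
  rewrite big1_seq ?add0r; last first.
    move=> k; rewrite mem_index_iota => /andP[_ /andP[_ kM]].
    have -> : x i k = 0 by rewrite /x leqNgt kM.
    exact: normc0.
  rewrite -{1}(add0n i) big_addn; apply: le_trans (ler_wpM2l h0 (hKb (M - i)%N)).
  rewrite mulr_sumr; apply: ler_sum => j _.
  by rewrite xE !normcM !normcX.
apply: (@double_seriesC x (fun i => a i * v ^+ i * g z) _ (f z * g z) (Ka * Kb)).
- move=> N M; apply: (@le_trans _ _
    (\sum_(0 <= i < N) normc (a i) * normc v ^+ i * Kb)).
    by apply: ler_sum => i _; exact: xsum.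
  by rewrite -mulr_suml ler_wpM2r.
- move=> i; rewrite -(cvg_shiftn i).
  have E n : series (x i) (n + i)%N = series (fun j => b j * v ^+ j) n * (a i * v ^+ i).
    rewrite /series/= (@big_cat_nat _ _ _ i)//=; last exact: leq_addl.
    rewrite [X in X + _]big1_seq ?add0r; last first.
      move=> k; rewrite mem_index_iota => /andP[_ /andP[_ kM]].
      by rewrite /x leqNgt kM.
    rewrite -{1}(add0n i) big_addn addnK mulr_suml; apply: eq_bigr => j _.
    by rewrite xE mulrC.
  rewrite mulrC; apply: (eq_cvgC E).
  by apply: cvgC_mulr; move/expandsP : gb; apply; case/andP: v0.
- move=> k; have -> : (\sum_(0 <= i < k.+1) a i * b (k - i)%N) * v ^+ k =
      \sum_(0 <= i < k.+1) x i k.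
    rewrite mulr_suml !big_mkord; apply: eq_bigr => i _.
    by rewrite /x -ltnS ltn_ord.
  by apply: finite_series_cvg => i ki; rewrite /x leqNgt ki.
- have E n : series (fun i => a i * v ^+ i * g z) n = series (fun i => a i * v ^+ i) n * g z.
    by rewrite /series/= mulr_suml.
  apply: (eq_cvgC E).
  by apply: cvgC_mulr; move/expandsP : fa; apply; case/andP: v0.
Qed.

Lemma expands_center (f : C -> C) (w : C) (rho : R) a :
  0 < rho -> expands f w rho a -> f w = a 0%N.
Proof.
move=> rho0 /expandsP fa; have := fa w; rewrite subrr normc0 => /(_ rho0) h.
apply: (cvgC_unique h); rewrite -[a 0%N]mulr1.
have := @finite_series_cvg (fun n => a n * (0 : C) ^+ n) 1.
rewrite big_nat1 expr0; apply => -[//|k _]; by rewrite expr0n mulr0.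
Qed.

(** Beyond the index [m], [s^n = (s / r)^n r^n] gains the factor [(s / r)^m]. The case [m = 1]
    yields a Lipschitz bound at the centre, general [m] the uniqueness of coefficients. *)
Lemma tail_le (a : nat -> C) (s r K : R) m N : 0 <= s <= r -> 0 < r ->
  (forall N, \sum_(0 <= n < N) normc (a n) * r ^+ n <= K) ->
  \sum_(m <= n < N) normc (a n) * s ^+ n <= (s / r) ^+ m * K.
Proof.
move=> /andP[s0 sr] r0 aK.
have q0 : 0 <= s / r by rewrite divr_ge0// ltW.
have q1 : s / r <= 1 by rewrite ler_pdivrMr// mul1r.
have [Nm|mN] := leqP N m.
  rewrite big_geq// mulr_ge0 ?exprn_ge0//; apply: le_trans (aK 0%N).
  by rewrite big_geq.
apply: (@le_trans _ _ (\sum_(m <= n < N) (s / r) ^+ m * (normc (a n) * r ^+ n))).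
  apply: ler_sum_nat => n /andP[mn _].
  have -> : s ^+ n = (s / r) ^+ n * r ^+ n by rewrite -exprMn divfK// gt_eqF.
  rewrite mulrCA ler_wpM2r//; first by rewrite mulr_ge0 ?normc_ge0 ?exprn_ge0// ltW.
  by rewrite ler_wiXn2l.
rewrite -mulr_sumr ler_wpM2l ?exprn_ge0//; apply: le_trans (aK N).
rewrite [leRHS](@big_cat_nat _ _ _ m)//=; last exact: ltnW.
by rewrite lerDr sumr_ge0// => n _; rewrite mulr_ge0 ?normc_ge0 ?exprn_ge0// ltW.
Qed.

(** The terms with [n >= 1] are bounded by [tail_le]; [K + 1] replaces [K] to have a positive
    constant. The purpose is continuity of [f] along paths. *)
Lemma expands_lip (f : C -> C) (w : C) (rho : R) a :
  0 < rho -> expands f w rho a ->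
  exists r K : R, [/\ 0 < r, 0 < K & forall z, normc (z - w) <= r ->
    normc (f z - f w) <= K * normc (z - w)].
Proof.
move=> rho0 fa; pose r := rho / 2.
have r0 : 0 < r by rewrite divr_gt0.
have rr : 0 <= r < rho by rewrite (ltW r0) ltr_pdivrMr// ltr_pMr// ltr1n.
have [K K0 hK] := expands_abs fa rr.
exists r, ((K + 1) / r); split; [exact: r0|by rewrite divr_gt0// ltr_wpDl|].
move=> z zw; rewrite (expands_center rho0 fa).
have h : series (fun n => a n * (z - w) ^+ n) @ \oo --> f z.
  by move/expandsP : fa; apply; apply: (le_lt_trans zw); case/andP: rr.
move/cvgC_normP : h; rewrite -cvg_shiftS => h.
rewrite -[normc _]addr0 -[leRHS]add0r.
have {}h : (fun n => normc (series (fun n => a n * (z - w) ^+ n) n.+1 - f z)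
   - normc (f z - a 0%N)) @ \oo --> 0 - normc (f z - a 0%N).
  by apply: cvgB => //; exact: cvg_cst.
rewrite addr0 add0r -lerN2 -[leRHS]add0r.
rewrite -(cvg_lim _ h)//; apply: limr_ge; first exact: cvgP h.
apply: nearW => N.
have ht : normc (series (fun n => a n * (z - w) ^+ n) N.+1 - a 0%N) <=
    (K + 1) / r * normc (z - w).
  rewrite /series/= big_nat_recl// expr0 mulr1 addrAC subrr add0r.
  rewrite -(big_add1 _ _ 0%N N.+1 xpredT (fun n => a n * (z - w) ^+ n)).
  apply: (le_trans (normc_sum _ _ _)).
  under eq_bigr do rewrite normcM normcX.
  apply: (le_trans (@tail_le a (normc (z - w)) r K 1 N.+1 _ r0 hK)).
    by rewrite normc_ge0.
  rewrite expr1 mulrAC [leRHS]mulrAC ler_pM2r ?invr_gt0// mulrC.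
  by rewrite ler_wpM2r ?normc_ge0// lerDl.
rewrite lerNl opprB lerBlDl; apply: le_trans (lerD (lexx _) ht).
rewrite (normcB _ (f z)); apply: le_trans (normcD _ _).
by rewrite addrA subrK.
Qed.

(** If the difference [c] of the two sequences vanishes below [m], evaluation at distance [s] from
    the centre gives [|c_m| s^m <= (s / r)^(m + 1) K]. Division by [s^m] leaves a bound that tends
    to 0 with [s]. *)
Lemma expands_uniq (f : C -> C) (w : C) (rho : R) a b :
  0 < rho -> expands f w rho a -> expands f w rho b -> a = b.
Proof.
move=> rho0 fa fb; pose c k := a k - b k.
have gc : expands (fun=> 0) w rho c.
  apply/expandsP => z zw.
  have E n : series (fun n => c n * (z - w) ^+ n) n =
    series (fun n => a n * (z - w) ^+ n) n - series (fun n => b n * (z - w) ^+ n) n.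
    by rewrite /series/= -sumrB; apply: eq_bigr => i _; rewrite mulrBl.
  apply: (eq_cvgC E).
  move/expandsP : fa => /(_ z zw) fa; move/expandsP : fb => /(_ z zw) fb.
  by have := cvgC_sub fa fb; rewrite subrr.
pose r := rho / 2.
have r0 : 0 < r by rewrite divr_gt0.
have rr : 0 <= r < rho by rewrite (ltW r0) ltr_pdivrMr// ltr_pMr// ltr1n.
have [K K0 hK] := expands_abs gc rr.
suff c0 m : c m = 0 by apply/funext => m; apply/eqP; rewrite -subr_eq0; apply/eqP/c0.
elim/ltn_ind : m => m ih; apply: eq0_normc; apply/eqP.
rewrite eq_le normc_ge0 andbT; apply/ler_addgt0Pr => e e0; rewrite add0r.
(* After division the bound is [s K / r^(m + 1)], at most [s M]; the added 1 allows division by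
   [M]. *)
pose M := K / r ^+ m.+1 + 1.
have M0 : 0 < M by rewrite /M ltr_wpDl// divr_ge0// exprn_ge0// ltW.
pose s := Num.min r (e / M).
have s0 : 0 < s by rewrite lt_min r0 divr_gt0.
have sr : s <= r by rewrite ge_min lexx.
have se : s * M <= e by rewrite -ler_pdivlMr// ge_min lexx orbT.
have sE : normc (w + s%:C - w) = s by rewrite addrAC subrr add0r normcR gtr0_norm.
have h : normc (c m) * s ^+ m <= (s / r) ^+ m.+1 * K.
  have hz : series (fun n => c n * (w + s%:C - w) ^+ n) @ \oo --> (0 : C).
    by move/expandsP : gc; apply; rewrite sE (le_lt_trans sr)//; case/andP: rr.
  move/cvgC_normP : hz; rewrite -(cvg_shiftn m.+1) => hz.
  rewrite -subr_le0; apply: (cvg_le_cst (u := fun n => normc (c m) * s ^+ m - (s / r) ^+ m.+1 * K - normc (series (fun n => c n * (w + s%:C - w) ^+ n) (n + m.+1)%N - 0))).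
    rewrite -[X in _ --> X]subr0; apply: cvgB => //; exact: cvg_cst.
  move=> N; rewrite subr0 lerBlDr add0r lerBlDr.
  rewrite /series/= (@big_cat_nat _ _ _ m.+1)//=; last exact: leq_addl.
  rewrite big_nat_recr//= big1_seq ?add0r; last first.
    by move=> k; rewrite mem_index_iota => /andP[_ /andP[_ km]]; rewrite ih// mul0r.
  set T := \sum_(m.+1 <= _ < _) _.
  have -> : normc (c m) * s ^+ m = normc (c m * (w + s%:C - w) ^+ m).
    by rewrite normcM normcX sE.
  have hT : normc T <= (s / r) ^+ m.+1 * K.
    apply: (le_trans (normc_sum _ _ _)).
    under eq_bigr do rewrite normcM normcX sE.
    by apply: tail_le => //; rewrite (ltW s0).
  apply: le_trans (lerD (lexx _) hT).
  by have := normcD (c m * (w + s%:C - w) ^+ m + T) (- T); rewrite addrK normcN.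
apply: le_trans se; rewrite -(@ler_pM2r _ (s ^+ m)) ?exprn_gt0//.
apply: (le_trans h); rewrite expr_div_n mulrAC -mulrA [leRHS]mulrAC -exprS.
by rewrite ler_wpM2l ?exprn_ge0 ?(ltW s0)// /M lerDl.
Qed.

Lemma unit_discE (z : C) : unit_disc z = (normc z < 1) :> Prop.
Proof. by rewrite /unit_disc/= -(normc_ltE z 1). Qed.

(** The radius is cut to [1 - |w|], since the functions agree only on the disc. *)
Lemma eq_disc_analytic (f g : C -> C) :
  (forall z, normc z < 1 -> f z = g z) -> disc_analytic f -> disc_analytic g.
Proof.
move=> fg fa w wD; have [rho [a [rho0 fwa]]] := fa w wD.
rewrite unit_discE in wD.
exists (Num.min rho (1 - normc w)), a; split; first by rewrite lt_min rho0 subr_gt0.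
apply: (@eq_expands f); last by apply: expands_le fwa; rewrite ge_min lexx.
move=> z; rewrite lt_min => /andP[_ zw]; apply: fg.
by have := normcD (z - w) w; rewrite subrK; move: zw; lra.
Qed.

Lemma disc_analyticM (f g : C -> C) : disc_analytic f -> disc_analytic g ->
  disc_analytic (fun z => f z * g z).
Proof.
move=> fa ga w wD; have [r1 [a [r10 fwa]]] := fa w wD.
have [r2 [b [r20 gwb]]] := ga w wD.
exists (Num.min r1 r2), (fun k => \sum_(0 <= i < k.+1) a i * b (k - i)%N).
split; first by rewrite lt_min r10.
by apply: expandsM; [apply: expands_le fwa|apply: expands_le gwb]; rewrite ge_min lexx ?orbT.
Qed.

Lemma expands_disc_analytic (f : C -> C) a : expands f 0 1 a -> disc_analytic f.
Proof.
move=> fa w; rewrite unit_discE => wD.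
exists (1 - normc (w - 0)), (shift_coef a (w - 0)); split.
  by rewrite subr0 subr_gt0.
by apply: expands_shift fa _; rewrite subr0.
Qed.

(** [taylor_coef] picks some expansion; uniqueness of coefficients makes the choice immaterial. *)
Lemma taylor_coefE (f : C -> C) a : expands f 0 1 a -> taylor_coef f = a.
Proof.
move=> fa; rewrite /taylor_coef; case: xgetP => [b _ fb|]; last by move=> /(_ a).
exact: (expands_uniq ltr01 fb fa).
Qed.

End DoubleSeries.

(** * Integrals depending analytically on a parameter *)

Section ComplexIntegral.
Variable R : realType.
Local Notation C := (R[i]^o).
Local Notation Re := (@complex.Re R).
Local Notation Im := (@complex.Im R).
Local Notation Rm := (measurableTypeR R).
Variable mu : {finite_measure set Rm -> \bar R}.
Implicit Types (D : set Rm) (g h : R -> C).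

Definition cmeasurable D g :=
  measurable_fun D (fun t : Rm => Re (g t)) /\
  measurable_fun D (fun t : Rm => Im (g t)).

Definition cbounded D g := exists M : R, forall t, D t -> normc (g t) <= M.

Lemma cmeasurable_cst D (c : C) : cmeasurable D (fun=> c).
Proof. by split; exact: measurable_cst. Qed.

Lemma cmeasurableD D g h :
  cmeasurable D g -> cmeasurable D h -> cmeasurable D (fun t => g t + h t).
Proof.
move=> [g1 g2] [h1 h2]; split.
  by under eq_fun do rewrite ReD; exact: measurable_funD.
by under eq_fun do rewrite ImD; exact: measurable_funD.
Qed.

Lemma cmeasurableM D g h :
  cmeasurable D g -> cmeasurable D h -> cmeasurable D (fun t => g t * h t).
Proof.
move=> [g1 g2] [h1 h2]; split.
  by under eq_fun do rewrite ReM; apply: measurable_funB; exact: measurable_funM.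
by under eq_fun do rewrite ImM; apply: measurable_funD; exact: measurable_funM.
Qed.

Lemma cmeasurableX D g n : cmeasurable D g -> cmeasurable D (fun t => g t ^+ n).
Proof.
move=> mg; elim: n => [|n ih]; first exact: cmeasurable_cst.
by under eq_fun do rewrite exprS; exact: cmeasurableM.
Qed.

Lemma cmeasurable_sum D (g : nat -> R -> C) n :
  (forall k, cmeasurable D (g k)) ->
  cmeasurable D (fun t => \sum_(0 <= k < n) g k t).
Proof.
move=> mg; elim: n => [|n ih].
  by under eq_fun do rewrite big_geq//; exact: cmeasurable_cst.
by under eq_fun do rewrite big_nat_recr//=; exact: cmeasurableD.
Qed.

Lemma cmeasurable_id D : cmeasurable D (fun t => t%:C).
Proof. by split => /=; [exact: measurable_id|exact: measurable_cst]. Qed.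

Lemma cmeasurable_cvg D (g : nat -> R -> C) (l : R -> C) :
  (forall n, cmeasurable D (g n)) ->
  (forall t, D t -> (fun n => g n t) @ \oo --> l t) -> cmeasurable D l.
Proof.
move=> mg gl; split.
  apply: (@measurable_fun_cvg _ _ _ D (fun n t => Re (g n t))).
    by move=> n; have [] := mg n.
  by move=> t Dt; have /cvgC_ReImP[] := gl t Dt.
apply: (@measurable_fun_cvg _ _ _ D (fun n t => Im (g n t))).
  by move=> n; have [] := mg n.
by move=> t Dt; have /cvgC_ReImP[] := gl t Dt.
Qed.

Lemma bounded_integrable D (f : R -> R) (M : R) : measurable D ->
  measurable_fun D (f : Rm -> R) -> (forall t, D t -> `|f t| <= M) ->
  mu.-integrable D (fun t => (f t)%:E).
Proof.
move=> mD mf fM; apply: (le_integrable mD _ _ (finite_measure_integrable_cst mu M mD)).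
  exact/measurable_EFinP.
move=> t Dt /=; rewrite lee_fin (le_trans (fM t Dt))//; exact: ler_norm.
Qed.

Lemma cintegrable D g : measurable D -> cmeasurable D g -> cbounded D g ->
  mu.-integrable D (fun t => (Re (g t))%:E) /\
  mu.-integrable D (fun t => (Im (g t))%:E).
Proof.
move=> mD [m1 m2] [M gM]; split; apply: (@bounded_integrable _ _ M) => // t Dt.
  exact: le_trans (normc_Re _) (gM t Dt).
exact: le_trans (normc_Im _) (gM t Dt).
Qed.

(** The domain is a parameter, unlike in [cintegral01], because the proof of analyticity cuts [[0,
    1[] into pieces. *)
Definition cint D g : C :=
  (\int[mu]_(t in D) Re (g t)) +i* (\int[mu]_(t in D) Im (g t)).

Lemma eq_cint D g h : (forall t, D t -> g t = h t) -> cint D g = cint D h.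
Proof.
by move=> gh; congr (_ +i* _); apply: eq_Rintegral => t; rewrite inE => Dt; rewrite gh.
Qed.

Lemma cintMr D g (c : C) : measurable D -> cmeasurable D g -> cbounded D g ->
  cint D (fun t => g t * c) = cint D g * c.
Proof.
move=> mD mg bg; have [i1 i2] := cintegrable mD mg bg.
have iZ (f : R -> R) (x : R) : mu.-integrable D (fun t => (f t)%:E) ->
    mu.-integrable D (fun t => (f t * x)%:E).
  by move=> fi; have := integrableZr mD x fi.
have N (f : R -> R) : - f = (fun t => (-1) * f t).
  by apply/funext => t; rewrite mulN1r.
apply: complex_eq; rewrite ?ReM ?ImM /=.
  under eq_Rintegral do rewrite ReM.
  by rewrite RintegralB ?RintegralZr//; exact: iZ.
under eq_Rintegral do rewrite ImM.
by rewrite RintegralD ?RintegralZr//; exact: iZ.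
Qed.

Lemma cint_setU D D' g : measurable D -> measurable D' -> [disjoint D & D'] ->
  cmeasurable (D `|` D') g -> cbounded (D `|` D') g ->
  cint (D `|` D') g = cint D g + cint D' g.
Proof.
move=> mD mD' DD' mg bg.
have [i1 i2] := cintegrable (measurableU _ _ mD mD') mg bg.
by apply: complex_eq; rewrite ?ReD ?ImD /= Rintegral_setU.
Qed.

(** With [I] the integral, [|I|^2] is the integral of [Re (conj I * g)], hence at most [|I|] times
    the integral of [|g|]; then divide by [|I|]. *)
Lemma normc_cint_le D g : measurable D -> cmeasurable D g -> cbounded D g ->
  measurable_fun D (fun t : Rm => normc (g t)) /\
  normc (cint D g) <= \int[mu]_(t in D) normc (g t).
Proof.
move=> mD mg bg; have [i1 i2] := cintegrable mD mg bg.
have mn : measurable_fun D (fun t : Rm => normc (g t)).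
  rewrite (_ : (fun t => _) = (fun t => Num.sqrt (Re (g t) ^+ 2 + Im (g t) ^+ 2))).
    apply: (measurableT_comp (continuous_measurable_fun (@sqrt_continuous R))).
    by apply: measurable_funD; apply: measurable_funX; case: mg.
  by apply/funext => t; case: (g t).
split=> //.
have iN : mu.-integrable D (fun t => (normc (g t))%:E).
  have [M gM] := bg; apply: (@bounded_integrable _ _ M) => // t Dt.
  by rewrite ger0_norm ?normc_ge0// gM.
set I := cint D g.
have [I0|I0] := eqVneq (normc I) 0.
  by rewrite I0 Rintegral_ge0// => t _; exact: normc_ge0.
have Ip : 0 < normc I by rewrite lt_def I0 normc_ge0.
have sq : normc I ^+ 2 = Re I ^+ 2 + Im I ^+ 2.
  by rewrite [I]lock; case: (locked I) => a b /=; rewrite sqr_sqrtr// addr_ge0 ?sqr_ge0.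
rewrite -(ler_pM2l Ip) -expr2 sq -RintegralZl//.
have iZ (f : R -> R) (x : R) : mu.-integrable D (fun t => (f t)%:E) ->
    mu.-integrable D (fun t => (x * f t)%:E).
  by move=> fi; have := integrableZl mD x fi.
have -> : Re I ^+ 2 + Im I ^+ 2 =
    \int[mu]_(t in D) (Re I * Re (g t) + Im I * Im (g t)).
  by rewrite RintegralD//; [rewrite !RintegralZl// !expr2|exact: iZ|exact: iZ].
apply: le_Rintegral => //.
- exact: (integrableD mD (iZ _ (Re I) i1) (iZ _ (Im I) i2)).
- exact: iZ.
- move=> t Dt.
  have -> : Re I * Re (g t) + Im I * Im (g t) = Re ((conjc I) * g t).
    by rewrite ReM; case: (I) => a b /=; rewrite mulNr opprK.
  apply: (le_trans (ler_norm _)); apply: (le_trans (normc_Re _)).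
  by rewrite normcM; case: (I) => a b /=; rewrite sqrrN.
Qed.

(** Dominated convergence for the partial sums; the constant [K] is an integrable majorant because
    [mu] is finite. *)
Lemma series_Rint D (c : nat -> R -> R) (y : nat -> R) (F : R -> R) (K : R) :
  measurable D -> (forall k, measurable_fun D (c k : Rm -> R)) ->
  (forall k t, D t -> `|c k t| <= y k) -> (forall n, series y n <= K) ->
  (forall t, D t -> series (fun k => c k t) @ \oo --> F t) ->
  series (fun k => \int[mu]_(t in D) c k t) @ \oo --> \int[mu]_(t in D) F t.
Proof.
move=> mD mc cy yK cF.
have ms n : measurable_fun D (fun t : Rm => \sum_(0 <= k < n) c k t).
  exact: measurable_sum.
have mF : measurable_fun D (F : Rm -> R).
  exact: (@measurable_fun_cvg _ _ _ D _ F ms cF).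
have sK n t : D t -> `|\sum_(0 <= k < n) c k t| <= K.
  move=> Dt; apply: (le_trans (ler_norm_sum _ _ _)); apply: le_trans (yK n).
  by apply: ler_sum => k _; exact: cy.
have ic k : mu.-integrable D (fun t => (c k t)%:E) by apply: bounded_integrable (cy k).
have [|||||iF _ h] := @dominated_convergence _ _ _ mu D mD
  (fun n t => (\sum_(0 <= k < n) c k t)%:E) (fun t => (F t)%:E) (cst K%:E).
- by move=> n; apply/measurable_EFinP; exact: ms.
- exact/measurable_EFinP.
- apply: aeW => t Dt; apply: cvg_EFin; first exact: nearW.
  exact: cF.
- exact: finite_measure_integrable_cst.
- by apply: aeW => t n Dt; rewrite /= lee_fin sK.
have E n : series (fun k => \int[mu]_(t in D) c k t) n =
    \int[mu]_(t in D) (\sum_(0 <= k < n) c k t).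
  elim: n => [|n ih].
    rewrite /series/= big_geq//; under eq_Rintegral do rewrite big_geq//.
    by rewrite Rintegral_cst// mul0r.
  move: ih; rewrite /series/= => ih; rewrite big_nat_recr//= ih.
  under [RHS]eq_Rintegral do rewrite big_nat_recr//=.
  by rewrite (RintegralD mD (bounded_integrable mD (ms n) (sK n)) (ic n)).
rewrite (_ : series _ = fun n => \int[mu]_(t in D) (\sum_(0 <= k < n) c k t)); last exact/funext.
apply: fine_cvg; rewrite fineK//.
exact: integrable_fin_num.
Qed.

Lemma series_cint D (c : nat -> R -> C) (y : nat -> R) (F : R -> C) (K : R) :
  measurable D -> (forall k, cmeasurable D (c k)) ->
  (forall k t, D t -> normc (c k t) <= y k) -> (forall n, series y n <= K) ->
  (forall t, D t -> series (fun k => c k t) @ \oo --> F t) ->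
  series (fun k => cint D (c k)) @ \oo --> cint D F.
Proof.
move=> mD mc cy yK cF; apply/seriesC_ReImP; split=> /=.
  apply: (series_Rint mD _ _ yK).
  - by move=> k; have [] := mc k.
  - by move=> k t Dt; apply: le_trans (cy k t Dt); exact: normc_Re.
  - by move=> t Dt; have /seriesC_ReImP[] := cF t Dt.
apply: (series_Rint mD _ _ yK).
- by move=> k; have [] := mc k.
- by move=> k t Dt; apply: le_trans (cy k t Dt); exact: normc_Im.
- by move=> t Dt; have /seriesC_ReImP[] := cF t Dt.
Qed.


Definition ccontinuous (gam : R -> C) := continuous (Re \o gam) /\ continuous (Im \o gam).

Lemma ccontinuous_near (gam : R -> C) (t e : R) : ccontinuous gam -> 0 < e ->
  \forall t' \near t, normc (gam t' - gam t) < e.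
Proof.
move=> [c1 c2] e0; have e2 : 0 < e / 2 by rewrite divr_gt0.
near=> t'.
apply: (le_lt_trans (normc_ReIm _)); rewrite ReB ImB (splitr e) ltrD//.
  by rewrite distrC; near: t'; have /cvgrPdist_lt := c1 t; exact.
by rewrite distrC; near: t'; have /cvgrPdist_lt := c2 t; exact.
Unshelve. all: by end_near. Qed.

Lemma near_ccontinuous (gam : R -> C) : (forall t e : R, 0 < e ->
  \forall t' \near t, normc (gam t' - gam t) < e) -> ccontinuous gam.
Proof.
move=> h; split=> t; apply/cvgrPdist_lt => e e0; near=> t'.
  rewrite distrC -ReB (le_lt_trans (normc_Re _))//.
  by near: t'; exact: h.
rewrite distrC -ImB (le_lt_trans (normc_Im _))//.
by near: t'; exact: h.
Unshelve. all: by end_near. Qed.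

Lemma disc_analytic_continuous (f : C -> C) (gam : R -> C) : disc_analytic f ->
  (forall t, normc (gam t) < 1) -> ccontinuous gam -> ccontinuous (f \o gam).
Proof.
move=> fa g1 cg; apply: near_ccontinuous => t e e0 /=.
have [rho [a [rho0 ft]]] : exists (rho : R) a, 0 < rho /\ expands f (gam t) rho a.
  by apply: fa; rewrite unit_discE.
have [r [K [r0 K0 fK]]] := expands_lip rho0 ft.
near=> t'.
apply: (@le_lt_trans _ _ (K * normc (gam t' - gam t))).
  apply: fK; apply: ltW; near: t'; exact: ccontinuous_near.
rewrite mulrC -ltr_pdivlMr//; near: t'; apply: ccontinuous_near => //.
by rewrite divr_gt0.
Unshelve. all: by end_near. Qed.

Lemma ccontinuous_measurable (gam : R -> C) D : ccontinuous gam -> cmeasurable D gam.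
Proof.
move=> [c1 c2]; split; apply: measurable_funTS.
  exact: (continuous_measurable_fun c1).
exact: (continuous_measurable_fun c2).
Qed.

Lemma ccontinuous_normc (gam : R -> C) : ccontinuous gam ->
  continuous (fun t => normc (gam t)).
Proof.
move=> cg t; apply/cvgrPdist_lt => e e0; near=> t'.
rewrite distrC; apply: (@le_lt_trans _ _ (normc (gam t' - gam t))).
  rewrite ler_norml; apply/andP; split.
    rewrite lerBrDl lerBlDl addrC; have := normcD (gam t - gam t') (gam t').
    by rewrite subrK normcB addrC.
  by rewrite lerBlDr; have := normcD (gam t' - gam t) (gam t); rewrite subrK.
by near: t'; exact: ccontinuous_near.
Unshelve. all: by end_near. Qed.

(* A function on [0, 1[ obtained from a path in the disc extends continuously to the line. *)
Definition clamp (t : R) : R := Num.max 0 (Num.min t 1).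

Lemma clamp01 t : 0 <= clamp t <= 1.
Proof. by rewrite /clamp le_max lexx/= ge_max ler01/= ge_min lexx orbT. Qed.

Lemma clampE t : 0 <= t <= 1 -> clamp t = t.
Proof. by move=> /andP[t0 t1]; rewrite /clamp (min_idPl t1) (max_idPr t0). Qed.

Lemma continuous_clamp : continuous clamp.
Proof.
move=> t.
have h1 : Num.min x 1 @[x --> t] --> Num.min t (1 : R).
  by apply: continuous_min; [exact: cvg_id|exact: cvg_cst].
have h0 : (cst 0 : R -> R) x @[x --> t] --> (0:R) by exact: cvg_cst.
exact: (continuous_max h0 h1).
Qed.

Lemma normc_clampM t (z : C) : normc z < 1 -> normc ((clamp t)%:C * z) < 1.
Proof.
move=> z1; have /andP[c0 c1] := clamp01 t.
rewrite normcM normcR ger0_norm// (le_lt_trans _ z1)//.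
by rewrite ler_piMl ?normc_ge0.
Qed.

Lemma ccontinuous_clampM (z : C) : ccontinuous (fun t => (clamp t)%:C * z).
Proof.
split=> t; rewrite /comp.
  under eq_fun do rewrite ReZ.
  by apply: cvgM; [exact: continuous_clamp|exact: cvg_cst].
under eq_fun do rewrite ImZ.
by apply: cvgM; [exact: continuous_clamp|exact: cvg_cst].
Qed.

(** With [clamp t] in place of [t] the function is continuous on the whole line, hence measurable,
    and it is bounded by its maximum over [[0, 1]], where [t z] stays in the disc. *)
Lemma disc_analytic_dilation (f : C -> C) (z : C) D : disc_analytic f ->
  normc z < 1 -> measurable D -> (forall t, D t -> 0 <= t <= 1) ->
  cmeasurable D (fun t => f (t%:C * z)) /\ cbounded D (fun t => f (t%:C * z)).
Proof.
move=> fa z1 mD D01; pose g t := f ((clamp t)%:C * z).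
have gE t : D t -> g t = f (t%:C * z) by move=> /D01 h; rewrite /g clampE.
have cg : ccontinuous g.
  apply: (disc_analytic_continuous fa _ (ccontinuous_clampM z)) => t.
  exact: normc_clampM.
have [m1 m2] := ccontinuous_measurable D cg.
split.
  split; [move: m1|move: m2]; apply: eq_measurable_fun => t; rewrite inE => Dt;
  by rewrite gE.
have [c _ hc] := EVT_max ler01 (continuous_subspaceT (ccontinuous_normc cg)).
by exists (normc (g c)) => t Dt; rewrite -gE//; apply: hc; rewrite in_itv/= D01.
Qed.

Lemma shift_coef_measurable D (gam : R -> C) (a : nat -> C) (sigma r K : R) k :
  (forall N, \sum_(0 <= n < N) normc (a n) * (sigma + r) ^+ n <= K) -> 0 < r ->
  cmeasurable D gam -> (forall t, D t -> normc (gam t) <= sigma) ->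
  cmeasurable D (fun t => shift_coef a (gam t) k).
Proof.
move=> aK r0 mg gs.
apply: (@cmeasurable_cvg D (fun N t =>
  \sum_(0 <= n < N) a n * 'C(n, k)%:R * gam t ^+ (n - k))); last first.
  by move=> t Dt; have [h _] := shift_coefP k aK (gs t Dt) r0; exact: h.
move=> N; apply: cmeasurable_sum => n.
by apply: cmeasurableM; [exact: cmeasurable_cst|exact: cmeasurableX].
Qed.

(** One expansion, at [w0], serves all [t] in [D]: re-expanded at [t w], it gives [f(t z)] in powers
    of [t (z - w)], with coefficients bounded independently of [t]. The series can then be
    integrated term by term. *)
Lemma expands_cint_dilation (f : C -> C) (w w0 : C) (rho : R) a D :
  0 < rho -> expands f w0 rho a -> measurable D -> (forall t, D t -> 0 <= t <= 1) ->
  (forall t, D t -> normc (t%:C * w - w0) <= rho / 4) ->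
  exists b, expands (fun z => cint D (fun t => f (t%:C * z))) w (rho / 4) b.
Proof.
move=> rho0 fa mD D01 Dw.
(* [sigma + r < rho] bounds the shifted coefficients by a multiple of [r^-k], and [rho / 4 < r]
   makes the series in [z - w] geometric. *)
pose sigma := rho / 4; pose r := rho / 2.
have [s0 r0] : 0 < sigma /\ 0 < r by rewrite /sigma /r; split; lra.
have sr : 0 <= sigma + r < rho by rewrite /sigma /r; apply/andP; split; lra.
have [K K0 aK] := expands_abs fa sr.
pose u (t : R) : C := t%:C * w - w0.
pose c (k : nat) (t : R) : C := shift_coef a (u t) k * t%:C ^+ k.
have mu_ : cmeasurable D u.
  apply: cmeasurableD; last exact: cmeasurable_cst.
  by apply: cmeasurableM; [exact: cmeasurable_id|exact: cmeasurable_cst].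
have mc k : cmeasurable D (c k).
  apply: cmeasurableM; last exact/cmeasurableX/cmeasurable_id.
  exact: (shift_coef_measurable k aK r0 mu_ Dw).
have cK k t : D t -> normc (c k t) <= 2 * K / r ^+ k.
  move=> Dt; have [_ h] := shift_coefP k aK (Dw t Dt) r0.
  rewrite ler_pdivlMr ?exprn_gt0//; apply: le_trans h.
  rewrite normcM normcX normcR ler_wpM2r ?exprn_ge0 ?(ltW r0)//.
  rewrite ler_piMr ?normc_ge0// exprn_ile1//.
  by have /andP[t0 t1] := D01 t Dt; rewrite ger0_norm.
exists (fun k => cint D (c k)); apply/expandsP => z zw.
have zw' : 0 <= normc (z - w) / r < 1.
  rewrite divr_ge0 ?normc_ge0 ?(ltW r0)//= ltr_pdivrMr// mul1r.
  by apply: (lt_trans zw); rewrite /r; lra.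
have E n : series (fun k => cint D (c k) * (z - w) ^+ k) n =
    series (fun k => cint D (fun t => c k t * (z - w) ^+ k)) n.
  apply: eq_bigr => k _; rewrite cintMr//.
  by exists (2 * K / r ^+ k) => t; exact: cK.
apply: (eq_cvgC E).
apply: (@series_cint D _ (fun k => 2 * K * (normc (z - w) / r) ^+ k) _
   (2 * K * (1 - normc (z - w) / r)^-1)) => //.
- by move=> k; apply: cmeasurableM => //; exact: cmeasurable_cst.
- move=> k t Dt; rewrite normcM normcX expr_div_n mulrCA -[leLHS]mulrC.
  by rewrite ler_wpM2l ?exprn_ge0 ?normc_ge0// cK.
- move=> n; rewrite /series/= -mulr_sumr ler_wpM2l ?mulr_ge0//.
  exact: geometric_sum_le.
- move=> t Dt.
  have uw : normc (u t) < rho by apply: (le_lt_trans (Dw t Dt)); lra.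
  have /expandsP h := expands_shift fa uw.
  have zt : normc (t%:C * z - t%:C * w) < rho - normc (u t).
    rewrite -mulrBr normcM normcR; have /andP[t0 t1] := D01 t Dt.
    rewrite ger0_norm//; apply: (@le_lt_trans _ _ (normc (z - w))).
      by rewrite ler_piMl ?normc_ge0.
    by have := Dw t Dt; rewrite -/(u t); move: zw; lra.
  apply: (eq_cvgC _ (h _ zt)) => n; apply: eq_bigr => k _.
  by rewrite -mulrBr exprMn mulrA.
Qed.

(* The radius of re-expansion at [t w] depends on [t]; taking the supremum of the [x] for
   which the integral over [0, x[ expands at [w] replaces a compactness argument. *)
Lemma has_expansion_cint_dilation (f : C -> C) (w : C) : disc_analytic f ->
  normc w < 1 -> exists rho b, 0 < rho /\
    expands (fun z => cint `[0, 1[ (fun t => f (t%:C * z))) w rho b.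
Proof.
move=> fa w1.
pose P D := exists (rho : R) b, 0 < rho /\
    expands (fun z => cint D (fun t => f (t%:C * z))) w rho b.
(* Since [|t w - t0 w| <= |t - t0|], a quarter of the radius of expansion of [f] at [t0 w] serves as
   [d]. *)
have loc t0 : 0 <= t0 <= 1 -> exists2 d : R, 0 < d & forall x y : R,
    0 <= x -> y <= 1 -> t0 - d < x -> y < t0 + d -> P `[x, y[%classic.
  move=> /andP[t00 t01].
  have [rho [a [rho0 fta]]] : exists (rho : R) a, 0 < rho /\ expands f (t0%:C * w) rho a.
    apply: fa; rewrite unit_discE normcM normcR ger0_norm//.
    by rewrite (le_lt_trans _ w1)// ler_piMl ?normc_ge0.
  exists (rho / 4); first by rewrite divr_gt0.
  move=> x y x0 y1 tx yt.
  have [] := @expands_cint_dilation f w (t0%:C * w) rho a `[x, y[%classic rho0 fta.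
  - exact: measurable_itv.
  - move=> t /=; rewrite in_itv/= => /andP[xt ty]; apply/andP; split.
      exact: le_trans xt.
    exact: le_trans (ltW ty) y1.
  - move=> t /=; rewrite in_itv/= => /andP[xt ty].
    rewrite -mulrBl -(rmorphB (real_complex R)) normcM normcR.
    apply: (@le_trans _ _ `|t - t0|).
      by rewrite ler_piMr// ltW.
    by rewrite ler_norml; apply/andP; split; lra.
  - by move=> b hb; exists (rho / 4), b; split => //; rewrite divr_gt0.
have ext x y : 0 <= x <= y -> y <= 1 -> P `[0, x[%classic -> P `[x, y[%classic ->
    P `[0, y[%classic.
  move=> /andP[x0 xy] y1 [r1 [b1 [r10 h1]]] [r2 [b2 [r20 h2]]].
  (* The bound [1 - |w|] keeps [z] in the disc, where the integrand is measurable and bounded and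
     the integral splits at [x]. *)
  exists (Num.min (1 - normc w) (Num.min r1 r2)), (fun k => b1 k + b2 k).
  split; first by rewrite !lt_min r10 r20 subr_gt0 w1.
  apply: (@eq_expands _ (fun z => cint `[0, x[%classic (fun t => f (t%:C * z)) +
    cint `[x, y[%classic (fun t => f (t%:C * z)))); last first.
    by apply: expandsD; [apply: expands_le h1|apply: expands_le h2];
      rewrite !ge_min lexx ?orbT.
  move=> z; rewrite lt_min => /andP[zw _].
  have z1 : normc z < 1.
    by have := normcD (z - w) w; rewrite subrK; move: zw; lra.
  have U : `[0, y[%classic = `[0, x[%classic `|` `[x, y[%classic :> set R.
    apply/seteqP; split=> t /=; rewrite !in_itv/=.
      move=> /andP[t0 ty]; case: (ltP t x) => tx; first by left; rewrite t0.
      by right; rewrite ty.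
    move=> [/andP[t0 tx]|/andP[xt ty]]; apply/andP; split=> //.
      exact: lt_le_trans xy.
    exact: le_trans xt.
  have [mf bf] := @disc_analytic_dilation f z (`[0, y[%classic : set Rm) fa z1 (measurable_itv _) (fun t => ltac:(rewrite /= in_itv/= => /andP[t0 ty]; rewrite t0 (le_trans (ltW ty))//)).
  rewrite U in mf bf *; rewrite cint_setU//.
  apply/disj_setPS => t /= [] /=; rewrite !in_itv/= => /andP[_ tx] /andP[xt _].
  by move: (lt_le_trans tx xt); rewrite ltxx.
pose S := [set x : R | 0 <= x <= 1 /\ P `[0, x[%classic].
have S0 : S 0.
  split; first by rewrite lexx ler01.
  exists 1, (fun=> 0); split => //; apply/expandsP => z _.
  have -> : cint `[0, 0[ (fun t => f (t%:C * z)) = 0.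
    by rewrite set_itvco0; apply: complex_eq => /=; rewrite Rintegral_set0.
  apply: (eq_cvgC (v := fun=> 0)) => [n|]; last exact: cvg_cst.
  by rewrite /series/= big1// => k _; rewrite mul0r.
have hS : has_sup S.
  by split; [exists 0|exists 1 => x [/andP[]]].
pose s := sup S.
have s01 : 0 <= s <= 1.
  apply/andP; split; first exact: sup_ubound hS.2 _ S0.
  by apply: sup_le_ub; [exists 0|move=> x [/andP[]]].
have [d d0 hd] := loc s s01.
have [x [/andP[x0 x1] Px] sx] := sup_adherent d0 hS.
have xs : x <= s by apply: sup_ubound hS.2 _ _; split => //; rewrite x0.
(* This point still belongs to [S], hence does not exceed the supremum [s]; the minimum must then be
   1. *)
pose y := Num.min 1 (s + d / 2).
have sy : s <= y by rewrite le_min; case/andP: s01 => _ ->; rewrite lerDl ltW// divr_gt0.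
have y1 : y <= 1 by rewrite ge_min lexx.
have Sy : S y.
  split; first by rewrite y1 andbT (le_trans x0)// (le_trans xs).
  have xy : 0 <= x <= y by rewrite x0 (le_trans xs).
  apply: (ext x y xy y1 Px); apply: (hd _ _ x0 y1 sx); rewrite gt_min; apply/orP; right.
  by rewrite ltrD2l ltr_pdivrMr// ltr_pMr// ltr1n.
have ys : y <= s by exact: sup_ubound hS.2 _ Sy.
suff y1E : y = 1 by rewrite y1E in Sy; case: Sy.
apply/eqP; rewrite eq_le y1/= leNgt; apply/negP => yl1.
have : y = s + d / 2.
  by move: yl1; rewrite /y minElt; case: ifP => //; rewrite ltxx.
by move: ys d0; lra.
Qed.

Lemma disc_analytic_cint_dilation (f : C -> C) : disc_analytic f ->
  disc_analytic (fun z => cint `[0, 1[ (fun t => f (t%:C * z))).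
Proof. by move=> fa w; rewrite unit_discE; exact: has_expansion_cint_dilation. Qed.

End ComplexIntegral.

(** * Complex powers and the binomial series *)

Section PointwiseDerivatives.
Variable R : realType.
Implicit Types (f g : R -> R) (x a b : R).

(** The derivative rules for functions written pointwise, a form in which they chain by
    unification. *)
Lemma is_derive_addf f g x a b : is_derive x 1 f a -> is_derive x 1 g b ->
  is_derive x 1 (fun u => f u + g u) (a + b).
Proof. by move=> df dg; exact: is_deriveD. Qed.

Lemma is_derive_subf f g x a b : is_derive x 1 f a -> is_derive x 1 g b ->
  is_derive x 1 (fun u => f u - g u) (a - b).
Proof. by move=> df dg; exact: is_deriveB. Qed.

Lemma is_derive_mulf f g x a b : is_derive x 1 f a -> is_derive x 1 g b ->
  is_derive x 1 (fun u => f u * g u) (f x * b + g x * a).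
Proof. by move=> df dg; exact: is_deriveM. Qed.

Lemma is_derive_mulfr f x a b : is_derive x 1 f a ->
  is_derive x 1 (fun u => f u * b) (a * b).
Proof.
move=> df; have := is_derive_mulf df (is_derive_cst b x 1).
by rewrite mulr0 add0r mulrC.
Qed.

Lemma is_derive_mulfl f x a b : is_derive x 1 f a ->
  is_derive x 1 (fun u => b * f u) (b * a).
Proof.
move=> df; have := is_derive_mulf (is_derive_cst b x 1) df.
by rewrite mulr0 addr0.
Qed.

Lemma is_derive_compf f g x a b : is_derive (g x) 1 f a -> is_derive x 1 g b ->
  is_derive x 1 (fun u => f (g u)) (a * b).
Proof. by move=> df dg; exact: is_derive1_comp. Qed.

Lemma is_derive_affine (c d x : R) : is_derive x 1 (fun u => c + u * d) d.
Proof.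
have := is_derive_addf (is_derive_cst c x 1) (is_derive_mulfr d (is_derive_id x 1)).
by rewrite add0r mul1r.
Qed.

End PointwiseDerivatives.

Section ComplexPower.
Variable R : realType.
Local Notation C := (R[i]^o).
Local Notation Re := (@complex.Re R).
Local Notation Im := (@complex.Im R).
Implicit Types (w z : C) (s t b : R).

Lemma normc_sq w : normc w ^+ 2 = Re w ^+ 2 + Im w ^+ 2.
Proof. by case: w => a c /=; rewrite sqr_sqrtr// addr_ge0 ?sqr_ge0. Qed.

Lemma normc_gt0_Re w : 0 < Re w -> 0 < normc w.
Proof. by move=> h; apply: lt_le_trans (normc_Re w); rewrite gtr0_norm. Qed.

(** The cosine of the right-hand side is [Re w / normc w], and the sign of [Im w] tells whether
    [acos] inverts the cosine on [[0, pi]] or, up to sign, on [[- pi, 0]]. *)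
Lemma carg_atan w : 0 < Re w -> carg w = atan (Im w / Re w).
Proof.
move=> w0; have n0 := normc_gt0_Re w0.
have E : Re w / normc w = cos (atan (Im w / Re w)).
  rewrite cos_atan; have -> : 1 + (Im w / Re w) ^+ 2 = (normc w / Re w) ^+ 2.
    by rewrite !expr_div_n normc_sq mulrDl divff// sqrf_eq0 gt_eqF.
  by rewrite sqrtr_sqr ger0_norm ?invf_div// divr_ge0// ltW.
have pi0 := @pi_gt0 R.
rewrite /carg E; case: leP => wi.
  rewrite cosK// in_itv/=; apply/andP; split.
    by rewrite -(@atan0 R) le_atan// divr_ge0// ltW.
  by apply: (le_trans (ltW (atan_ltpi2 _))); rewrite ler_pdivrMr// ler_peMr ?ler1n// ltW.
rewrite cosKN ?opprK//; apply/andP; split.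
  apply: le_trans (ltW (atan_gtNpi2 _)); rewrite lerN2 ler_pdivrMr//.
  by rewrite ler_peMr ?ler1n// ltW.
by rewrite -(@atan0 R) le_atan// pmulr_lle0 ?invr_gt0// ltW.
Qed.

Lemma normc_cpowR w s : normc (cpowR w s) = normc w `^ s.
Proof.
rewrite /cpowR normcM normcR ger0_norm ?powR_ge0//.
by rewrite /= cos2Dsin2 sqrtr1 mulr1.
Qed.

Lemma cpowRD w s t : 0 < normc w -> cpowR w (s + t) = cpowR w s * cpowR w t.
Proof.
move=> w0; have hp : normc w `^ (s + t) = normc w `^ s * normc w `^ t.
  by rewrite powRD//; apply/implyP => _; rewrite gt_eqF.
have hc : (s + t) * carg w = s * carg w + t * carg w by rewrite mulrDl.
rewrite /cpowR hp hc cosD sinD.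
by apply: complex_eq; rewrite !(ReM, ImM)/=; ring.
Qed.

Lemma cpowR0 w : 0 < normc w -> cpowR w 0 = 1.
Proof. by move=> w0; rewrite /cpowR powRr0 mul0r cos0 sin0 mul1r. Qed.

Lemma cpowRN w s : 0 < normc w -> cpowR w (- s) = (cpowR w s)^-1.
Proof.
move=> w0; have h : cpowR w s * cpowR w (- s) = 1.
  by rewrite -cpowRD// subrr cpowR0.
have n0 : cpowR w s != 0.
  by apply/eqP => h0; move: h; rewrite h0 mul0r => /esym/eqP; rewrite oner_eq0.
by apply: (mulfI n0); rewrite h divff.
Qed.

Lemma cpowR1l s : cpowR 1 s = 1.
Proof.
rewrite /cpowR normc1 powR1 carg_atan/=; last exact: ltr01.
by rewrite mul0r atan0 mulr0 cos0 sin0 mul1r.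
Qed.

Lemma Re_1B_gt0 z : normc z < 1 -> 0 < Re (1 - z).
Proof.
move=> z1; rewrite ReB subr_gt0; apply: le_lt_trans z1.
exact: le_trans (ler_norm _) (normc_Re _).
Qed.

(* [L + i A] is the logarithm of [1 - t z]. *)
Lemma cpowR_ray (z : C) (b t : R) : 0 < 1 - t * Re z ->
  let x := 1 - t * Re z in let y := - (t * Im z) in
  let L := ln (x ^+ 2 + y ^+ 2) / 2 in let A := atan (y / x) in
  Re (cpowR (1 - t%:C * z) b) = expR (b * L) * cos (b * A) /\
  Im (cpowR (1 - t%:C * z) b) = expR (b * L) * sin (b * A).
Proof.
move=> x0 x y L A.
have xE : Re (1 - t%:C * z) = x by rewrite ReB ReZ.
have yE : Im (1 - t%:C * z) = y by rewrite ImB ImZ/= sub0r.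
have w0 : 0 < Re (1 - t%:C * z) by rewrite xE.
have n0 := normc_gt0_Re w0.
rewrite /cpowR carg_atan// xE yE -/A.
have -> : normc (1 - t%:C * z) `^ b = expR (b * L).
  rewrite /powR gt_eqF//; congr (expR (b * _)).
  by rewrite /L -xE -yE -normc_sq lnXn// -[ln _ *+ 2]mulr_natr mulfK.
by rewrite ReZ ImZ.
Qed.

(** [l + i a] is the logarithmic derivative [- z / (1 - t z)], so the two formulas are the parts of
    [b (l + i a) (1 - t z)^b]. *)
Lemma derive_cpowR_ray (z : C) (b t : R) : 0 < 1 - t * Re z ->
  let x := 1 - t * Re z in let y := - (t * Im z) in
  let q := x ^+ 2 + y ^+ 2 in
  let l := (- x * Re z - y * Im z) / q in let a := (y * Re z - x * Im z) / q in
  let Er u := Re (cpowR (1 - u%:C * z) b) in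
  let Ei u := Im (cpowR (1 - u%:C * z) b) in
  is_derive t 1 Er (b * (l * Er t - a * Ei t)) /\
  is_derive t 1 Ei (b * (l * Ei t + a * Er t)).
Proof.
move=> x0 x y q l a Er Ei.
have q0 : 0 < q by rewrite /q ltr_pwDl ?sqr_ge0// exprn_gt0.
pose X (u : R) := 1 - u * Re z; pose Y (u : R) := - (u * Im z).
have dX : is_derive t 1 X (- Re z).
  by have := is_derive_affine 1 (- Re z) t; under eq_fun do rewrite mulrN.
have dY : is_derive t 1 Y (- Im z).
  by have := is_derive_affine 0 (- Im z) t; under eq_fun do rewrite add0r mulrN.
pose L (u : R) := ln (X u ^+ 2 + Y u ^+ 2) / 2.
pose A (u : R) := atan (Y u / X u).
have dL : is_derive t 1 L l.
  have h : is_derive t 1 (fun u => X u * X u + Y u * Y u) (2 * (- x * Re z - y * Im z)).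
    have := is_derive_addf (is_derive_mulf dX dX) (is_derive_mulf dY dY).
    by move/is_derive_eq; apply; rewrite /X /Y -/x -/y; ring.
  have q0' : 0 < X t * X t + Y t * Y t by rewrite -!expr2.
  have := is_derive_mulfr 2^-1 (is_derive_compf (f := @ln R) (g := fun u => X u * X u + Y u * Y u) (is_derive1_ln q0') h).
  rewrite (_ : (fun u => _) = L); last by apply/funext => u; rewrite /L !expr2.
  move/is_derive_eq; apply; rewrite /l /q !expr2 /X /Y -/x -/y.
  by field; rewrite -!expr2 gt_eqF.
have dA : is_derive t 1 A a.
  have Xt0 : X t != 0 by rewrite gt_eqF.
  have h := is_derive_mulf dY (is_deriveV Xt0 dX).
  have := is_derive_compf (g := fun u => Y u / X u) (is_derive1_atan (Y t / X t)) h.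
  move/is_derive_eq; apply; rewrite /a /q /GRing.scale/= /X /Y -/x -/y.
  by field; rewrite !gt_eqF.
have X0 : \forall u \near t, 0 < X u.
  have cX : {for t, continuous X}.
    exact/differentiable_continuous/derivable1_diffP/ex_derive.
  by have /cvgr_gt := cX; apply.
have Ee : \forall u \near t, Er u = expR (b * L u) * cos (b * A u) /\
    Ei u = expR (b * L u) * sin (b * A u).
  by near=> u; apply: cpowR_ray; near: u; exact: X0.
have [Ert Eit] := nbhs_singleton Ee.
have dexp : is_derive t 1 (fun u => expR (b * L u)) (expR (b * L t) * (b * l)).
  by apply: is_derive_compf; exact: is_derive_mulfl.
have dbA : is_derive t 1 (fun u => b * A u) (b * a).
  exact: is_derive_mulfl.
split.
  have h := is_derive_mulf dexp (is_derive_compf (g := fun u => b * A u) (is_derive_cos (b * A t)) dbA).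
  have h2 : is_derive t 1 (fun u => expR (b * L u) * cos (b * A u)) (b * (l * Er t - a * Ei t)).
    by move/is_derive_eq : h; apply; rewrite Ert Eit; ring.
  by apply: near_eq_is_derive h2; near=> u; near: u; apply: filterS Ee => u [].
have h := is_derive_mulf dexp (is_derive_compf (g := fun u => b * A u) (is_derive_sin (b * A t)) dbA).
have h2 : is_derive t 1 (fun u => expR (b * L u) * sin (b * A u)) (b * (l * Ei t + a * Er t)).
  by move/is_derive_eq : h; apply; rewrite Ert Eit; ring.
by apply: near_eq_is_derive h2; near=> u; near: u; apply: filterS Ee => u [].
Unshelve. all: by end_near. Qed.

Lemma cvgC_shiftS (u : nat -> C) (l : C) :
  u @ \oo --> l -> (fun n => u n.+1) @ \oo --> l.
Proof.
move=> /cvgC_ReImP[h1 h2]; apply/cvgC_ReImP; split.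
  by rewrite (cvg_shiftS (fun n => Re (u n))).
by rewrite (cvg_shiftS (fun n => Im (u n))).
Qed.

(** The coefficient [b (b + 1) ... (b + n - 1) / n!] of [x^n] in [(1 - x)^-b]. *)
Definition bincoef (b : R) (n : nat) : R := \prod_(0 <= i < n) ((b + i%:R) / i.+1%:R).

Lemma bincoef0 b : bincoef b 0 = 1.
Proof. by rewrite /bincoef big_geq. Qed.

Lemma bincoefS b n : n.+1%:R * bincoef b n.+1 = (b + n%:R) * bincoef b n.
Proof.
rewrite /bincoef big_nat_recr//= mulrCA mulrC; congr (_ * _).
by rewrite mulrCA divff ?mulr1// pnatr_eq0.
Qed.

Lemma bincoef_ge0 b n : 0 < b -> 0 <= bincoef b n.
Proof.
by move=> b0; apply: prodr_ge0 => i _; rewrite divr_ge0// addr_ge0// ltW.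
Qed.

(** The derivative of [(1 - x)^-b], coefficientwise. It keeps the bounds on differentiated series
    inside the same family. *)
Lemma bincoef_diffs b n : n.+1%:R * bincoef b n.+1 = b * bincoef (b + 1) n.
Proof.
elim: n => [|n ih]; first by rewrite bincoefS !bincoef0 addr0.
have n0 : (n.+1%:R : R) != 0 by rewrite pnatr_eq0.
apply: (mulfI n0); rewrite bincoefS mulrCA ih.
rewrite [RHS]mulrCA bincoefS mulrCA; congr (_ * (_ * _)).
by rewrite -natr1; ring.
Qed.

(** A ratio test: for [x < y < 1] the sequence [v_n], that is [bincoef b n (x / y)^n], decreases as
    soon as [(b + n) x <= (n + 1) y], in particular for [n > b x / (y - x)]. It is thus bounded, and
    the terms are dominated by multiples of [y^n]. *)
Lemma bincoef_series_le (b x : R) : 0 < b -> 0 <= x < 1 ->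
  exists K, forall N, \sum_(0 <= n < N) bincoef b n * x ^+ n <= K.
Proof.
move=> b0 /andP[x0 x1]; pose y := (1 + x) / 2.
have [y0 y1 xy] : [/\ 0 < y, y < 1 & x < y] by rewrite /y; split; lra.
pose v n := bincoef b n * (x / y) ^+ n.
have q0 : 0 <= x / y by rewrite divr_ge0// ltW.
have v0 n : 0 <= v n by rewrite mulr_ge0 ?bincoef_ge0// exprn_ge0.
pose N0 := (Num.truncn (b * x / (y - x))).+1.
have vS n : (N0 <= n)%N -> v n.+1 <= v n.
  move=> Nn; have E : n.+1%:R * v n.+1 = (b + n%:R) * (x / y) * v n.
    by rewrite /v exprS mulrA bincoefS; ring.
  rewrite -(@ler_pM2l _ n.+1%:R) ?ltr0n// E ler_wpM2r// mulrA ler_pdivrMr//.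
  have : b * x / (y - x) < n%:R.
    by apply: (lt_le_trans (Num.Theory.truncnS_gt _)); rewrite ler_nat.
  rewrite ltr_pdivrMr ?subr_gt0// -natr1; move: y0; nra.
pose K := \sum_(0 <= n < N0.+1) v n.
have vK n : v n <= K.
  have vK' m : (m <= N0)%N -> v m <= K.
    move=> mN; rewrite /K (@big_cat_nat _ _ _ m)//=; last exact: leqW.
    by rewrite [X in _ + X]big_ltn// addrCA lerDl addr_ge0// sumr_ge0.
  have [/vK'//|/ltnW] := leqP n N0.
  elim: n => [|n ih]; first by rewrite leqn0 => /eqP E; apply: vK'; rewrite E.
  rewrite leq_eqVlt => /orP[/eqP <-|]; first exact: vK'.
  by rewrite ltnS => Nn; apply: (le_trans (vS _ Nn)); exact: ih.
exists (K * (1 - y)^-1) => N.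
have K0 : 0 <= K by apply: sumr_ge0.
apply: (@le_trans _ _ (\sum_(0 <= n < N) K * y ^+ n)).
  apply: ler_sum => n _; have -> : x ^+ n = (x / y) ^+ n * y ^+ n.
    by rewrite -exprMn divfK// gt_eqF.
  by rewrite mulrA ler_wpM2r ?exprn_ge0 ?(ltW y0)//; exact: vK.
by rewrite -mulr_sumr ler_wpM2l//; apply: geometric_sum_le; rewrite (ltW y0).
Qed.

Lemma pseries_bincoef_cvg (c : nat -> R) (b r x M : R) : 0 < b -> 0 <= r -> 0 <= x ->
  r * x < 1 -> (forall n, `|c n| <= M * (bincoef b n * r ^+ n)) ->
  cvgn (pseries c x).
Proof.
move=> b0 r0 x0 rx cM.
have [|K' hK'] := @bincoef_series_le b (r * x) b0; first by rewrite mulr_ge0.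
apply: (@series_dom_cvg _ _ (fun n => `|M| * (bincoef b n * (r * x) ^+ n)) (`|M| * K')).
  move=> n; rewrite normrM normrX (ger0_norm x0) exprMn !mulrA.
  rewrite ler_wpM2r ?exprn_ge0//; apply: (le_trans (cM n)).
  rewrite -mulrA ler_wpM2r ?mulr_ge0 ?bincoef_ge0 ?exprn_ge0//; exact: ler_norm.
by move=> n; rewrite /series/= -mulr_sumr ler_wpM2l.
Qed.

(* If [S u] is the sum of the series at [u z], then [(1 - u z) S' = b z S], so that
   [S u * (1 - u z)^b] is constant along the ray. *)
Lemma binomial_series (b : R) (z : C) : 0 < b -> normc z < 1 ->
  series (fun n => (bincoef b n)%:C * z ^+ n) @ \oo --> cpowR (1 - z) (- b).
Proof.
move=> b0 z1; pose r := normc z.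
have r0 : 0 <= r by exact: normc_ge0.
(* Convergence in [u] is needed beyond 1, so that [S] is differentiable on the closed segment
   [[0, 1]]; [r K < 1] still allows it. *)
pose K := 2 / (1 + r).
have [K0 K1 rK] : [/\ 0 < K, 1 < K & r * K < 1].
  have h : 0 < 1 + r by rewrite ltr_pwDl.
  split; first by rewrite divr_gt0.
    by rewrite /K ltr_pdivlMr// mul1r; move: z1; rewrite -/r; lra.
  by rewrite /K mulrA ltr_pdivrMr// mul1r; move: z1; rewrite -/r; lra.
pose c n : C := (bincoef b n)%:C * z ^+ n.
have cN n : normc (c n) = bincoef b n * r ^+ n.
  by rewrite normcM normcX normcR ger0_norm ?bincoef_ge0.
(* Termwise differentiation asks for convergence at [K] of the series and of its first two formal
   derivatives; [P] will be [Re] and [Im]. *)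
have pow_cvg (P : C -> R) : (forall w, `|P w| <= normc w) ->
  [/\ cvgn (pseries (P \o c) K), cvgn (pseries (pseries_diffs (P \o c)) K) &
    cvgn (pseries (pseries_diffs (pseries_diffs (P \o c))) K)].
  move=> hP; have bK := ltW K0; split.
  - apply: (@pseries_bincoef_cvg _ b r K 1) => // n.
    by rewrite mul1r; apply: (le_trans (hP _)); rewrite cN.
  - apply: (@pseries_bincoef_cvg _ (b + 1) r K (b * r)) => //; first exact: ltr_wpDr.
    move=> n; rewrite /pseries_diffs normrM normr_nat/=.
    apply: (@le_trans _ _ (n.+1%:R * normc (c n.+1))); first by rewrite ler_wpM2l.
    by rewrite cN (mulrA n.+1%:R) bincoef_diffs exprS le_eqVlt; apply/orP; left; apply/eqP; ring.
  - apply: (@pseries_bincoef_cvg _ (b + 1 + 1) r K (b * (b + 1) * r ^+ 2)) => //.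
      by rewrite !ltr_wpDr.
    move=> n; rewrite /pseries_diffs !normrM !normr_nat/=.
    apply: (@le_trans _ _ (n.+1%:R * (n.+2%:R * normc (c n.+2)))).
      by rewrite !ler_wpM2l.
    rewrite cN (mulrA n.+2%:R) bincoef_diffs.
    have -> : n.+1%:R * (b * bincoef (b + 1) n.+1 * r ^+ n.+2) =
      b * (n.+1%:R * bincoef (b + 1) n.+1) * r ^+ n.+2 by ring.
    by rewrite bincoef_diffs !exprS le_eqVlt; apply/orP; left; apply/eqP; ring.
have [r1 r2 r3] := pow_cvg Re (@normc_Re R).
have [i1 i2 i3] := pow_cvg Im (@normc_Im R).
pose Sr (u : R) : R := limn (pseries (Re \o c) u).
pose Si (u : R) : R := limn (pseries (Im \o c) u).
pose Dr (u : R) : R := limn (pseries (pseries_diffs (Re \o c)) u).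
pose Di (u : R) : R := limn (pseries (pseries_diffs (Im \o c)) u).
have dS (u : R) : `|u| < K -> is_derive u 1 Sr (Dr u) /\ is_derive u 1 Si (Di u).
  move=> uK; have uK' : `|u| < `|K| by rewrite (gtr0_norm K0).
  by split; [exact: pseries_snd_diffs r1 r2 r3 uK'|exact: pseries_snd_diffs i1 i2 i3 uK'].
have cS (u : R) : `|u| < K -> series (fun n => c n * u%:C ^+ n) @ \oo --> (Sr u +i* Si u : C).
  move=> uK; have uK' : `|u| < `|K| by rewrite (gtr0_norm K0).
  have xE n : c n * u%:C ^+ n = (u ^+ n)%:C * c n by rewrite mulrC rmorphXn.
  apply/seriesC_ReImP; split => /=.
    rewrite (_ : (fun k => _) = (fun k => (Re \o c) k * u ^+ k)); last first.
      by apply/funext => k; rewrite xE ReZ mulrC.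
    exact: is_cvg_pseries_inside r1 uK'.
  rewrite (_ : (fun k => _) = (fun k => (Im \o c) k * u ^+ k)); last first.
    by apply/funext => k; rewrite xE ImZ mulrC.
  exact: is_cvg_pseries_inside i1 uK'.
have cD (u : R) : `|u| < K ->
    series (fun n => n.+1%:R%:C * c n.+1 * u%:C ^+ n) @ \oo --> (Dr u +i* Di u : C).
  move=> uK; have uK' : `|u| < `|K| by rewrite (gtr0_norm K0).
  have xE n : n.+1%:R%:C * c n.+1 * u%:C ^+ n = (n.+1%:R * u ^+ n)%:C * c n.+1.
    by rewrite rmorphM rmorphXn/=; ring.
  apply/seriesC_ReImP; split => /=.
    rewrite (_ : (fun k => _) = (fun k => pseries_diffs (Re \o c) k * u ^+ k)); last first.
      by apply/funext => k; rewrite xE ReZ /pseries_diffs/= mulrAC.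
    exact: is_cvg_pseries_inside r2 uK'.
  rewrite (_ : (fun k => _) = (fun k => pseries_diffs (Im \o c) k * u ^+ k)); last first.
    by apply/funext => k; rewrite xE ImZ /pseries_diffs/= mulrAC.
  exact: is_cvg_pseries_inside i2 uK'.
(* This sums the recurrence [(n + 1) c_(n+1) = (b + n) z c_n]. The partial sums standing for [S']
   and for [b z S] are shifted by one, so that both sides stop at the same power of [u]. *)
have ode (u : R) : `|u| < K ->
    (Dr u +i* Di u : C) - (Dr u +i* Di u : C) * (u%:C * z) = (Sr u +i* Si u : C) * (b%:C * z).
  move=> uK; have hD := cD u uK; have hS := cS u uK.
  pose sD : nat -> C := series (fun n => n.+1%:R%:C * c n.+1 * u%:C ^+ n).
  pose sS : nat -> C := series (fun n => c n * u%:C ^+ n).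
  pose uz : C := u%:C * z; pose bz : C := b%:C * z.
  have hD1 : (fun N => sD N.+1) @ \oo --> (Dr u +i* Di u : C).
    exact: (cvgC_shiftS (u := sD) hD).
  have hS1 : (fun N => sS N.+1) @ \oo --> (Sr u +i* Si u : C).
    exact: (cvgC_shiftS (u := sS) hS).
  have hD2 := cvgC_mulr (u := sD) (v := uz) hD.
  have hS2 := cvgC_mulr (v := bz) hS1.
  have hD3 := cvgC_sub hD1 hD2.
  apply: (cvgC_unique hD3); move: hS2.
  apply: eq_cvgC => N; rewrite /sD /sS /uz /bz /series/=.
  rewrite [in LHS]big_nat_recl// [in RHS]big_nat_recl// mulrDl !mulr_suml -addrA -sumrB.
  have cS' n : n.+1%:R%:C * c n.+1 = (b + n%:R)%:C * (c n * z).
    by rewrite /c exprS [LHS]mulrA -rmorphM bincoefS rmorphM/=; ring.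
  congr (_ + _).
    by rewrite cS' addr0 !expr0; ring.
  apply: eq_bigr => i _; rewrite (cS' i.+1) (cS' i) /c.
  rewrite !exprS -natr1 !rmorphD/= rmorph1.
  have bS := bincoefS b i; move/(congr1 (real_complex R)) : bS.
  rewrite !rmorphM/= -natr1 !rmorphD/= rmorph1 => bS.
  rewrite (_ : _ - _ = ((i%:R)%:C + 1) * (bincoef b i.+1)%:C * (z ^+ i * z * z * (u%:C * u%:C ^+ i)) + b%:C * (bincoef b i.+1)%:C * (z ^+ i * z * z * (u%:C * u%:C ^+ i)) - (b%:C + (i%:R)%:C) * (bincoef b i)%:C * (z ^+ i * z * z * (u%:C * u%:C ^+ i))); last by ring.
  by rewrite bS; ring.
pose Er (u : R) := Re (cpowR (1 - u%:C * z) b); pose Ei (u : R) := Im (cpowR (1 - u%:C * z) b).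
(* The two functions are the real and imaginary parts of [S(u) (1 - u z)^b]. *)
have dU (u : R) : 0 <= u <= 1 ->
    is_derive u 1 (fun u => Sr u * Er u - Si u * Ei u) 0 /\
    is_derive u 1 (fun u => Sr u * Ei u + Si u * Er u) 0.
  move=> /andP[u0 u1].
  have uK : `|u| < K by rewrite ger0_norm// (le_lt_trans u1).
  have x0 : 0 < 1 - u * Re z.
    rewrite subr_gt0; apply: (@le_lt_trans _ _ r) => //.
    apply: (le_trans (ler_norm _)); rewrite normrM (ger0_norm u0).
    apply: le_trans (normc_Re z); rewrite ler_piMl//.
  have [dSr dSi] := dS u uK.
  have [dEr dEi] := derive_cpowR_ray b x0.
  have o := ode u uK.
  set x := 1 - u * Re z in x0 dEr dEi.
  set y := - (u * Im z) in dEr dEi.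
  have q0 : 0 < x ^+ 2 + y ^+ 2 by rewrite ltr_pwDl ?sqr_ge0// exprn_gt0.
  set l := (X in (b * (X * _ - _))) in dEr; set a := (X in (b * (_ - X * _))) in dEr.
  rewrite -/l -/a in dEi.
  have H1 : x * Dr u - y * Di u = b * (Re z * Sr u - Im z * Si u).
    move: o => /(congr1 Re); rewrite !(ReM, ImM, ReB, ImB)/= => o.
    by transitivity (b * Re z * Sr u - b * Im z * Si u);
      [rewrite /x /y; move: o; rewrite !mul0r !(subr0, addr0) => o; lra|ring].
  have H2 : x * Di u + y * Dr u = b * (Re z * Si u + Im z * Sr u).
    move: o => /(congr1 Im); rewrite !(ReM, ImM, ReB, ImB)/= => o.
    by transitivity (b * Re z * Si u + b * Im z * Sr u);
      [rewrite /x /y; move: o; rewrite !mul0r !(subr0, addr0) => o; lra|ring].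
  (* The differential equation is solved for [S'] by multiplying with the conjugate of [1 - u z]. *)
  have qDr : Dr u = - b * (l * Sr u - a * Si u).
    have : (x ^+ 2 + y ^+ 2) * Dr u = x * (x * Dr u - y * Di u) + y * (x * Di u + y * Dr u) by ring.
    rewrite H1 H2 => h; apply: (mulfI (lt0r_neq0 q0)); rewrite h /l /a.
    by field; rewrite gt_eqF.
  have qDi : Di u = - b * (a * Sr u + l * Si u).
    have : (x ^+ 2 + y ^+ 2) * Di u = x * (x * Di u + y * Dr u) - y * (x * Dr u - y * Di u) by ring.
    rewrite H1 H2 => h; apply: (mulfI (lt0r_neq0 q0)); rewrite h /l /a.
    by field; rewrite gt_eqF.
  split.
    have := is_derive_subf (is_derive_mulf dSr dEr) (is_derive_mulf dSi dEi).
    by move/is_derive_eq; apply; rewrite qDr qDi -/(Er u) -/(Ei u); ring.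
  have := is_derive_addf (is_derive_mulf dSr dEi) (is_derive_mulf dSi dEr).
  by move/is_derive_eq; apply; rewrite qDr qDi -/(Er u) -/(Ei u); ring.
have cst01 (f : R -> R) : (forall u : R, 0 <= u <= 1 -> is_derive u 1 f 0) -> f 1 = f 0.
  move=> df; have [| |c1 _ h] := @MVT_segment R f (fun=> 0) 0 1 ler01.
  - by move=> u; rewrite in_itv/= => /andP[/ltW u0 /ltW u1]; apply: df; rewrite u0.
  - apply: derivable_within_continuous => u; rewrite in_itv/= => u01.
    by have [] := df u u01.
  - by apply/eqP; rewrite -subr_eq0 h mul0r.
have := cst01 _ (fun u h => (dU u h).1); have := cst01 _ (fun u h => (dU u h).2).
have abs0K : `|0 : R| < K by rewrite normr0.
have abs1K : `|1 : R| < K by rewrite normr1.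
have S0 : (Sr 0 +i* Si 0 : C) = 1.
  apply: (cvgC_unique (cS 0 abs0K)).
  have := @finite_series_cvg R (fun n => c n * (0 : R)%:C ^+ n) 1.
  rewrite big_nat1 /c bincoef0 !expr0 !mulr1; apply.
  by move=> [//|k _]; rewrite expr0n mulr0.
have [Sr0 Si0] : Sr 0 = 1 /\ Si 0 = 0 by case: S0.
have E00 : cpowR (1 - 0%:C * z) b = 1 by rewrite mul0r subr0 cpowR1l.
have E11 : cpowR (1 - 1%:C * z) b = cpowR (1 - z) b by rewrite mul1r.
have [Er0 Ei0] : Er 0 = 1 /\ Ei 0 = 0 by rewrite /Er /Ei E00.
rewrite Sr0 Si0 Er0 Ei0 !mulr0 !mul0r !(addr0, mulr1, subr0) /Er /Ei E11 => Ui Ur.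
have := cS 1 abs1K; rewrite (_ : (fun n => _) = c); last first.
  by apply/funext => n; rewrite expr1n mulr1.
suff -> : (Sr 1 +i* Si 1 : C) = cpowR (1 - z) (- b) by [].
have x1 : 0 < normc (1 - z) by exact/normc_gt0_Re/Re_1B_gt0.
rewrite cpowRN//.
have E1 : (Sr 1 +i* Si 1 : C) * cpowR (1 - z) b = 1.
  by apply: complex_eq; rewrite ?ReM ?ImM/=.
have E0 : cpowR (1 - z) b != 0.
  by apply/eqP => h; move: E1; rewrite h mulr0 => /esym/eqP; rewrite oner_eq0.
by apply: (mulIf E0); rewrite E1 mulVf.
Qed.

End ComplexPower.

(** * The Gamma function *)

Section PowerInequalities.
Variable R : realType.
Implicit Types x y r s : R.

Lemma powR_posD x r s : 0 < x -> x `^ (r + s) = x `^ r * x `^ s.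
Proof. by move=> x0; rewrite powRD//; apply/implyP => _; rewrite gt_eqF. Qed.

Lemma le_powRl x y r : 0 <= x -> x <= y -> 0 <= r -> x `^ r <= y `^ r.
Proof.
by move=> x0 xy r0; apply: ge0_ler_powR => //; rewrite nnegrE// (le_trans x0).
Qed.

Lemma ge_powRNl x y r : 0 < x -> x <= y -> 0 <= r -> y `^ (- r) <= x `^ (- r).
Proof.
move=> x0 xy r0; rewrite !powRN lef_pV2 ?posrE ?powR_gt0// ?(lt_le_trans x0)//.
by apply: le_powRl => //; exact: ltW.
Qed.

Lemma powR_ge1 x r : 1 <= x -> 0 <= r -> 1 <= x `^ r.
Proof. by move=> x1 r0; rewrite -(powRr0 x); apply: ler_powR. Qed.

Lemma powR_le1 x r : 0 <= x -> x <= 1 -> 0 <= r -> x `^ r <= 1.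
Proof. by move=> x0 x1 r0; have := le_powRl x0 x1 r0; rewrite powR1. Qed.

End PowerInequalities.

Section GammaFunction.
Variable R : realType.
Implicit Types (s x : R).
Local Notation leb := (@lebesgue_measure R).

Lemma integral_FTC2 (f F : R -> R) (a b : R) : a < b ->
  (forall x, a <= x <= b -> is_derive x 1 F (f x)) ->
  (forall x, a <= x <= b -> {for x, continuous f}) ->
  (\int[leb]_(x in `[a, b]) (f x)%:E = (F b - F a)%:E)%E.
Proof.
move=> ab dF cf.
have cF x : a <= x <= b -> {for x, continuous F}.
  move=> xab; apply/differentiable_continuous/derivable1_diffP.
  by have [] := dF x xab.
rewrite EFinB; apply: continuous_FTC2 => //.
- apply: continuous_in_subspaceT => x; rewrite inE/= in_itv/= => xab.
  exact: cf.
- split.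
  + by move=> x; rewrite in_itv/= => /andP[/ltW ax /ltW xb]; have [|] := dF x; rewrite ?ax.
  + by apply: cvg_at_right_filter; apply: cF; rewrite lexx ltW.
  + by apply: cvg_at_left_filter; apply: cF; rewrite lexx ltW.
- move=> x; rewrite in_itv/= => /andP[/ltW ax /ltW xb].
  by rewrite derive1E; have [|_ ->] := dF x; rewrite ?ax.
Qed.

Lemma is_derive_continuous (f : R -> R) (x d : R) :
  is_derive x 1 f d -> {for x, continuous f}.
Proof. by case=> df _; apply/differentiable_continuous/derivable1_diffP. Qed.

Lemma continuous_powRl (s x : R) : 0 < x -> {for x, continuous (fun y => y `^ s)}.
Proof. by move=> x0; exact: is_derive_continuous (is_derive1_powR s x0). Qed.

Definition gamma_integrand s x := x `^ (s - 1) * expR (- x).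

(** Extended real values let the functional equation be proved before finiteness, which is then
    deduced from it. *)
Definition gamma_integral s : \bar R :=
  (\int[leb]_(x in `]0%R, +oo[%classic) (gamma_integrand s x)%:E)%E.

Lemma gamma_integrand_ge0 s x : 0 <= gamma_integrand s x.
Proof. by rewrite mulr_ge0 ?powR_ge0 ?expR_ge0. Qed.

Lemma is_derive_expRN x : is_derive x 1 (fun y => expR (- y)) (- expR (- x)).
Proof.
have := is_derive_compf (f := @expR R) (g := fun u => 0 + u * -1) _ (is_derive_affine 0 (-1) x).
rewrite /= add0r mulrN1 => /(_ _ (is_derive_expR (- x))); rewrite mulrN1.
rewrite (_ : (fun u => _) = (fun y => expR (- y)))//.
by apply/funext => u; rewrite add0r mulrN1.
Qed.

Lemma continuous_gamma_integrand s x : 0 < x -> {for x, continuous (gamma_integrand s)}.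
Proof.
move=> x0; apply: cvgM; first exact: continuous_powRl.
exact: is_derive_continuous (is_derive_expRN x).
Qed.

Lemma measurable_gamma_integrand s : measurable_fun setT (gamma_integrand s).
Proof.
apply: measurable_funM; first exact: measurable_powR.
apply: (continuous_measurable_fun (f := fun x => expR (- x))) => x.
exact: is_derive_continuous (is_derive_expRN x).
Qed.

(** For [m > 0], [exp(x / m) >= x / m] raised to the power [m] gives [exp(x) >= (x / m)^m], so the
    left side is at most [m^m x^(s - m)]. This controls the boundary term at infinity. *)
Lemma gamma_integrand_dec s x (m : nat) : 1 <= x -> s + 1 <= m%:R ->
  x `^ s * expR (- x) <= m%:R ^+ m / x.
Proof.
move=> x1 sm; have x0 : 0 < x by exact: lt_le_trans x1.
have [m0|m0] := posnP m.
  rewrite m0 expr0 in sm *.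
  have : expR (- x) <= 1 by rewrite -expR0 ler_expR oppr_le0 ltW.
  have : x `^ s <= x `^ (-1) by apply: ler_powR => //; lra.
  rewrite powR_inv1 ?(ltW x0)// mul1r => h1 h2.
  by rewrite -[leRHS]mulr1 ler_pM// ?powR_ge0 ?expR_ge0.
have mR : 0 < m%:R :> R by rewrite ltr0n.
have he : (x / m%:R) ^+ m <= expR x.
  have -> : expR x = expR (x / m%:R) ^+ m.
    by rewrite -expRM_natl mulrC divfK// gt_eqF.
  rewrite lerXn2r ?nnegrE ?expR_ge0 ?divr_ge0 ?(ltW x0) ?(ltW mR)//.
  by apply: le_trans (expR_ge1Dx _); rewrite lerDr.
rewrite expRN ler_pdivrMr ?expR_gt0//.
apply: (@le_trans _ _ (m%:R ^+ m / x * (x / m%:R) ^+ m)); last first.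
  by rewrite ler_wpM2l// divr_ge0 ?exprn_ge0 ?(ltW x0)// ltW.
have -> : m%:R ^+ m / x * (x / m%:R) ^+ m = x ^+ m / x.
  by rewrite expr_div_n; field; rewrite expf_neq0 gt_eqF.
have -> : x ^+ m / x = x `^ (m%:R - 1).
  by rewrite powR_posD// powR_mulrn ?(ltW x0)// powR_inv1// ltW.
by apply: ler_powR => //; lra.
Qed.

(** Integration by parts on compact intervals that increase to []0, +oo[]; monotone convergence
    takes care of the integrals, and the boundary terms tend to 0. *)
Lemma gamma_integralS s : 0 < s -> (gamma_integral (s + 1) = s%:E * gamma_integral s)%E.
Proof.
move=> s0.
(* The left endpoint is chosen so that [(a n)^s = 1 / b n], which makes both boundary terms of order
   [1 / n]; starting from 2 ensures [a n < 1 < b n]. *)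
pose a n : R := n.+2%:R `^ (- s^-1); pose b n : R := n.+2%:R.
have b1 n : 1 < b n by rewrite ltr1n.
have b0 n : 0 < b n by exact: lt_trans (b1 n).
have a0 n : 0 < a n by rewrite powR_gt0 // ltr0n.
have as_ n : a n `^ s = (b n)^-1.
  by rewrite /a -powRrM mulNr mulVf ?gt_eqF// powR_inv1// ltW// b0.
have a1 n : a n < 1.
  rewrite ltNge; apply/negP => h.
  have : 1 <= a n `^ s by apply: powR_ge1 => //; exact: ltW.
  by rewrite as_ leNgt invf_lt1 ?b1.
have ab n : a n < b n by exact: lt_trans (a1 n) (b1 n).
pose F n : set (measurableTypeR R) := `[a n, b n]%classic.
have FE : \bigcup_n F n = `]0, +oo[%classic.
  apply/seteqP; split=> x /=.
    by move=> [n _]; rewrite /F/= !in_itv/= andbT => /andP[ax _]; exact: lt_le_trans ax.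
  rewrite in_itv/= andbT => x0.
  pose n := (Num.truncn (Num.max x (x `^ (- s)))).+1.
  have hn : Num.max x (x `^ (- s)) <= b n.
    apply: (le_trans (ltW (Num.Theory.truncnS_gt _))); rewrite ler_nat /n.
    by rewrite ltnS leqW.
  exists n => //; rewrite /F/= in_itv/=; apply/andP; split; last first.
    by apply: le_trans hn; rewrite le_max lexx.
  have {}hn : x `^ (- s) <= b n by apply: le_trans hn; rewrite le_max lexx orbT.
  have := @ge_powRNl _ _ _ s^-1 (powR_gt0 _ x0) hn.
  rewrite -powRrM mulrNN mulfV ?gt_eqF// powRr1 ?(ltW x0)//; apply.
  by rewrite invr_ge0 ltW.
have nF : {homo F : n m / (n <= m)%N >-> (n <= m)%O}.
  move=> n m nm; apply/subsetPset; apply: subset_itv; rewrite bnd_simp.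
    by apply: ge_powRNl; rewrite ?ltr0n// ?ler_nat ?ltnS// invr_ge0 ltW.
  by rewrite ler_nat ltnS.
have mF n : measurable (F n) by exact: measurable_itv.
have mg t n : measurable_fun (F n) (EFin \o gamma_integrand t).
  by apply/measurable_EFinP/measurable_funTS; exact: measurable_gamma_integrand.
have cvg t : (\int[leb]_(x in F n) (gamma_integrand t x)%:E)%E @[n --> \oo] --> gamma_integral t.
  have h0 n x : F n x -> (0 <= (EFin \o gamma_integrand t) x)%E.
    by move=> _; rewrite /= lee_fin gamma_integrand_ge0.
  have := @ge0_nondecreasing_set_cvg_integral _ (measurableTypeR R) R F (EFin \o gamma_integrand t) leb nF mF (mg t) h0.
  by rewrite FE.
have iF t n : leb.-integrable (F n) (EFin \o gamma_integrand t).
  apply: continuous_compact_integrable; first exact: segment_compact.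
  apply: continuous_in_subspaceT => x; rewrite inE /F/= in_itv/= => /andP[ax _].
  exact: continuous_gamma_integrand (lt_le_trans (a0 n) ax).
pose B n := a n `^ s * expR (- a n) - b n `^ s * expR (- b n).
have JS n : (\int[leb]_(x in F n) (gamma_integrand (s + 1) x)%:E =
    s%:E * (\int[leb]_(x in F n) (gamma_integrand s x)%:E) + (B n)%:E)%E.
  have h : (\int[leb]_(x in F n) (gamma_integrand (s + 1) x - s * gamma_integrand s x)%:E
      = (B n)%:E)%E.
    have -> : B n = - (b n `^ s * expR (- b n)) - - (a n `^ s * expR (- a n)).
      by rewrite opprK addrC.
    apply: (@integral_FTC2 _ (fun x => - (x `^ s * expR (- x)))) => // x /andP[ax xb];
      have x0 := lt_le_trans (a0 n) ax.
      have := is_derive_mulfl (-1) (is_derive_mulf (is_derive1_powR s x0) (is_derive_expRN x)).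
      rewrite (_ : (fun u => _) = (fun x => - (x `^ s * expR (- x)))); last first.
        by apply/funext => u; rewrite mulN1r.
      by move/is_derive_eq; apply; rewrite /gamma_integrand addrK; ring.
    apply: cvgB; first exact: continuous_gamma_integrand.
    apply: cvgM; first exact: cvg_cst.
    exact: continuous_gamma_integrand.
  have f1 := integrable_fin_num (mF n) (iF s n).
  have f2 := integrable_fin_num (mF n) (iF (s + 1) n).
  pose J t := (\int[leb]_(x in F n) (gamma_integrand t x)%:E)%E.
  have JB : (B n)%:E = (J (s + 1)%R - s%:E * J s)%E.
    have E := integralB (mF n) (iF (s + 1) n) (integrableZl (mF n) s (iF s n)).
    rewrite -h; apply: eq_trans E _; congr (_ - _)%E.
    exact: (integralZl (mF n) (iF s n)).
  have fJ : (s%:E * J s)%E \is a fin_num by rewrite fin_numM.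
  change (J (s + 1)%R = s%:E * J s + (B n)%:E)%E; rewrite JB [RHS]addeC.
  by rewrite (subeK _ fJ).
have hB : (EFin \o B) @ \oo --> 0%E.
  pose m := (Num.truncn (s + 1)).+1.
  have sm : s + 1 <= m%:R by exact/ltW/Num.Theory.truncnS_gt.
  apply: cvg_EFin; first exact: nearW.
  apply/norm_cvg0P.
  (* [harmonic n.+1] is [1 / (n + 2)], the inverse of [b n]. *)
  apply: (@squeeze_cvgr _ _ _ _ (fun=> 0) (fun n => (m%:R ^+ m + 1) * harmonic n.+1)).
  - apply: nearW => n; rewrite normr_ge0/=.
    have h1 : `|a n `^ s * expR (- a n)| <= (b n)^-1.
      rewrite ger0_norm ?mulr_ge0 ?powR_ge0 ?expR_ge0// as_.
      by rewrite ler_piMr ?invr_ge0 ?(ltW (b0 n))// -expR0 ler_expR oppr_le0 ltW.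
    have h2 : `|b n `^ s * expR (- b n)| <= m%:R ^+ m * (b n)^-1.
      rewrite ger0_norm ?mulr_ge0 ?powR_ge0 ?expR_ge0//.
      by apply: gamma_integrand_dec => //; rewrite ltW.
    apply: (le_trans (ler_normB _ _)); rewrite mulrDl mul1r addrC.
    exact: lerD.
  - exact: cvg_cst.
  - rewrite -[X in _ --> X](mulr0 (m%:R ^+ m + 1)); apply: cvgM; first exact: cvg_cst.
    by have := @cvg_harmonic R; rewrite -cvg_shiftS.
have h1 := cvg (s + 1); have h2 := cvg s.
have h3 : (s%:E * (\int[leb]_(x in F n) (gamma_integrand s x)%:E) + (B n)%:E)%E @[n --> \oo]
    --> (s%:E * gamma_integral s + 0)%E.
  apply: cvgeD; [by rewrite fin_num_adde_defl|exact: cvgeZl|exact: hB].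
rewrite -[RHS]adde0; rewrite (funext JS) in h1.
exact: (cvg_unique _ h1 h3).
Qed.

Lemma gamma_integral_ge0 s : (0 <= gamma_integral s)%E.
Proof. by apply: integral_ge0 => x _; rewrite lee_fin gamma_integrand_ge0. Qed.

Lemma gamma_integral1 : (gamma_integral 1 < +oo)%E.
Proof.
have : (gamma_integral 1 <= \int[leb]_(x in `[0%R, +oo[%classic) (expR (- x))%:E)%E.
  rewrite /gamma_integral; under eq_integral do rewrite /gamma_integrand subrr powRr0 mul1r.
  apply: ge0_subset_integral => //.
  - apply/measurable_EFinP/measurable_funTS.
    apply: (continuous_measurable_fun (f := fun x => expR (- x))) => x.
    exact: is_derive_continuous (is_derive_expRN x).
  - by move=> x /=; rewrite !in_itv/= !andbT => /ltW.
move/le_lt_trans; apply.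
have cE x : {for x, continuous (fun x : R => expR (- x))}.
  exact: is_derive_continuous (is_derive_expRN x).
have cNE x : {for x, continuous (fun x : R => - expR (- x))}.
  by apply: cvgN; exact: cE.
rewrite (@ge0_continuous_FTC2y _ (fun x => expR (- x)) (fun x => - expR (- x)) 0 0).
- by rewrite -EFinB ltry.
- by move=> x _; exact: expR_ge0.
- by apply: continuous_subspaceT => x; exact: cE.
- by rewrite -oppr0; apply: cvgN; exact: cvgr_expR.
- by move=> x _; apply: derivableN; have [] := is_derive_expRN x.
- by apply: cvg_at_right_filter; exact: cNE.
- move=> x _; rewrite derive1E; have [dE dEE] := is_derive_expRN x.
  by rewrite deriveN// dEE opprK.
Qed.

(** Positive integers follow from [s = 1] by the functional equation. At [s + 1] there is no
    singularity at 0, and [x^s <= 1 + x^n] for an integer [n >= s]. The functional equation leads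
    back to [s], as an infinite value there would give one at [s + 1]. *)
Lemma gamma_integral_lty s : 0 < s -> (gamma_integral s < +oo)%E.
Proof.
move=> s0.
have hn n : (gamma_integral n.+1%:R < +oo)%E.
  elim: n => [|n ih]; first exact: gamma_integral1.
  rewrite -natr1 gamma_integralS ?ltr0n//.
  by apply: lte_mul_pinfty => //; rewrite lee_fin.
suff : (gamma_integral (s + 1) < +oo)%E.
  rewrite gamma_integralS// => h; rewrite ltey; apply/eqP => h0.
  by move: h; rewrite h0 gt0_muley ?lte_fin.
pose n := (Num.truncn s).+1.
have sn : s <= n%:R by exact/ltW/Num.Theory.truncnS_gt.
apply: (@le_lt_trans _ _ (gamma_integral 1%:R + gamma_integral n.+1%:R)%E); last first.
  by apply: lte_add_pinfty; exact: hn.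
rewrite /gamma_integral -ge0_integralD//=; first last.
- by apply/measurable_EFinP/measurable_funTS; exact: measurable_gamma_integrand.
- by move=> x _; rewrite lee_fin gamma_integrand_ge0.
- by apply/measurable_EFinP/measurable_funTS; exact: measurable_gamma_integrand.
- by move=> x _; rewrite lee_fin gamma_integrand_ge0.
apply: ge0_le_integral => //.
- by move=> x _; rewrite lee_fin gamma_integrand_ge0.
- by apply/measurable_EFinP/measurable_funTS; exact: measurable_gamma_integrand.
- by apply: emeasurable_funD; apply/measurable_EFinP/measurable_funTS; exact: measurable_gamma_integrand.
- move=> x /=; rewrite in_itv/= andbT => x0.
  rewrite -EFinD lee_fin /gamma_integrand -mulrDl ler_wpM2r ?expR_ge0//.
  rewrite addrK subrr powRr0 -natr1 addrK; have [x1|/ltW x1] := leP x 1.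
    rewrite ler_wpDr ?powR_ge0//.
    by apply: powR_le1 => //; exact: ltW.
  by rewrite ler_wpDl//; apply: ler_powR.
Qed.

Lemma GammaE s : 0 < s -> (Gamma s)%:E = gamma_integral s.
Proof.
move=> s0; rewrite /Gamma /Rintegral fineK// ge0_fin_numE.
  exact: gamma_integral_lty.
exact: gamma_integral_ge0.
Qed.

Lemma GammaS s : 0 < s -> Gamma (s + 1) = s * Gamma s.
Proof.
move=> s0; apply: EFin_inj.
by rewrite EFinM !GammaE// ?gamma_integralS// addr_gt0.
Qed.

(** At [s + 1] the integrand is at least [exp(-2)] on [[1, 2]]; the factor [s] is then divided
    out. *)
Lemma Gamma_gt0 s : 0 < s -> 0 < Gamma s.
Proof.
move=> s0.
suff : 0 < Gamma (s + 1) by rewrite GammaS// pmulr_rgt0.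
rewrite -lte_fin GammaE ?addr_gt0//.
apply: (@lt_le_trans _ _ (\int[leb]_(x in `[1%R, 2%R]%classic) (cst (expR (- 2))%:E x))%E).
  rewrite integral_cst//= lebesgue_measure_itv/= lte_fin ltr1n/=.
  by rewrite -EFinB -EFinM lte_fin mulr_gt0 ?expR_gt0//; lra.
apply: (@le_trans _ _ (\int[leb]_(x in `[1%R, 2%R]%classic) (gamma_integrand (s + 1) x)%:E)%E).
  apply: ge0_le_integral => //.
  - by move=> x _; rewrite lee_fin expR_ge0.
  - by apply/measurable_EFinP/measurable_funTS; exact: measurable_gamma_integrand.
  - move=> x /=; rewrite in_itv/= => /andP[x1 x2].
    rewrite lee_fin /gamma_integrand addrK -[leLHS]mul1r ler_pM ?expR_ge0//.
      by apply: powR_ge1 => //; exact: ltW.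
    by rewrite ler_expR lerN2.
apply: ge0_subset_integral => //.
- by apply/measurable_EFinP/measurable_funTS; exact: measurable_gamma_integrand.
- by move=> x _; rewrite lee_fin gamma_integrand_ge0.
- by move=> x /=; rewrite !in_itv/= andbT => /andP[x1 _]; apply: lt_le_trans x1.
Qed.

Lemma Gamma_ratio (b : R) n : 0 < b -> Gamma (n%:R + b) / (n`!%:R * Gamma b) = bincoef b n.
Proof.
move=> b0; elim: n => [|n ih].
  by rewrite add0r bincoef0 fact0 mul1r divff// gt_eqF// Gamma_gt0.
have n0 : (n.+1%:R : R) != 0 by rewrite pnatr_eq0.
apply: (mulfI n0); rewrite bincoefS -ih -natr1 addrAC GammaS ?ltr_wpDl// factS natrM.
have := Gamma_gt0 b0; have : (n`!%:R : R) != 0 by rewrite pnatr_eq0 -lt0n fact_gt0.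
move=> f0 G0; rewrite -natr1 in n0 *.
by field; rewrite f0 n0 gt_eqF.
Qed.

End GammaFunction.

(** * Fractional derivatives of the moment generating function *)

Section CesaroIdentity.
Variable R : realType.
Local Notation C := (R[i]^o).
Local Notation Rm := (measurableTypeR R).
Variable mu : {finite_measure set Rm -> \bar R}.
Local Notation I01 := (`[0, 1[%classic : set Rm).

Lemma measurable_I01 : measurable I01.
Proof. exact: measurable_itv. Qed.

Lemma I01_le (t : R) : I01 t -> 0 <= t <= 1.
Proof. by rewrite /= in_itv/= => /andP[-> /ltW]. Qed.

Lemma expr_I01_cint n : cmeasurable I01 (fun t => (t%:C : C) ^+ n) /\
  cbounded I01 (fun t => (t%:C : C) ^+ n) /\
  cint mu I01 (fun t => (t%:C : C) ^+ n) = (moment mu n)%:C.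
Proof.
split; first exact/cmeasurableX/cmeasurable_id.
split.
  exists 1 => t /I01_le/andP[t0 t1].
  by rewrite normcX normcR ger0_norm// exprn_ile1.
have E t : (t%:C : C) ^+ n = (t ^+ n)%:C by rewrite rmorphXn.
apply: complex_eq => /=; first by apply: eq_Rintegral => t _; rewrite E.
under eq_Rintegral do rewrite E/=.
by rewrite Rintegral_cst ?mul0r//; exact: measurable_I01.
Qed.

Lemma moment_le n : `|moment mu n| <= fine (mu I01).
Proof.
have [mX [bX E]] := expr_I01_cint n.
have [] := normc_cint_le mu measurable_I01 mX bX; rewrite E normcR => mn h.
apply: (le_trans h); rewrite -[leRHS]mul1r -(Rintegral_cst mu measurable_I01).
apply: le_Rintegral; first exact: measurable_I01.
- apply: (@bounded_integrable R mu I01 (fun t => normc ((t%:C : C) ^+ n)) 1 measurable_I01 mn).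
  move=> t /I01_le/andP[t0 t1].
  by rewrite ger0_norm ?normc_ge0// normcX normcR ger0_norm// exprn_ile1.
- exact: (finite_measure_integrable_cst mu 1 measurable_I01).
- by move=> t /I01_le/andP[t0 t1]; rewrite normcX normcR ger0_norm// exprn_ile1.
Qed.

Lemma moment_gf_expands : expands (moment_gf mu) 0 1 (fun n => (moment mu n)%:C).
Proof.
apply/expandsP => z; rewrite subr0 => z1; rewrite /moment_gf.
have [l hl] : exists l : C, series (fun n => (moment mu n)%:C * z ^+ n) @ \oo --> l.
  apply: (@seriesC_dom_cvg _ _ (fun n => fine (mu I01) * normc z ^+ n)
    (fine (mu I01) * (1 - normc z)^-1)).
    by move=> n; rewrite normcM normcX normcR ler_wpM2r ?exprn_ge0 ?normc_ge0// moment_le.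
  move=> n; rewrite /series/= -mulr_sumr ler_wpM2l//.
    by apply: le_trans (moment_le 0).
  by apply: geometric_sum_le; rewrite normc_ge0.
by rewrite (cvgC_lim hl).
Qed.

(** The binomial series at [t z] is integrated term by term in [t]; since [0 <= t <= 1], the series
    of absolute values at [|z|] dominates. *)
Lemma fracD_moment_gf (alpha : R) (z : C) : 0 < alpha + 1 -> normc z < 1 ->
  fracD alpha (moment_gf mu) z =
  cint mu I01 (fun t => cpowR (1 - t%:C * z) (- (alpha + 1))).
Proof.
move=> b0 z1; rewrite /fracD (taylor_coefE moment_gf_expands); apply: cvgC_lim.
set b := alpha + 1 in b0 *.
have [K hK] := @bincoef_series_le R b (normc z) b0 ltac:(rewrite normc_ge0 z1//).
have mc k : cmeasurable I01 (fun t => (t%:C : C) ^+ k * ((bincoef b k)%:C * z ^+ k)).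
  by apply: cmeasurableM; [have [] := expr_I01_cint k|exact: cmeasurable_cst].
have h := @series_cint R mu I01 (fun k t => (t%:C : C) ^+ k * ((bincoef b k)%:C * z ^+ k))
  (fun k => bincoef b k * normc z ^+ k) (fun t => cpowR (1 - t%:C * z) (- b)) K
  measurable_I01 mc _ hK _.
have {}h : series (fun k => cint mu I01 (fun t => (t%:C : C) ^+ k * ((bincoef b k)%:C * z ^+ k)))
    @ \oo --> cint mu I01 (fun t => cpowR (1 - t%:C * z) (- b)).
  apply: h.
    move=> k t /I01_le/andP[t0 t1]; rewrite !normcM !normcX !normcR.
    rewrite (ger0_norm t0) (ger0_norm (bincoef_ge0 _ _))//.
    rewrite ler_piMl ?exprn_ile1// mulr_ge0 ?exprn_ge0 ?normc_ge0// bincoef_ge0//.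
  move=> t /I01_le/andP[t0 t1].
  have tz : normc (t%:C * z) < 1.
    by rewrite normcM normcR ger0_norm// (le_lt_trans _ z1)// ler_piMl ?normc_ge0.
  apply: eq_cvgC (binomial_series b0 tz) => n; apply: eq_bigr => k _.
  by rewrite exprMn; ring.
apply: eq_cvgC h => n; apply: eq_bigr => k _.
have [mX [bX E]] := expr_I01_cint k.
rewrite (cintMr mu _ measurable_I01 mX bX) E -[(k%:R + alpha) + 1]addrA Gamma_ratio//.
by rewrite mulrA [(moment mu k)%:C * _]mulrC.
Qed.

Lemma disc_analytic_cpowR (b : R) : 0 < b -> disc_analytic (fun z : C => cpowR (1 - z) (- b)).
Proof.
move=> b0; apply: (@expands_disc_analytic _ _ (fun n => (bincoef b n)%:C)).
by apply/expandsP => z; rewrite subr0; exact: binomial_series.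
Qed.

Lemma normc_1B_gt0 (z : C) : normc z < 1 -> 0 < normc (1 - z).
Proof. by move=> z1; exact/normc_gt0_Re/Re_1B_gt0. Qed.

Lemma normc_dilate (t : R) (z : C) : 0 <= t <= 1 -> normc z < 1 -> normc (t%:C * z) < 1.
Proof.
move=> /andP[t0 t1] z1.
by rewrite normcM normcR ger0_norm// (le_lt_trans _ z1)// ler_piMl ?normc_ge0.
Qed.

Lemma cesaro_opE (beta : R) (f : C -> C) (z : C) : normc z < 1 ->
  cesaro_op mu beta f z =
  cint mu I01 (fun t => f (t%:C * z) * cpowR (1 - t%:C * z) (- beta)).
Proof.
move=> z1; apply: eq_cint => t /I01_le t01.
by rewrite cpowRN// normc_1B_gt0// normc_dilate.
Qed.

(** The integrand is the value at [t z] of the single analytic function [f(z) (1 - z)^(- beta)], so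
    the result on integrated dilations applies. *)
Lemma disc_analytic_cesaro (beta : R) (f : C -> C) : 0 < beta -> disc_analytic f ->
  disc_analytic (cesaro_op mu beta f).
Proof.
move=> b0 fa.
apply: (@eq_disc_analytic _ (fun z => cint mu I01
   (fun t => f (t%:C * z) * cpowR (1 - t%:C * z) (- beta)))).
  by move=> z z1; rewrite cesaro_opE.
apply: (disc_analytic_cint_dilation mu
  (f := fun z => f z * cpowR (1 - z) (- beta))).
exact: disc_analyticM fa (disc_analytic_cpowR b0).
Qed.

Lemma cesaro_cpowR (beta kappa : R) (z : C) : 0 < beta + kappa -> normc z < 1 ->
  cesaro_op mu beta (fun w => cpowR (1 - w) (- kappa)) z =
  fracD (beta + kappa - 1) (moment_gf mu) z.
Proof.
move=> bk0 z1; rewrite cesaro_opE// fracD_moment_gf ?subrK//.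
apply: eq_cint => t /I01_le t01.
by rewrite -cpowRD ?normc_1B_gt0 ?normc_dilate// -opprD [kappa + _]addrC.
Qed.

End CesaroIdentity.

(** * Minkowski's inequality *)

Section IntegralTools.
Variable R : realType.
Local Notation Rm := (measurableTypeR R).
Implicit Types (s x y : R).

(** The integral of a nonnegative function is a supremum over the simple functions below it, so
    monotonicity holds for arbitrary [f] and [g]. Integrals of [r |-> integral_mean p f r] can thus
    be compared without studying how the mean depends on [r]. *)
Lemma ge0_le_integral_sub d (T : measurableType d) (m : {measure set T -> \bar R})
    (A D : set T) (f g : T -> \bar R) : A `<=` D ->
  (forall u, A u -> (0 <= f u <= g u)%E) -> (forall u, D u -> (0 <= g u)%E) ->
  (\int[m]_(x in A) f x <= \int[m]_(x in D) g x)%E.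
Proof.
move=> AD fg g0.
rewrite !ge0_integralE//; last by move=> x /fg/andP[].
apply: le_ereal_sup => _ [h hf <-]; exists h => // x; apply: (le_trans (hf x)).
rewrite /patch; case: ifPn => [/set_mem Ax|_]; last first.
  by case: ifPn => // /set_mem /g0.
by rewrite mem_set; [have /andP[] := fg x Ax|exact: AD].
Qed.

Lemma ge0_integralZ_EFin (m : {measure set Rm -> \bar R}) (D : set Rm) (f g : R -> R) (k : R) :
  measurable D -> measurable_fun D (g : Rm -> R) -> (forall t, D t -> 0 <= g t) -> 0 <= k ->
  (forall t, D t -> f t = k * g t) ->
  (\int[m]_(t in D) (f t)%:E = k%:E * \int[m]_(t in D) (g t)%:E)%E.
Proof.
move=> mD mg g0 k0 fg.
have h := @ge0_integralZl_EFin _ _ _ m D mD (fun t => (g t)%:E) _ _ k k0.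
rewrite -h.
- by apply: eq_integral => t; rewrite inE => Dt; rewrite -EFinM fg.
- by move=> t Dt; rewrite lee_fin g0.
- exact/measurable_EFinP.
Qed.

(** The graph of [x^s] lies above its tangent at [c]. It is Young's inequality for [x] and
    [c^(s - 1)]; [s = 1] is apart, its conjugate exponent being infinite. *)
Lemma young_powR s x c : 1 <= s -> 0 <= x -> 0 <= c ->
  s * c `^ (s - 1) * x <= x `^ s + (s - 1) * c `^ s.
Proof.
move=> s1 x0 c0; have s0 : 0 < s by exact: lt_le_trans s1.
have [->|sn1] := eqVneq s 1.
  by rewrite subrr powRr0 mulr1 mul1r mul0r addr0 powRr1.
have s1' : 0 < s - 1 by rewrite subr_gt0 lt_neqAle eq_sym sn1.
have := @conjugate_powR R x (c `^ (s - 1)) s (s / (s - 1)) x0 (powR_ge0 _ _) s0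
  (divr_gt0 s0 s1').
rewrite -powRrM mulrCA mulfV ?gt_eqF// mulr1 => h.
have {}h := h ltac:(by rewrite invf_div -[X in X + _]mul1r -mulrDl addrC subrK divff// gt_eqF).
rewrite -(ler_pM2l s0) in h; rewrite -mulrA [_ * x]mulrC; apply: (le_trans h).
by rewrite le_eqVlt; apply/orP; left; apply/eqP; field; rewrite !gt_eqF.
Qed.

Lemma cvg_truncn_grid (a : R) : 0 <= a ->
  (fun n : nat => (Num.truncn (n.+1%:R * a))%:R / n.+1%:R) @ \oo --> a.
Proof.
move=> a0; apply/cvgrPdist_le => e e0.
near=> n.
have n0 : 0 < n.+1%:R :> R by rewrite ltr0n.
have na0 : 0 <= n.+1%:R * a by rewrite mulr_ge0.
have /andP[t1 t2] := Num.Theory.truncn_itv na0.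
have hn : n.+1%:R^-1 < e.
  rewrite -[ltLHS]ger0_norm ?invr_ge0 ?ltW// -normrN -sub0r.
  by near: n; have /cvgrPdist_lt := @cvg_harmonic R; exact.
rewrite ger0_norm; last by rewrite subr_ge0 ler_pdivrMr// [a * _]mulrC.
apply: le_trans (ltW hn); rewrite -(ler_pM2r n0) mulrBl divfK ?gt_eqF//.
by rewrite mulVf ?gt_eqF// lerBlDr addrC natr1 [a * _]mulrC ltW.
Unshelve. all: by end_near. Qed.

(* Caratheodory functions are jointly measurable: discretize the continuous variable. *)
Lemma measurable_caratheodory (F : R -> R -> R) : (forall y, continuous (F ^~ y)) ->
  (forall x, measurable_fun setT (F x : Rm -> R)) ->
  measurable_fun setT (fun x : Rm * Rm => F (Num.max 0 x.1) x.2).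
Proof.
move=> cF mF.
apply: (@measurable_fun_cvg _ _ _ setT (fun n (x : Rm * Rm) =>
   F ((Num.truncn (n.+1%:R * Num.max 0 x.1))%:R / n.+1%:R) x.2)); last first.
  move=> [x y] _ /=.
  have h := @cvg_truncn_grid (Num.max 0 x) ltac:(by rewrite le_max lexx).
  exact: (cvg_comp _ _ h (cF y _)).
move=> n _ Y mY; rewrite setTI.
(* On [A k] the discretized first variable is constantly [k / (n + 1)], so the preimage of [Y] is a
   countable union of rectangles. *)
pose A k : set Rm := [set x | k%:R <= n.+1%:R * Num.max 0 x < k.+1%:R].
pose B k : set Rm := F (k%:R / n.+1%:R) @^-1` Y.
have mA k : measurable (A k).
  have c : continuous (fun x : R => n.+1%:R * Num.max 0 x).
    move=> x; apply: cvgM; first exact: cvg_cst.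
    have h0 : (cst 0 : R -> R) x @[x --> x] --> (0 : R) by exact: cvg_cst.
    have h1 : id x @[x --> x] --> (x : R) by exact: cvg_id.
    exact: (continuous_max h0 h1).
  have h := continuous_measurable_fun c measurableT
     (measurable_itv (Interval (BLeft k%:R) (BLeft k.+1%:R))).
  rewrite setTI in h; rewrite (_ : A k = (fun x : R => n.+1%:R * Num.max 0 x) @^-1`
    [set` Interval (BLeft k%:R) (BLeft k.+1%:R)])//.
have mB k : measurable (B k).
  by have := mF (k%:R / n.+1%:R) measurableT Y mY; rewrite setTI.
have -> : (fun x : Rm * Rm =>
   F ((Num.truncn (n.+1%:R * Num.max 0 x.1))%:R / n.+1%:R) x.2) @^-1` Y =
   \bigcup_k (A k `*` B k).
  apply/seteqP; split=> [[x y] /= h|[x y] [k _] [/= Ax By]] /=.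
    exists (Num.truncn (n.+1%:R * Num.max 0 x)) => //; split => //=.
    by apply: Num.Theory.truncn_itv; rewrite mulr_ge0// le_max lexx.
  by rewrite (Num.Theory.truncn_def Ax).
by apply: bigcup_measurable => k _; exact: measurableX.
Qed.

Lemma tonelli_restrict (m1 m2 : {sigma_finite_measure set Rm -> \bar R})
    (D1 D2 : set Rm) (F : R -> R -> R) : measurable D1 -> measurable D2 ->
  (forall x y, 0 <= F x y) -> measurable_fun setT (fun x : Rm * Rm => F x.1 x.2) ->
  (\int[m2]_(y in D2) \int[m1]_(x in D1) (F x y)%:E =
   \int[m1]_(x in D1) \int[m2]_(y in D2) (F x y)%:E)%E.
Proof.
move=> mD1 mD2 F0 mF.
pose f (z : Rm * Rm) : \bar R := (F z.1 z.2 * \1_D1 z.1 * \1_D2 z.2)%:E.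
have mf : measurable_fun setT f.
  apply/measurable_EFinP; apply: measurable_funM; last first.
    exact: (measurableT_comp (measurable_indic mD2) measurable_snd).
  apply: measurable_funM => //.
  exact: (measurableT_comp (measurable_indic mD1) measurable_fst).
have f0 z : (0 <= f z)%E by rewrite lee_fin !mulr_ge0.
have h := @fubini_tonelli _ _ _ _ R m1 m2 f mf f0.
have mF1 y : measurable_fun setT (fun x : Rm => F x y).
  exact: (measurableT_comp mF (measurable_pair2 y)).
have mF2 x : measurable_fun setT (fun y : Rm => F x y).
  exact: (measurableT_comp mF (measurable_pair1 x)).
transitivity (\int[m2]_y \int[m1]_x f (x, y))%E.
  rewrite integral_mkcond; apply: eq_integral => y _.
  rewrite /patch /f /=; case: ifPn => yD.
    rewrite integral_mkcond; apply: eq_integral => x _.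
    rewrite /patch indicE [in RHS]indicE yD mulr1; case: ifPn => xD; rewrite ?mulr1// mulr0//.
  rewrite integral0_eq// => x _; by rewrite indicE [in X in _ * X]indicE (negbTE yD) mulr0.
rewrite -h [in RHS]integral_mkcond; apply: eq_integral => x _.
rewrite /patch /f /=; case: ifPn => xD.
  rewrite [RHS]integral_mkcond; apply: eq_integral => y _.
  rewrite /patch !indicE xD mulr1; case: ifPn => yD; rewrite ?mulr1// mulr0//.
by rewrite integral0_eq// => y _; rewrite !indicE (negbTE xD) mulr0 mul0r.
Qed.

End IntegralTools.

Section Minkowski.
Variable R : realType.
Local Notation C := (R[i]^o).
Local Notation Rm := (measurableTypeR R).
Variable mu : {finite_measure set Rm -> \bar R}.
Local Notation I01 := (`[0, 1[%classic : set Rm).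
Local Notation leb := (@lebesgue_measure R).
Local Notation circle := (`[0%R, (2 * pi)%R]%classic : set Rm).

Lemma poweR_inv_le (X : \bar R) (s y : R) : 0 < s -> (0 <= X)%E -> 0 <= y ->
  (X `^ s^-1 <= y%:E)%E = (X <= (y `^ s)%:E)%E.
Proof.
move=> s0 X0 y0.
have K (Y : \bar R) : (0 <= Y)%E -> ((Y `^ s^-1) `^ s)%E = Y.
  by move=> Y0; rewrite -poweRrM mulVf ?gt_eqF// poweRe1.
have K' : (((y `^ s)%:E) `^ s^-1)%E = y%:E.
  by rewrite poweR_EFin -powRrM mulfV ?gt_eqF// powRr1.
have in0 (Y : \bar R) : (0 <= Y)%E -> Y \in `[0%E, +oo%E].
  by move=> Y0; rewrite in_itv/= Y0 leey.
apply/idP/idP => h.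
  rewrite -(K X X0) -poweR_EFin; apply: gt0_ler_poweR => //; first exact: ltW.
    exact/in0/poweR_ge0.
  by apply: in0; rewrite lee_fin.
rewrite -K'; apply: gt0_ler_poweR => //; first by rewrite invr_ge0 ltW.
  exact: in0.
by apply: in0; rewrite lee_fin powR_ge0.
Qed.

Lemma normc_circle_pt (r theta : R) : normc (circle_pt r theta) = `|r|.
Proof.
by rewrite /= !exprMn -mulrDr cos2Dsin2 mulr1 sqrtr_sqr.
Qed.

Lemma circle_ptM (t r theta : R) : circle_pt (t * r) theta = t%:C * circle_pt r theta.
Proof. by apply: complex_eq; rewrite ?ReZ ?ImZ /= mulrA. Qed.

Lemma ccontinuous_circle_pt (t r : R) : ccontinuous (fun theta => t%:C * circle_pt r theta).
Proof.
split=> theta; rewrite /comp; under eq_fun do rewrite ?ReZ ?ImZ/=.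
  apply: cvgM; first exact: cvg_cst.
  by apply: cvgM; [exact: cvg_cst|exact: continuous_cos].
apply: cvgM; first exact: cvg_cst.
by apply: cvgM; [exact: cvg_cst|exact: continuous_sin].
Qed.

Lemma measurable_polar (phi : C -> C) (r : R) : disc_analytic phi -> 0 <= r < 1 ->
  measurable_fun setT (fun x : Rm * Rm => normc (phi ((clamp x.1)%:C * circle_pt r x.2))).
Proof.
move=> pa /andP[r0 r1].
have c1 theta : normc (circle_pt r theta) < 1 by rewrite normc_circle_pt ger0_norm.
(* This matches the form of [measurable_caratheodory], which discretizes [max 0 t]. *)
have E (x : Rm * Rm) : clamp x.1 = clamp (Num.max 0 x.1).
  rewrite /clamp; case: (leP 0 x.1) => // x0.
  by rewrite (min_idPl (ltW (lt_trans x0 ltr01))) (max_idPl (ltW x0)) (min_idPl ler01)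
    (max_idPl (lexx 0)).
under eq_fun do rewrite E.
apply: (@measurable_caratheodory R (fun t theta => normc (phi ((clamp t)%:C * circle_pt r theta)))).
  move=> theta; apply: ccontinuous_normc.
  apply: (disc_analytic_continuous pa _ (ccontinuous_clampM (circle_pt r theta))) => t.
  exact: normc_clampM.
move=> t; apply: (@continuous_measurable_fun R).
apply: ccontinuous_normc.
apply: (disc_analytic_continuous pa _ (ccontinuous_circle_pt (clamp t) r)) => theta.
exact: normc_clampM.
Qed.

Lemma EFin_Rintegral (D : set Rm) (f : R -> R) :
  mu.-integrable D (fun t => (f t)%:E) ->
  measurable D -> (\int[mu]_(t in D) f t)%:E = (\int[mu]_(t in D) (f t)%:E)%E.
Proof. by move=> fi mD; rewrite fineK//; exact: (integrable_fin_num mD fi). Qed.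

(* Jensen's inequality for the weight [psi mu], in the form of Young's inequality
   integrated against the weight. *)
Lemma jensen_cint (g : R -> C) (psi : R -> R) (s H m M : R) : 1 <= s -> 0 < H -> 0 < m ->
  cmeasurable I01 g -> cbounded I01 g -> measurable_fun I01 (psi : Rm -> R) ->
  (forall t, I01 t -> m <= psi t <= M) -> \int[mu]_(t in I01) psi t <= H ->
  (((normc (cint mu I01 g)) `^ s)%:E <=
   (H `^ (s - 1))%:E * \int[mu]_(t in I01) (normc (g t) `^ s * psi t `^ (1 - s))%:E)%E.
Proof.
move=> s1 H0 m0 mg bg mpsi psib psiH.
have mI := @measurable_I01 R.
have s0 : 0 < s by exact: lt_le_trans s1.
have [mn cle] := normc_cint_le mu mI mg bg.
have [B gB] := bg.
have psi0 t : I01 t -> 0 < psi t by move=> /psib/andP[h _]; exact: lt_le_trans h.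
have in_ : mu.-integrable I01 (fun t => (normc (g t))%:E).
  by apply: (@bounded_integrable R mu I01 (fun t => normc (g t)) B) => // t It; rewrite ger0_norm ?normc_ge0// gB.
have ipsi : mu.-integrable I01 (fun t => (psi t)%:E).
  apply: (@bounded_integrable R mu I01 psi M) => // t It.
  by rewrite gtr0_norm ?psi0//; have /andP[] := psib t It.
have iu : mu.-integrable I01 (fun t => (normc (g t) `^ s * psi t `^ (1 - s))%:E).
  apply: (@bounded_integrable R mu I01 (fun t => normc (g t) `^ s * psi t `^ (1 - s)) (B `^ s * m `^ (1 - s))) => //.
    by apply: measurable_funM; apply: (measurableT_comp (measurable_powR _)).
  move=> t It; rewrite ger0_norm ?mulr_ge0 ?powR_ge0//; apply: ler_pM; rewrite ?powR_ge0//.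
    by apply: le_powRl; rewrite ?normc_ge0 ?gB// ltW.
  have -> : 1 - s = - (s - 1) by rewrite opprB.
  by apply: ge_powRNl; rewrite ?subr_ge0//; have /andP[] := psib t It.
rewrite -EFin_Rintegral// -EFinM lee_fin.
set A := \int[mu]_(t in I01) normc (g t) in cle.
set U := \int[mu]_(t in I01) _.
have A0 : 0 <= A by apply: Rintegral_ge0 => t _; exact: normc_ge0.
apply: (@le_trans _ _ (A `^ s)); first by apply: le_powRl; rewrite ?normc_ge0// ltW.
(* Young's inequality is applied to [|g| / psi] with tangent point [c], the mean of that quotient
   against [psi mu] when [H] is the total mass. A larger [H] is allowed, because the mass enters
   with the nonnegative coefficient [(s - 1) c^s]. *)
pose c := A / H.
have c0 : 0 <= c by rewrite divr_ge0// ltW.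
have AE : A = c * H by rewrite /c divfK// gt_eqF.
have cs : c `^ s = c `^ (s - 1) * c.
  have [->|cn0] := eqVneq c 0; first by rewrite mulr0 powR0// gt_eqF.
  by rewrite -{3}(powRr1 c0) -powR_posD ?subrK// lt_def cn0.
have hU : s * c `^ (s - 1) * A <= U + (s - 1) * c `^ s * \int[mu]_(t in I01) psi t.
  have iZ (k : R) (f : R -> R) : mu.-integrable I01 (fun t => (f t)%:E) ->
      mu.-integrable I01 (fun t => (k * f t)%:E) by move=> fi; have := integrableZl mI k fi.
  rewrite /A /U -RintegralZl// -RintegralZl// -RintegralD//; last exact: iZ.
  apply: le_Rintegral => //; first exact: iZ.
    exact: (integrableD mI iu (iZ _ _ ipsi)).
  move=> t It; have p0 := psi0 t It.
  have := @young_powR R s (normc (g t) / psi t) c s1 (divr_ge0 (normc_ge0 _) (ltW p0)) c0.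
  rewrite -(ler_pM2r p0) => h; apply: le_trans (le_trans h _).
    by rewrite -[leRHS]mulrA divfK// gt_eqF.
  rewrite mulrDl lerD2r powRM ?normc_ge0 ?invr_ge0 ?(ltW p0)// -mulrA.
  rewrite ler_wpM2l ?powR_ge0// -powR_inv1 ?(ltW p0)// -powRrM mulN1r.
  by rewrite -{2}(powRr1 (ltW p0)) -powR_posD// addrC.
have hU2 : c `^ s * H <= U.
  have h3 : (s - 1) * c `^ s * \int[mu]_(t in I01) psi t <= (s - 1) * c `^ s * H.
    by rewrite ler_wpM2l// mulr_ge0 ?powR_ge0// subr_ge0.
  have h4 : s * c `^ (s - 1) * A = s * c `^ s * H by rewrite AE cs; ring.
  by move: hU h3; rewrite h4; lra.
have HE : H `^ s = H `^ (s - 1) * H.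
  by rewrite -[X in _ * X](powRr1 (ltW H0)) -powR_posD// subrK.
rewrite AE powRM ?(ltW H0)// HE.
by rewrite mulrCA ler_wpM2l ?powR_ge0.
Qed.

(** For finite [p = s], Jensen's inequality at each point of the circle, with weight [psi^(1 - s)],
    is integrated in [theta]. After Tonelli the inner integral is the [s]-th power of the mean at
    radius [t r], at most [psi^s], and only [psi] is left. The bound [m > 0] keeps [psi^(1 - s)]
    bounded. *)
Lemma minkowski_dilation (p : \bar R) (phi : C -> C) (r : R) (psi : R -> R) (m M : R) :
  (1 <= p)%E -> disc_analytic phi -> 0 <= r < 1 -> 0 < m ->
  measurable_fun setT (psi : Rm -> R) -> (forall t, I01 t -> m <= psi t <= M) ->
  (forall t, I01 t -> integral_mean p phi (t * r) <= (psi t)%:E)%E ->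
  (integral_mean p (fun z => cint mu I01 (fun t => phi (t%:C * z)))%R r <=
   (\int[mu]_(t in I01) psi t)%:E)%E.
Proof.
move=> p1 pa r01 m0 mpsi psib hpsi; have /andP[r0 r1] := r01.
have mI := @measurable_I01 R.
have mpsiI : measurable_fun I01 (psi : Rm -> R) by exact: measurable_funTS.
have psi0 t : I01 t -> 0 < psi t by move=> /psib/andP[h _]; exact: lt_le_trans h.
have ipsi : mu.-integrable I01 (fun t => (psi t)%:E).
  apply: (@bounded_integrable R mu I01 psi M) => // t It.
  by rewrite gtr0_norm ?psi0//; have /andP[] := psib t It.
have dil z : normc z < 1 -> cmeasurable I01 (fun t => phi (t%:C * z)) /\
    cbounded I01 (fun t => phi (t%:C * z)).
  by move=> z1; apply: disc_analytic_dilation => // t; exact: I01_le.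
case: p p1 hpsi => [s| |//] p1 hpsi.
- rewrite lee_fin in p1; have s0 : 0 < s by exact: lt_le_trans p1.
  have pi2 : 0 < 2 * pi :> R by rewrite mulr_gt0// pi_gt0.
  apply/lee_addgt0Pr => e e0; rewrite -EFinD.
  (* Jensen's inequality divides by [H], while the integral of [psi] vanishes when [mu] does; hence
     the added [e]. *)
  set H := _ + e.
  have psiH : \int[mu]_(t in I01) psi t <= H by rewrite lerDl ltW.
  have H0 : 0 < H by rewrite ltr_wpDl// Rintegral_ge0// => t It; exact/ltW/psi0.
  rewrite /integral_mean poweR_inv_le ?(ltW H0)//; last first.
    by apply: integral_ge0 => x _; rewrite lee_fin divr_ge0 ?powR_ge0// ltW.
  (* [clamp] makes [F] jointly measurable on the whole plane, as Tonelli's theorem requires, without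
     changing it on [[0, 1[]. *)
  pose F t theta := H `^ (s - 1) / (2 * pi) *
    (normc (phi ((clamp t)%:C * circle_pt r theta)) `^ s * psi t `^ (1 - s)).
  have F0 t theta : 0 <= F t theta.
    by rewrite /F mulr_ge0 ?divr_ge0 ?mulr_ge0 ?powR_ge0 ?pi_ge0.
  have mF : measurable_fun setT (fun x : Rm * Rm => F x.1 x.2).
    apply: measurable_funM => //; apply: measurable_funM.
      apply: (measurableT_comp (measurable_powR s)); exact: measurable_polar.
    apply: (measurableT_comp (measurable_powR _)).
    exact: (measurableT_comp mpsi measurable_fst).
  apply: (@le_trans _ _ (\int[leb]_(theta in circle) \int[mu]_(t in I01) (F t theta)%:E)%E).
    apply: ge0_le_integral_sub => //; last first.
      by move=> theta _; apply: integral_ge0 => t _; rewrite lee_fin.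
    move=> theta _; rewrite lee_fin divr_ge0 ?powR_ge0 ?(ltW pi2)//=.
    have c1 : normc (circle_pt r theta) < 1 by rewrite normc_circle_pt ger0_norm.
    have [mg bg] := dil _ c1.
    have j := @jensen_cint _ psi s H m M p1 H0 m0 mg bg mpsiI psib psiH.
    have [mn _] := normc_cint_le mu mI mg bg.
    have -> : (\int[mu]_(t in I01) (F t theta)%:E = (H `^ (s - 1) / (2 * pi))%:E *
        \int[mu]_(t in I01) (normc (phi (t%:C * circle_pt r theta)) `^ s * psi t `^ (1 - s))%:E)%E.
      apply: ge0_integralZ_EFin => //.
      - apply: measurable_funM; first exact: (measurableT_comp (measurable_powR _)).
        exact: (measurableT_comp (measurable_powR _)).
      - by move=> t _; rewrite mulr_ge0 ?powR_ge0.
      - by rewrite divr_ge0 ?powR_ge0 ?(ltW pi2).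
      - by move=> t /I01_le It; rewrite /F clampE.
    rewrite [_ / (2 * pi)]mulrC EFinM [(H `^ _ / _)%R]mulrC EFinM -muleA.
    by apply: lee_wpmul2l => //; rewrite lee_fin invr_ge0 ltW.
  have mcirc : measurable circle by exact: measurable_itv.
  rewrite (@tonelli_restrict R mu leb I01 circle F mI mcirc F0 mF).
  apply: (@le_trans _ _ (\int[mu]_(t in I01) (H `^ (s - 1) * psi t)%:E)%E); last first.
    have E := integralZl mI ipsi (H `^ (s - 1)).
    rewrite (_ : (\int[mu]_(t in I01) _)%E = ((H `^ (s - 1))%:E * \int[mu]_(t in I01) (psi t)%:E)%E) //.
    have HE : H `^ s = H `^ (s - 1) * H.
      by rewrite -[X in _ * X](powRr1 (ltW H0)) -powR_posD// subrK.
    by rewrite -EFin_Rintegral// -EFinM lee_fin HE ler_wpM2l ?powR_ge0.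
  apply: ge0_le_integral_sub => //; last first.
    by move=> t It; rewrite lee_fin mulr_ge0 ?powR_ge0// ltW// psi0.
  move=> t It; rewrite integral_ge0/=; last by move=> theta _; rewrite lee_fin.
  have p0 := psi0 t It.
  have := hpsi t It; rewrite /integral_mean poweR_inv_le ?(ltW p0)//; last first.
    by apply: integral_ge0 => x _; rewrite lee_fin divr_ge0 ?powR_ge0// ltW.
  move=> h.
  have tr1 theta : normc (circle_pt r theta) < 1 by rewrite normc_circle_pt ger0_norm.
  have -> : (\int[leb]_(theta in circle) (F t theta)%:E = (H `^ (s - 1) * psi t `^ (1 - s))%:E *
      \int[leb]_(theta in circle) (normc (phi (circle_pt (t * r) theta)) `^ s / (2 * pi))%:E)%E.
    apply: ge0_integralZ_EFin => //.
    - apply: measurable_funTS; apply: measurable_funM => //.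
      apply: (measurableT_comp (measurable_powR _)).
      apply: (@continuous_measurable_fun R); apply: ccontinuous_normc.
      under eq_fun do rewrite circle_ptM.
      apply: (disc_analytic_continuous pa _ (ccontinuous_circle_pt t r)) => theta.
      by apply: normc_dilate => //; exact: I01_le.
    - by move=> theta _; rewrite divr_ge0 ?powR_ge0// ltW.
    - by rewrite mulr_ge0 ?powR_ge0.
    - move=> theta _; rewrite /F clampE ?I01_le// -circle_ptM; ring.
  apply: (@le_trans _ _ ((H `^ (s - 1) * psi t `^ (1 - s))%:E * (psi t `^ s)%:E)%E).
    by apply: lee_wpmul2l => //; rewrite lee_fin mulr_ge0 ?powR_ge0.
  by rewrite -EFinM lee_fin -mulrA -powR_posD// subrK powRr1 ?lexx// ltW.
- rewrite /integral_mean; apply: ge_ereal_sup => _ [z zr <-].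
  have zE : normc z = r by move: zr => /=; rewrite normrCE => -[].
  have z1 : normc z < 1 by rewrite zE.
  have [mg bg] := dil z z1.
  have [mn cle] := normc_cint_le mu mI mg bg.
  rewrite lee_fin; apply: (le_trans cle); apply: le_Rintegral => //.
    have [B gB] := bg.
    apply: (@bounded_integrable R mu I01 (fun t => normc (phi (t%:C * z))) B) => // t It.
    by rewrite ger0_norm ?normc_ge0// gB.
  move=> t It; rewrite -lee_fin; apply: le_trans (hpsi t It).
  apply: ereal_sup_ubound; exists (t%:C * z) => //=.
  rewrite normrCE normcM normcR zE ger0_norm//.
  by have /andP[] := I01_le It.
Qed.

End Minkowski.

(** * A Hardy inequality for the kernel integrals *)

Section KernelIntegral.
Variable R : realType.
Local Notation Rm := (measurableTypeR R).
Variable mu : {finite_measure set Rm -> \bar R}.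
Local Notation I01 := (`[0, 1[%classic : set Rm).
Implicit Types (b r s t x : R).

(** [k = 0] gives [h_b]; the factor [t^k] accounts for derivatives in [r]. *)
Definition kernel_int (k : nat) (b r : R) : R :=
  \int[mu]_(t in I01) (t ^+ k * (1 - t * r) `^ (- b)).

Lemma kernel_le k b r v t : 0 <= b -> 0 <= v < 1 -> r <= v -> I01 t ->
  0 < 1 - t * r /\ 0 <= t ^+ k * (1 - t * r) `^ (- b) <= (1 - v) `^ (- b).
Proof.
move=> b0 /andP[v0 v1] rv /I01_le/andP[t0 t1].
have tr : t * r <= v.
  have [r0|r0] := leP r 0; first by apply: le_trans v0; rewrite mulr_ge0_le0.
  by apply: le_trans rv; rewrite ler_piMl// ltW.
have h : 1 - v <= 1 - t * r by rewrite lerD2l lerN2.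
have v1' : 0 < 1 - v by rewrite subr_gt0.
split; first exact: lt_le_trans h.
rewrite mulr_ge0 ?powR_ge0 ?exprn_ge0//=.
apply: (@le_trans _ _ (1 * (1 - t * r) `^ (- b))).
  by rewrite ler_wpM2r ?powR_ge0// exprn_ile1.
by rewrite mul1r; apply: ge_powRNl.
Qed.

Lemma measurable_kernel k b r :
  measurable_fun setT ((fun t => t ^+ k * (1 - t * r) `^ (- b)) : Rm -> R).
Proof.
apply: measurable_funM; first exact: exprn_measurable.
apply: (measurableT_comp (measurable_powR _)).
apply: measurable_funB => //; exact: measurable_funM.
Qed.

Lemma integrable_kernel k b r : 0 <= b -> r < 1 ->
  mu.-integrable I01 (fun t => (t ^+ k * (1 - t * r) `^ (- b))%:E).
Proof.
move=> b0 r1; pose v := Num.max 0 r.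
have v01 : 0 <= v < 1 by rewrite le_max lexx gt_max ltr01 r1.
have rv : r <= v by rewrite le_max lexx orbT.
apply: (@bounded_integrable R mu I01 (fun t => t ^+ k * (1 - t * r) `^ (- b)) ((1 - v) `^ (- b))).
- exact: measurable_I01.
- by apply: measurable_funTS; exact: measurable_kernel.
- move=> t It; have [_ /andP[h1 h2]] := @kernel_le k _ _ _ _ b0 v01 rv It.
  by rewrite ger0_norm.
Qed.

Lemma kernel_int_ge0 k b r : 0 <= kernel_int k b r.
Proof.
apply: Rintegral_ge0 => t /I01_le/andP[t0 _].
by rewrite mulr_ge0 ?exprn_ge0 ?powR_ge0.
Qed.

(** Differentiation under the integral on []-1, v[], with [v] midway between [|r|] and 1: there the
    derivative of the integrand is at most the constant [b (1 - v)^(- (b + 1))], integrable since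
    [mu] is finite. *)
Lemma is_derive_kernel_int k b r : 0 <= b -> -1 < r < 1 ->
  is_derive r 1 (kernel_int k b) (b * kernel_int k.+1 (b + 1) r).
Proof.
move=> b0 /andP[rN1 r1].
pose v := (1 + `|r|) / 2.
have ra : `|r| < 1 by rewrite ltr_norml rN1.
have v01 : 0 <= v < 1 by rewrite /v; have n0 := normr_ge0 r; apply/andP; split; lra.
have rv : r < v by rewrite /v; have := ler_norm r; lra.
have b1 : 0 <= b + 1 by rewrite addr_ge0.
pose f x (t : R) := t ^+ k * (1 - t * x) `^ (- b).
have df x t : (`]-1, v[%classic : set R) x -> I01 t ->
    is_derive x 1 (f ^~ t) (b * (t ^+ k.+1 * (1 - t * x) `^ (- (b + 1)))).
  rewrite /= in_itv/= => /andP[_ /ltW xv] It.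
  have [p0 _] := @kernel_le k _ _ _ _ b0 v01 xv It.
  have h : is_derive x 1 (fun u => 1 - t * u) (- t).
    have := is_derive_affine 1 (- t) x.
    rewrite (_ : (fun u => _) = (fun u => 1 - t * u))//.
    by apply/funext => u; rewrite mulrN mulrC.
  have := is_derive_mulfl (t ^+ k) (is_derive_compf (g := fun u => 1 - t * u)
    (is_derive1_powR (- b) p0) h).
  move/is_derive_eq; apply; rewrite exprS opprD; ring.
have Ir : (`]-1, v[%classic : set R) r by rewrite /= in_itv/= rN1.
have i1 x : (`]-1, v[%classic : set R) x -> mu.-integrable I01 (EFin \o f x).
  rewrite /= in_itv/= => /andP[_ xv]; apply: integrable_kernel => //.
  by apply: lt_trans xv _; case/andP: v01.
have d1 x t : (`]-1, v[%classic : set R) x -> I01 t -> derivable (f ^~ t) x 1.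
  by move=> xI It; have [] := df x t xI It.
pose G (_ : R) := b * (1 - v) `^ (- (b + 1)).
have G0 y : 0 <= G y by rewrite mulr_ge0 ?powR_ge0.
have iG : mu.-integrable I01 (EFin \o G).
  exact: (finite_measure_integrable_cst mu (b * (1 - v) `^ (- (b + 1))) (@measurable_I01 R)).
have E x t : (`]-1, v[%classic : set R) x -> I01 t ->
    partial1of2 f x t = b * (t ^+ k.+1 * (1 - t * x) `^ (- (b + 1))).
  by move=> xI It; rewrite partial1of2E; have [_ ->] := df x t xI It.
have Gu x t : (`]-1, v[%classic : set R) x -> I01 t -> `|partial1of2 f x t| <= G t.
  move=> xI It; rewrite (E _ _ xI It).
  move: xI; rewrite /= in_itv/= => /andP[_ /ltW xv].
  have [_ /andP[h1 h2]] := @kernel_le k.+1 _ _ _ _ b1 v01 xv It.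
  by rewrite ger0_norm; [exact: ler_wpM2l|exact: mulr_ge0].
have D1 := @derivable_under_integral R _ Rm mu f I01 (@measurable_I01 R) r (-1) v Ir i1 d1 G G0 iG Gu.
have D2 := @differentiation_under_integral R _ Rm mu f I01 (@measurable_I01 R) r (-1) v Ir i1 d1 G G0 iG Gu.
apply: DeriveDef => //.
rewrite -derive1E; rewrite /kernel_int.
rewrite -RintegralZl; [|exact: measurable_I01|exact: integrable_kernel].
apply: eq_trans D2 _; apply: eq_Rintegral => t; rewrite inE => It.
exact: E.
Qed.

Lemma continuous_kernel_int k b r : 0 <= b -> -1 < r < 1 ->
  {for r, continuous (kernel_int k b)}.
Proof. by move=> b0 r1; exact: is_derive_continuous (is_derive_kernel_int k b0 r1). Qed.

(** Pointwise in [t]: [t <= 1], and [(1 - r) / (1 - t r) <= 1] is raised to the power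
    [1 - s >= 0]. *)
Lemma kernel_int_deriv_le (b s r : R) : 0 <= b -> 0 <= s <= 1 -> 0 <= r < 1 ->
  (1 - r) * kernel_int 1 (b + 1) r <= (1 - r) `^ s * kernel_int 0 (b + s) r.
Proof.
move=> b0 /andP[s0 s1] r01; have /andP[r0 r1] := r01.
have d0 : 0 < 1 - r by rewrite subr_gt0.
have i1 := @integrable_kernel 1 _ _ (addr_ge0 b0 ler01) r1.
have i2 := @integrable_kernel 0 _ _ (addr_ge0 b0 s0) r1.
have mI := @measurable_I01 R.
rewrite -!RintegralZl//; apply: le_Rintegral => //.
- exact: (integrableZl mI _ i1).
- exact: (integrableZl mI _ i2).
move=> t It; have [p0 _] := @kernel_le 0 _ _ _ _ b0 r01 (lexx r) It.
have /andP[t0 t1] := I01_le It.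
rewrite expr1 expr0 mul1r.
have tr : 1 - r <= 1 - t * r by rewrite lerD2l lerN2 ler_piMl.
have -> : (1 - t * r) `^ (- (b + 1)) = (1 - t * r) `^ (- (b + s)) * (1 - t * r) `^ (- (1 - s)).
  by rewrite -powR_posD//; congr (_ `^ _); ring.
rewrite (_ : (1 - r) * _ = t * ((1 - t * r) `^ (- (b + s)) * ((1 - r) * (1 - t * r) `^ (- (1 - s))))); last by ring.
apply: (@le_trans _ _ (1 * ((1 - t * r) `^ (- (b + s)) * ((1 - r) * (1 - t * r) `^ (- (1 - s)))))).
  by rewrite ler_wpM2r// !mulr_ge0 ?powR_ge0// ltW.
rewrite mul1r mulrC ler_wpM2r ?powR_ge0//.
apply: (@le_trans _ _ ((1 - r) * (1 - r) `^ (- (1 - s)))).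
  by rewrite ler_wpM2l ?(ltW d0)//; apply: ge_powRNl; rewrite ?subr_ge0.
rewrite -{1}(powRr1 (ltW d0)) -powR_posD//.
by rewrite le_eqVlt; apply/orP; left; apply/eqP; congr (_ `^ _); ring.
Qed.

(** Pointwise in [t], the quotient of the integrands is [((1 - r) / (1 - t r))^s <= 1]. *)
Lemma kernel_int_mono_exp (b s r : R) : 0 <= b -> 0 <= s -> 0 <= r < 1 ->
  (1 - r) `^ s * kernel_int 0 (b + s) r <= kernel_int 0 b r.
Proof.
move=> b0 s0 r01; have /andP[r0 r1] := r01.
have d0 : 0 < 1 - r by rewrite subr_gt0.
have i2 := @integrable_kernel 0 _ _ (addr_ge0 b0 s0) r1.
have mI := @measurable_I01 R.
rewrite -!RintegralZl//; apply: le_Rintegral => //.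
- exact: (integrableZl mI _ i2).
- exact: integrable_kernel.
move=> t It; have [p0 _] := @kernel_le 0 _ _ _ _ b0 r01 (lexx r) It.
have /andP[t0 t1] := I01_le It.
rewrite expr0 !mul1r opprD powR_posD// mulrCA ler_piMr ?powR_ge0//.
have tr : 1 - r <= 1 - t * r by rewrite lerD2l lerN2 ler_piMl.
apply: (@le_trans _ _ ((1 - r) `^ s * (1 - r) `^ (- s))).
  by rewrite ler_wpM2l ?powR_ge0//; apply: ge_powRNl.
by rewrite -powR_posD// subrr powRr0.
Qed.

End KernelIntegral.

(** * The Hardy inequality for a function and its derivative *)

Section Hardy.
Variable R : realType.
Local Notation Rm := (measurableTypeR R).
Local Notation leb := (@lebesgue_measure R).

(** If [w < e h] the first term suffices. Otherwise [h <= w / e], and [w <= h] gives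
    [h^(q - 1) w <= h^q <= e^(- q) w^q]. This replaces Young's inequality and covers [q < 1]. *)
Lemma hardy_pointwise (h w q e : R) : 0 < h -> 0 <= w <= h -> 0 < q -> 0 < e ->
  h `^ (q - 1) * w <= e * h `^ q + e `^ (- q) * w `^ q.
Proof.
move=> h0 /andP[w0 wh] q0 e0.
have hq : h `^ q = h `^ (q - 1) * h.
  by rewrite -[X in _ * X](powRr1 (ltW h0)) -powR_posD// subrK.
have [we|ew] := ltP w (e * h).
  apply: (@le_trans _ _ (e * h `^ q)); last by rewrite lerDl mulr_ge0 ?powR_ge0.
  by rewrite hq mulrCA ler_wpM2l ?powR_ge0// ltW.
apply: (@le_trans _ _ (e `^ (- q) * w `^ q)); last by rewrite lerDr mulr_ge0 ?powR_ge0// ltW.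
apply: (@le_trans _ _ (h `^ q)); first by rewrite hq ler_wpM2l ?powR_ge0.
rewrite powRN mulrC ler_pdivlMr ?powR_gt0// -powRM ?(ltW h0) ?(ltW e0)//.
by apply: le_powRl; rewrite ?mulr_ge0 ?(ltW h0) ?(ltW e0)// ?(ltW q0)// mulrC.
Qed.

(** Monotone convergence along []0, 1 - 1/(n + 2)[]: a bound independent of [x] survives the passage
    to the limit. *)
Lemma integral_exhaust (f : R -> R) (M : R) : (forall r, 0 <= f r) ->
  (forall r : R, 0 <= r < 1 -> {for r, continuous f}) ->
  (forall x, 0 < x < 1 -> (\int[leb]_(r in `[0%R, x]%classic) (f r)%:E <= M%:E)%E) ->
  (\int[leb]_(r in `]0%R, 1%R[%classic) (f r)%:E <= M%:E)%E.
Proof.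
move=> f0 cf fM.
pose rho (n : nat) : R := 1 - n.+2%:R^-1.
have rho01 n : 0 < rho n < 1.
  by rewrite /rho subr_gt0 invf_lt1 ?ltr0n// ltr1n/= ltrBlDr ltrDl invr_gt0 ltr0n.
pose E n : set Rm := `]0, rho n[%classic.
have UE : \bigcup_n E n = `]0%R, 1%R[%classic.
  apply/seteqP; split=> [r [n _]|r]; rewrite /E/= !in_itv/= => /andP[r0 r1].
    by rewrite r0 (lt_trans r1)//; have /andP[] := rho01 n.
  have [n hn] := ltr_add_invr r1; exists n => //=.
  rewrite in_itv/= r0/= /rho ltrBrDr; apply: le_lt_trans hn.
  by rewrite lerD2l lef_pV2 ?posrE ?ltr0n// ler_nat.
have lim : (\int[leb]_(r in E n) (f r)%:E)%E @[n --> \oo] -->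
    (\int[leb]_(r in `]0%R, 1%R[%classic) (f r)%:E)%E.
  rewrite -UE; apply: ge0_nondecreasing_set_cvg_integral.
  - move=> n m nm; apply/subsetPset; apply: subset_itvl; rewrite bnd_simp.
    by rewrite lerD2l lerN2 lef_pV2 ?posrE ?ltr0n// ler_nat.
  - by move=> n; exact: measurable_itv.
  - move=> n; apply/measurable_EFinP; apply: subspace_continuous_measurable_fun.
      exact: measurable_itv.
    apply: continuous_in_subspaceT => r; rewrite inE /E/= in_itv/= => /andP[/ltW r0 r1].
    by apply: cf; rewrite r0 (lt_trans r1)//; have /andP[] := rho01 n.
  - by move=> n r _; rewrite lee_fin.
rewrite -(cvg_lim (@ereal_hausdorff R) lim); apply: lime_le; first by apply/cvg_ex; eexists; exact: lim.
apply: nearW => n; apply: le_trans (fM _ (rho01 n)); apply: ge0_le_integral_sub.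
- by apply: subset_itv; rewrite bnd_simp.
- by move=> r _; rewrite !lee_fin f0 lexx.
- by move=> r _; rewrite lee_fin.
Qed.

Lemma continuous_1B_powR (s r : R) : r < 1 -> {for r, continuous (fun u : R => (1 - u) `^ s)}.
Proof.
move=> r1; apply: (@continuous_comp _ _ _ (fun u : R => 1 - u) (fun y : R => y `^ s)).
  by apply: cvgB; [exact: cvg_cst|exact: cvg_id].
by apply: continuous_powRl; rewrite subr_gt0.
Qed.

Lemma is_derive_1B_powR (s r : R) : r < 1 ->
  is_derive r 1 (fun u : R => (1 - u) `^ s) (- (s * (1 - r) `^ (s - 1))).
Proof.
move=> r1; have h1 : is_derive r 1 (fun u : R => 1 - u) (-1).
  have := is_derive_affine 1 (-1) r.
  by rewrite (_ : (fun u => _) = (fun u => 1 - u))//; apply/funext => u; rewrite mulrN1.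
have d : 0 < 1 - r by rewrite subr_gt0.
have := is_derive_compf (g := fun u => 1 - u) (is_derive1_powR s d) h1.
by move/is_derive_eq; apply; ring.
Qed.

Lemma integral_1B_powR (T : R) : 0 < T ->
  (\int[leb]_(r in `]0%R, 1%R[%classic) ((1 - r) `^ (T - 1))%:E <= (T^-1)%:E)%E.
Proof.
move=> T0; apply: integral_exhaust => [r|r /andP[_ r1]|x /andP[x0 x1]].
- exact: powR_ge0.
- exact: continuous_1B_powR.
pose P (u : R) := - T^-1 * (1 - u) `^ T.
have dP (r : R) : 0 <= r <= x -> is_derive r 1 P ((1 - r) `^ (T - 1)).
  move=> /andP[_ rx]; have r1 := le_lt_trans rx x1.
  have := is_derive_mulfl (- T^-1) (is_derive_1B_powR T r1).
  by move/is_derive_eq; apply; field; rewrite gt_eqF.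
rewrite (integral_FTC2 x0 dP); last first.
  by move=> r /andP[_ rx]; apply: continuous_1B_powR; exact: le_lt_trans x1.
rewrite lee_fin /P subr0 powR1 mulr1 opprK mulNr gerDr oppr_le0.
by rewrite mulr_ge0 ?powR_ge0// invr_ge0 ltW.
Qed.

(* Integrate the derivative of [((1 - r)^(T/q) h)^q] and absorb the term in [h^q]. *)
Lemma hardy_ineq (h h' w : R -> R) (T q a : R) : 0 < T -> 0 < q -> 0 < a ->
  (forall r : R, 0 <= r < 1 -> is_derive r 1 h (h' r)) ->
  (forall r : R, 0 <= r < 1 -> {for r, continuous h'}) ->
  (forall r : R, 0 <= r < 1 -> {for r, continuous w}) ->
  (forall r : R, 0 <= r < 1 -> 0 < h r) ->
  (forall r : R, 0 <= r < 1 -> 0 < w r <= h r) ->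
  (forall r : R, 0 <= r < 1 -> (1 - r) * h' r <= a * w r) ->
  (\int[leb]_(r in `]0%R, 1%R[%classic) ((1 - r) `^ (T - 1) * w r `^ q)%:E < +oo)%E ->
  (\int[leb]_(r in `]0%R, 1%R[%classic) ((1 - r) `^ (T - 1) * h r `^ q)%:E < +oo)%E.
Proof.
move=> T0 q0 a0 dh ch' cw hp wp hw W.
have ch (r : R) : 0 <= r < 1 -> {for r, continuous h} by move=> /dh; exact: is_derive_continuous.
have d1 (r : R) : 0 <= r < 1 -> 0 < 1 - r by move=> /andP[_]; rewrite subr_gt0.
pose f1 r := (1 - r) `^ (T - 1) * h r `^ q.
pose f2 r := (1 - r) `^ (T - 1) * w r `^ q.
pose Phi r := (1 - r) `^ T * h r `^ q.
pose Phi' r := (1 - r) `^ T * (q * h r `^ (q - 1) * h' r) - T * f1 r.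
have dPhi (r : R) : 0 <= r < 1 -> is_derive r 1 Phi (Phi' r).
  move=> r01; have /andP[_ r1] := r01.
  have := is_derive_mulf (is_derive_1B_powR T r1)
     (is_derive_compf (g := h) (is_derive1_powR q (hp r r01)) (dh r r01)).
  by move/is_derive_eq; apply; rewrite /Phi' /f1; ring.
have cpow (s r : R) : 0 <= r < 1 -> {for r, continuous (fun u : R => (1 - u) `^ s)}.
  by move=> /andP[_]; exact: continuous_1B_powR.
have chpow (s r : R) : 0 <= r < 1 -> {for r, continuous (fun u : R => h u `^ s)}.
  move=> r01; apply: (@continuous_comp _ _ _ h (fun y : R => y `^ s)); first exact: ch.
  by apply: continuous_powRl; exact: hp.
have cf1 (r : R) : 0 <= r < 1 -> {for r, continuous f1}.
  by move=> r01; apply: cvgM; [exact: cpow|exact: chpow].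
have cf2 (r : R) : 0 <= r < 1 -> {for r, continuous f2}.
  move=> r01; apply: cvgM; first exact: cpow.
  apply: (@continuous_comp _ _ _ w (fun y : R => y `^ q)); first exact: cw.
  by apply: continuous_powRl; have /andP[] := wp r r01.
have cPhi' (r : R) : 0 <= r < 1 -> {for r, continuous Phi'}.
  move=> r01; apply: cvgB; last by apply: cvgM; [exact: cvg_cst|exact: cf1].
  apply: cvgM; first exact: cpow.
  apply: cvgM; last exact: ch'.
  by apply: cvgM; [exact: cvg_cst|exact: chpow].
(* With this choice [q a e = T / 2]: the [h^q] term of [hardy_pointwise] consumes half of the term
   [T f1] coming from the derivative of [(1 - r)^T], and the other half remains. *)
pose e := T / (2 * q * a).
have e0 : 0 < e by rewrite divr_gt0 ?mulr_gt0.
pose K := q * a * e `^ (- q).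
have K0 : 0 <= K by rewrite !mulr_ge0 ?powR_ge0// ltW.
have key (r : R) : 0 <= r < 1 -> T / 2 * f1 r <= K * f2 r - Phi' r.
  move=> r01; have dr := d1 r r01; have h0 := hp r r01.
  have /andP[w0 wh] := wp r r01.
  have p1 : 0 <= (1 - r) `^ (T - 1) by exact: powR_ge0.
  have hT : (1 - r) `^ T = (1 - r) `^ (T - 1) * (1 - r).
    by rewrite -[X in _ * X](powRr1 (ltW dr)) -powR_posD// subrK.
  have s1 : (1 - r) `^ T * (q * h r `^ (q - 1) * h' r) <=
      (1 - r) `^ (T - 1) * (q * a * (h r `^ (q - 1) * w r)).
    rewrite hT -mulrA ler_wpM2l//.
    rewrite (_ : _ * _ = q * h r `^ (q - 1) * ((1 - r) * h' r)); last by ring.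
    rewrite (_ : q * a * _ = q * h r `^ (q - 1) * (a * w r)); last by ring.
    by rewrite ler_wpM2l ?hw// mulr_ge0 ?powR_ge0// ltW.
  have s2 : q * a * (h r `^ (q - 1) * w r) <= T / 2 * h r `^ q + K * w r `^ q.
    have := @hardy_pointwise (h r) (w r) q e h0 _ q0 e0; rewrite (ltW w0) => /(_ wh) hh.
    have qa : 0 < q * a by rewrite mulr_gt0.
    apply: (le_trans (ler_wpM2l (ltW qa) hh)); rewrite /K /e le_eqVlt; apply/orP; left; apply/eqP.
    by field; rewrite !gt_eqF.
  have s3 := ler_wpM2l p1 s2.
  rewrite /Phi' /f1 /f2; move: s1 s3; nra.
have f20 r : 0 <= f2 r by rewrite mulr_ge0 ?powR_ge0.
have f10 r : 0 <= f1 r by rewrite mulr_ge0 ?powR_ge0.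
set J := (\int[leb]_(r in `]0%R, 1%R[%classic) _)%E in W.
have J0 : (0 <= J)%E by apply: integral_ge0 => r _; rewrite lee_fin f20.
have JE : (fine J)%:E = J by rewrite fineK// ge0_fin_numE.
apply: (@le_lt_trans _ _ (2 / T * (Phi 0 + K * fine J))%:E); last exact: ltry.
apply: integral_exhaust => // x /andP[x0 x1].
pose F : set Rm := `[0, x]%classic.
have Fin r : F r -> 0 <= r < 1.
  by rewrite /F/= in_itv/= => /andP[-> h2]; exact: le_lt_trans h2 x1.
have cint (f : R -> R) : (forall r : R, 0 <= r < 1 -> {for r, continuous f}) ->
    leb.-integrable F (EFin \o f).
  move=> cf; apply: continuous_compact_integrable; first exact: segment_compact.
  by apply: continuous_in_subspaceT => r; rewrite inE => /Fin; exact: cf.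
have mF : measurable F by exact: measurable_itv.
have fin (f : R -> R) : leb.-integrable F (EFin \o f) ->
    (\int[leb]_(r in F) f r)%:E = (\int[leb]_(r in F) (f r)%:E)%E.
  by move=> fi; rewrite fineK//; exact: (integrable_fin_num mF fi).
have i1 := cint f1 cf1; have i2 := cint f2 cf2; have i3 := cint Phi' cPhi'.
have ftc : (\int[leb]_(r in F) (Phi' r)%:E = (Phi (x) - Phi 0)%:E)%E.
  apply: integral_FTC2 => // r /andP[r0 r1]; have r01 : 0 <= r < 1 by rewrite r0 (le_lt_trans r1).
    exact: dPhi.
  exact: cPhi'.
have e2 : \int[leb]_(r in F) f2 r <= fine J.
  rewrite -lee_fin fin// JE /F -integral_itv_obnd_cbnd; last first.
    apply: measurable_funS (measurable_int _ i2); first exact: mF.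
    by apply: subset_itv; rewrite bnd_simp.
  apply: ge0_le_integral_sub => [r|r _|r _]; rewrite ?lee_fin ?f20 ?lexx//.
  rewrite /= !in_itv/= => /andP[-> h2]; exact: le_lt_trans h2 (x1).
have e1 : \int[leb]_(r in F) (T / 2 * f1 r) <= \int[leb]_(r in F) (K * f2 r - Phi' r).
  apply: le_Rintegral => //.
  - exact: (integrableZl (mF) _ i1).
  - exact: (integrableB (mF) (integrableZl (mF) K i2) i3).
  - by move=> r Fr; apply: key; exact: (Fin).
move: e1; rewrite RintegralB//; last exact: (integrableZl (mF) K i2).
rewrite !RintegralZl// -(fin f1 i1) lee_fin.
have -> : \int[leb]_(r in F) Phi' r = Phi (x) - Phi 0.
  by apply/EFin_inj; rewrite fin.
(* The boundary term at [x] has a favourable sign and is dropped, which frees the bound of [x]. *)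
have P0 : 0 <= Phi (x) by rewrite mulr_ge0 ?powR_ge0.
have e3 := ler_wpM2l K0 e2.
move=> e4; rewrite -(ler_pM2l (divr_gt0 T0 (ltr0Sn R 1))) mulrA.
rewrite (_ : T / 2 * (2 / T) = 1); last by field; rewrite gt_eqF.
rewrite mul1r; apply: (le_trans e4).
by rewrite opprB addrC lerD// gerBl.
Qed.

End Hardy.

(** * The Hardy inequality applied to the kernel integrals *)

Section KernelHardy.
Variable R : realType.
Local Notation Rm := (measurableTypeR R).
Variable mu : {finite_measure set Rm -> \bar R}.
Local Notation leb := (@lebesgue_measure R).

(** [x + 1] is at most twice the larger of [x] and 1. *)
Lemma powR_add1_le (x q : R) : 0 <= x -> 0 <= q -> (x + 1) `^ q <= 2 `^ q * x `^ q + 2 `^ q.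
Proof.
move=> x0 q0; have [x1|x1] := leP x 1.
  apply: (@le_trans _ _ (2 `^ q)); last by rewrite lerDr mulr_ge0 ?powR_ge0.
  by apply: le_powRl => //; [rewrite addr_ge0|lra].
apply: (@le_trans _ _ ((2 * x) `^ q)); last by rewrite powRM// lerDl powR_ge0.
by apply: le_powRl => //; [rewrite addr_ge0|lra].
Qed.

Lemma measurable_kernel_int (T s q b : R) : 0 <= b ->
  measurable_fun (`]0%R, 1%R[%classic : set Rm) (fun r : Rm =>
    (1 - r) `^ (T - 1) * ((1 - r) `^ s * kernel_int mu 0 b r) `^ q).
Proof.
move=> b0; have mJ : measurable (`]0%R, 1%R[%classic : set Rm) by exact: measurable_itv.
apply: measurable_funM.
  by apply: (measurableT_comp (measurable_powR _)); exact: measurable_funB.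
apply: (measurableT_comp (measurable_powR _)); apply: measurable_funM.
  by apply: (measurableT_comp (measurable_powR _)); exact: measurable_funB.
apply: subspace_continuous_measurable_fun => //.
apply: continuous_in_subspaceT => r; rewrite inE/= in_itv/= => /andP[r0 r1].
by apply: continuous_kernel_int => //; rewrite r1 andbT (lt_trans _ r0)// ltrN10.
Qed.

(* The constant 1 added to the kernel integrals keeps them positive even if [mu] vanishes. *)
Lemma kernel_hardy (a s T q : R) : 0 < a -> 0 <= s <= 1 -> 0 < T -> 0 < q ->
  (\int[leb]_(r in `]0%R, 1%R[%classic)
     ((1 - r) `^ (T - 1) * ((1 - r) `^ s * kernel_int mu 0 (a + s) r) `^ q)%:E < +oo)%E ->
  (\int[leb]_(r in `]0%R, 1%R[%classic)
     ((1 - r) `^ (T - 1) * kernel_int mu 0 a r `^ q)%:E < +oo)%E.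
Proof.
move=> a0 s01 T0 q0 W; have /andP[s0 s1] := s01.
have as0 : 0 <= a + s by rewrite addr_ge0// ltW.
have r11 (r : R) : 0 <= r < 1 -> -1 < r < 1.
  by move=> /andP[r0 ->]; rewrite andbT (lt_le_trans _ r0)// ltrN10.
pose h r := kernel_int mu 0 a r + 1.
pose w (r : R) := (1 - r) `^ s * (kernel_int mu 0 (a + s) r + 1).
have p1 (r : R) : 0 <= r < 1 -> (1 - r) `^ s <= 1.
  by move=> /andP[r0 r1]; apply: powR_le1 => //; lra.
have k0 := kernel_int_ge0 mu.
have ck (b r : R) : 0 <= b -> 0 <= r < 1 -> {for r, continuous (kernel_int mu 0 b)}.
  by move=> b0 /r11; exact: continuous_kernel_int.
apply: (@le_lt_trans _ _ (\int[leb]_(r in `]0%R, 1%R[%classic)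
    ((1 - r) `^ (T - 1) * h r `^ q)%:E)%E).
  apply: ge0_le_integral_sub => // r _; last by rewrite lee_fin mulr_ge0 ?powR_ge0.
  rewrite !lee_fin mulr_ge0 ?powR_ge0//= ler_wpM2l ?powR_ge0//.
  by apply: le_powRl; rewrite ?k0 ?(ltW q0)// lerDl.
apply: (@hardy_ineq R h (fun r => a * kernel_int mu 1 (a + 1) r) w T q a T0 q0 a0).
- move=> r r01; have := is_derive_addf (is_derive_kernel_int mu 0 (ltW a0) (r11 r r01)) (is_derive_cst (1 : R) r 1).
  by move/is_derive_eq; apply; rewrite addr0.
- move=> r r01; apply: cvgM; first exact: cvg_cst.
  by apply: continuous_kernel_int; [rewrite addr_ge0// ltW|exact: r11].
- move=> r r01; apply: cvgM; first by apply: continuous_1B_powR; have /andP[] := r01.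
  by apply: cvgD; [exact: ck|exact: cvg_cst].
- by move=> r _; rewrite /h ltr_wpDl.
- move=> r r01; have /andP[r0 r1] := r01; rewrite /w mulr_gt0 ?powR_gt0 ?subr_gt0//=; last first.
    by rewrite ltr_wpDl.
  rewrite mulrDr mulr1 /h lerD ?p1//; apply: kernel_int_mono_exp => //; exact: ltW.
- move=> r r01; have /andP[r0 r1] := r01; rewrite mulrCA ler_wpM2l ?(ltW a0)//.
  apply: le_trans (kernel_int_deriv_le mu (ltW a0) s01 r01) _.
  by rewrite ler_wpM2l ?powR_ge0// lerDl.
(* [powR_add1_le] separates the added constant: [g1] is integrable by hypothesis, and [g2] because
   [T > 0]. *)
pose g1 r : \bar R := (2 `^ q * ((1 - r) `^ (T - 1) * ((1 - r) `^ s * kernel_int mu 0 (a + s) r) `^ q))%:E.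
pose g2 r : \bar R := (2 `^ q * (1 - r) `^ (T - 1))%:E.
apply: (@le_lt_trans _ _ (\int[leb]_(r in `]0%R, 1%R[%classic) (g1 r + g2 r))%E).
  apply: ge0_le_integral_sub => // r; last first.
    by rewrite /g1 /g2 -EFinD lee_fin addr_ge0 ?mulr_ge0 ?powR_ge0.
  rewrite /= in_itv/= => /andP[r0 r1].
  have r01 : 0 <= r < 1 by rewrite ltW.
  rewrite /g1 /g2 -EFinD !lee_fin mulr_ge0 ?powR_ge0//=.
  have x0 : 0 <= (1 - r) `^ s * kernel_int mu 0 (a + s) r by rewrite mulr_ge0 ?powR_ge0.
  have := powR_add1_le x0 (ltW q0).
  move=> /(ler_wpM2l (powR_ge0 (1 - r) (T - 1))) hx.
  apply: (le_trans (ler_wpM2l _ _) (le_trans hx _)); first exact: powR_ge0.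
    apply: le_powRl; rewrite ?(ltW q0)// ?mulr_ge0 ?powR_ge0// ?addr_ge0//.
    by rewrite /w mulrDr mulr1 lerD2l p1.
  by rewrite le_eqVlt; apply/orP; left; apply/eqP; ring.
have mJ : measurable (`]0%R, 1%R[%classic : set Rm) by exact: measurable_itv.
have m2 : measurable_fun (`]0%R, 1%R[%classic : set Rm) (fun r : Rm => (1 - r) `^ (T - 1)).
  by apply: (measurableT_comp (measurable_powR _)); exact: measurable_funB.
have m1 := measurable_kernel_int T s q as0.
rewrite ge0_integralD//.
- apply: lte_add_pinfty.
    rewrite (@ge0_integralZ_EFin R leb _ _ _ (2 `^ q) mJ m1) ?powR_ge0//; last first.
      by move=> r _; rewrite mulr_ge0 ?powR_ge0.
    by apply: lte_mul_pinfty; rewrite ?lee_fin ?powR_ge0.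
  rewrite (@ge0_integralZ_EFin R leb _ _ _ (2 `^ q) mJ m2) ?powR_ge0//; last first.
    by move=> r _; exact: powR_ge0.
  apply: lte_mul_pinfty; rewrite ?lee_fin ?powR_ge0//.
  exact: le_lt_trans (integral_1B_powR T0) (ltry _).
- by move=> r _; rewrite lee_fin !mulr_ge0 ?powR_ge0.
- by apply/measurable_EFinP; exact: measurable_funM.
- by move=> r _; rewrite lee_fin !mulr_ge0 ?powR_ge0.
- by apply/measurable_EFinP; exact: measurable_funM.
Qed.

End KernelHardy.

(** * Integral means *)

Section Trigonometry.
Variable R : realType.
Implicit Types x y : R.

Lemma lipschitz1_derive (f df : R -> R) : (forall x : R, is_derive x 1 f (df x)) ->
  (forall x, `|df x| <= 1) -> forall x, `|f x - f 0| <= `|x|.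
Proof.
move=> hf hdf.
have H a b : a <= b -> `|f b - f a| <= b - a.
  move=> ab.
  have cf : {within `[a, b], continuous f}.
    by apply: continuous_subspaceT => x; exact: is_derive_continuous (hf x).
  have [c _ ->] := MVT_segment ab (fun x _ => hf x) cf.
  by rewrite normrM (ger0_norm (_ : 0 <= b - a)) ?subr_ge0// ler_piMl ?subr_ge0.
move=> x; have [x0|x0] := leP 0 x.
  by rewrite (ger0_norm x0); have := H _ _ x0; rewrite subr0.
by rewrite distrC (ltr0_norm x0); have := H _ _ (ltW x0); rewrite sub0r.
Qed.

Lemma cos_ge1B x : 1 - `|x| <= cos x.
Proof.
have := @lipschitz1_derive cos (fun x => - sin x) (@is_derive_cos R) _ x.
rewrite cos0 => /(_ _)/wrap[]; last by rewrite ler_norml; move=> /andP[]; lra.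
by move=> y; rewrite normrN ler_norml sin_geN1 sin_le1.
Qed.

Lemma normr_sin_le x : `|sin x| <= `|x|.
Proof.
have := @lipschitz1_derive sin cos (@is_derive_sin R) _ x.
by rewrite sin0 subr0; apply => y; rewrite ler_norml cos_geN1 cos_le1.
Qed.

Lemma normr_atan_le x : `|atan x| <= `|x|.
Proof.
have := @lipschitz1_derive atan (fun x => (1 + x ^+ 2)^-1) (@is_derive1_atan R) _ x.
rewrite atan0 subr0; apply => y; rewrite ger0_norm; last first.
  by rewrite invr_ge0 addr_ge0// sqr_ge0.
by rewrite invf_le1 ?lerDl ?sqr_ge0// ltr_wpDr// sqr_ge0.
Qed.

End Trigonometry.

(** * Lower bound for the means of the fractional derivative *)

Section LowerBound.
Variable R : realType.
Local Notation C := (R[i]^o).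
Local Notation Re := (@complex.Re R).
Local Notation Im := (@complex.Im R).
Local Notation Rm := (measurableTypeR R).
Variable mu : {finite_measure set Rm -> \bar R}.
Local Notation I01 := (`[0, 1[%classic : set Rm).
Local Notation leb := (@lebesgue_measure R).

(** With [d = 1 - u] one has [d <= Re w <= 2 d] and [|Im w| <= theta <= d], so [|w| <= 3 d]. The
    argument of [w] is at most [theta / d], hence [sigma] times it at most 1/2, and the cosine is at
    least 1/2. *)
Lemma Re_cpowR_ge (sigma u theta : R) : 0 < sigma -> 0 <= u < 1 ->
  0 <= theta <= 1 - u -> sigma * theta <= 2^-1 * (1 - u) ->
  3 `^ (- sigma) / 2 * (1 - u) `^ (- sigma) <= Re (cpowR (1 - circle_pt u theta) (- sigma)).
Proof.
move=> s0 /andP[u0 u1] /andP[t0 td] std.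
set w := 1 - circle_pt u theta; set d := 1 - u in td std *.
have d0 : 0 < d by rewrite subr_gt0.
have [c1 c2] : 1 - theta <= cos theta /\ cos theta <= 1.
  by split; [have := cos_ge1B theta; rewrite ger0_norm|exact: cos_le1].
have si : `|sin theta| <= theta by have := normr_sin_le theta; rewrite [X in _ <= X]ger0_norm.
have rw : d <= Re w <= 2 * d.
  rewrite ReB /= /d; apply/andP; split; first by rewrite lerD2l lerN2 ler_piMr.
  have : u * (1 - theta) <= u * cos theta by rewrite ler_wpM2l.
  move: td; rewrite /d; nra.
have iw : `|Im w| <= theta.
  rewrite ImB /= sub0r normrN normrM ger0_norm//.
  by apply: le_trans (ler_piMl _ (ltW u1)) si.
have /andP[rw1 rw2] := rw.
have rw0 : 0 < Re w by exact: lt_le_trans rw1.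
have nw : normc w <= 3 * d.
  apply: (le_trans (normc_ReIm w)); rewrite (gtr0_norm rw0); lra.
have nw0 : 0 < normc w by exact: normc_gt0_Re.
have aw : sigma * `|carg w| <= 2^-1.
  rewrite carg_atan//; apply: (@le_trans _ _ (sigma * (theta / d))).
    rewrite ler_wpM2l ?(ltW s0)//; apply: (le_trans (normr_atan_le _)).
    rewrite normrM normrV ?unitfE ?gt_eqF// (gtr0_norm rw0).
    by apply: ler_pM; rewrite ?invr_ge0 ?(ltW rw0)// lef_pV2 ?posrE.
  by rewrite mulrA ler_pdivrMr.
have ca : 2^-1 <= cos (- sigma * carg w).
  apply: le_trans (cos_ge1B _); rewrite normrM normrN (gtr0_norm s0); lra.
have -> : Re (cpowR w (- sigma)) = normc w `^ (- sigma) * cos (- sigma * carg w).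
  by rewrite /cpowR ReZ.
apply: (@le_trans _ _ (normc w `^ (- sigma) * 2^-1)); last by rewrite ler_wpM2l ?powR_ge0.
rewrite mulrAC ler_wpM2r ?invr_ge0//.
rewrite -powRM ?(ltW d0)//; apply: ge_powRNl => //; exact: ltW.
Qed.

Lemma poweR_inv_ge (X : \bar R) (s y : R) : 0 < s -> 0 <= y ->
  ((y `^ s)%:E <= X -> y%:E <= X `^ s^-1)%E.
Proof.
move=> s0 y0 h; have -> : y%:E = ((y `^ s)%:E `^ s^-1)%E.
  by rewrite poweR_EFin -powRrM mulfV ?gt_eqF// powRr1.
have h0 : (0 <= (y `^ s)%:E)%E by rewrite lee_fin powR_ge0.
apply: gt0_ler_poweR => //; first by rewrite invr_ge0 ltW.
  by rewrite in_itv/= h0 leey.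
by rewrite in_itv/= leey (le_trans h0 h).
Qed.

(** As [1 - r <= 1 - t r], one arc fits the kernels of all [t], and their real parts add up under
    the integral. For [p = oo] the point [theta = 0] is enough. *)
Lemma kernel_int_le_mean (p : \bar R) (sigma : R) : (1 <= p)%E -> 0 < sigma ->
  exists2 kappa : R, 0 < kappa & forall r, 0 < r < 1 ->
   ((kappa * ((1 - r) `^ (fine p^-1) * kernel_int mu 0 sigma r))%:E <=
    integral_mean p (fun z : C => cint mu I01 (fun t => cpowR (1 - t%:C * z)%R (- sigma)%R)) r)%E.
Proof.
move=> p1 s0; set G := fun z : C => _.
(* [c <= 1] and [sigma c <= 1/2] are the two conditions of [Re_cpowR_ge] on [theta], divided by
   [1 - r]. *)
pose c := Num.min 1 (2 * sigma)^-1.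
have c0 : 0 < c by rewrite lt_min ltr01 invr_gt0 mulr_gt0.
have c1 : c <= 1 by rewrite ge_min lexx.
have cs : sigma * c <= 2^-1.
  have : c <= (2 * sigma)^-1 by rewrite ge_min lexx orbT.
  move=> /(ler_wpM2l (ltW s0)) h; apply: (le_trans h).
  by rewrite le_eqVlt; apply/orP; left; apply/eqP; field; rewrite gt_eqF.
pose k0 : R := 3 `^ (- sigma) / 2.
have k00 : 0 < k0 by rewrite divr_gt0// powR_gt0.
have mI := @measurable_I01 R.
have low r theta : 0 < r < 1 -> 0 <= theta <= c * (1 - r) ->
    k0 * kernel_int mu 0 sigma r <= normc (G (circle_pt r theta)).
  move=> /andP[r0 r1] /andP[t0 t1].
  have z1 : normc (circle_pt r theta) < 1 by rewrite normc_circle_pt gtr0_norm.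
  apply: le_trans (normc_Re _); apply: le_trans (ler_norm _).
  have [mg bg] := disc_analytic_dilation (disc_analytic_cpowR s0) z1 mI (@I01_le R).
  have [B gB] := bg.
  have ik := @integrable_kernel R mu 0 sigma r (ltW s0) r1.
  rewrite /kernel_int -RintegralZl//; apply: le_Rintegral => //.
  - exact: (integrableZl mI _ ik).
  - apply: (@bounded_integrable R mu I01 (fun t => Re (cpowR (1 - t%:C * circle_pt r theta) (- sigma))) B) => //.
      by have [] := mg.
    by move=> t It; apply: le_trans (normc_Re _) (gB t It).
  move=> t /I01_le/andP[t0' t1']; rewrite expr0 mul1r -circle_ptM.
  have trr : t * r <= r by rewrite ler_piMl// ltW.
  have d : 1 - r <= 1 - t * r by rewrite lerD2l lerN2.
  apply: Re_cpowR_ge => //.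
  - by rewrite mulr_ge0 ?(ltW r0)// (le_lt_trans trr).
  - rewrite t0 (le_trans t1)// (le_trans _ d)// ler_piMl// subr_ge0 ltW//.
  - apply: (@le_trans _ _ (sigma * (c * (1 - r)))); first by rewrite ler_wpM2l ?(ltW s0).
    rewrite mulrA; apply: (@le_trans _ _ (2^-1 * (1 - r))).
      by rewrite ler_wpM2r// subr_ge0 ltW.
    by rewrite ler_wpM2l// invr_ge0.
case: p p1 => [P| |//] p1.
- rewrite lee_fin in p1; have P0 : 0 < P by exact: lt_le_trans p1.
  rewrite fine_invr.
  have pi2 : 1 < 2 * pi :> R by have := @pi_ge2 R; lra.
  have pi20 : 0 < 2 * pi :> R by exact: lt_trans pi2.
  exists (k0 * (c / (2 * pi)) `^ P^-1).
    by rewrite mulr_gt0// powR_gt0// divr_gt0.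
  move=> r r01; have /andP[r0 r1] := r01.
  have k1 := kernel_int_ge0 mu 0 sigma r.
  have d0 : 0 < 1 - r by rewrite subr_gt0.
  pose delta := c * (1 - r).
  have de0 : 0 < delta by rewrite mulr_gt0.
  have de1 : delta <= 2 * pi.
    apply: le_trans (ltW pi2); rewrite /delta -[leRHS]mul1r; apply: ler_pM => //; try exact: ltW.
    by rewrite gerBl ltW.
  apply: poweR_inv_ge => //; first by rewrite !mulr_ge0 ?powR_ge0// ltW.
  apply: (@le_trans _ _ (\int[leb]_(theta in `[0%R, delta]%classic)
     ((k0 * kernel_int mu 0 sigma r) `^ P / (2 * pi))%:E)%E); last first.
    apply: ge0_le_integral_sub.
    + by apply: subset_itvl; rewrite bnd_simp.
    + move=> theta; rewrite /= in_itv/= => th.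
      rewrite !lee_fin divr_ge0 ?powR_ge0 ?(ltW pi20)//= ler_pM2r ?invr_gt0//.
      by apply: le_powRl; rewrite ?(ltW P0) ?low// mulr_ge0// ltW.
    + by move=> theta _; rewrite lee_fin divr_ge0 ?powR_ge0// ltW.
  rewrite integral_cst//= lebesgue_measure_itv/= lte_fin de0 oppr0 adde0 -EFinM lee_fin.
  have kc : 0 <= (c / (2 * pi)) by rewrite divr_ge0// ltW.
  have E : k0 * (c / (2 * pi)) `^ P^-1 * ((1 - r) `^ P^-1 * kernel_int mu 0 sigma r) =
      (k0 * kernel_int mu 0 sigma r) * ((c / (2 * pi)) `^ P^-1 * (1 - r) `^ P^-1) by ring.
  rewrite E -powRM// ?(ltW d0)// powRM ?powR_ge0//; last by rewrite mulr_ge0// ltW.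
  rewrite -powRrM mulVf ?gt_eqF// powRr1; last by rewrite mulr_ge0// ltW.
  set X := _ `^ P; rewrite /delta le_eqVlt; apply/orP; left; apply/eqP.
  by rewrite -[RHS]mulrA; congr (X * _); rewrite [RHS]mulrA [_^-1 * c]mulrC.
- rewrite invey /=; exists k0 => // r r01; have /andP[r0 r1] := r01.
  rewrite powRr0 mul1r; apply: (@le_trans _ _ (normc (G (circle_pt r 0)))%:E).
    rewrite lee_fin; apply: low => //.
    by rewrite lexx mulr_ge0 ?(ltW c0)// subr_ge0 ltW.
  apply: ereal_sup_ubound; exists (circle_pt r 0) => //=.
  by rewrite normrCE normc_circle_pt gtr0_norm.
Qed.

End LowerBound.

(** * Growth of integral means and the test function *)

Section IntegralMeans.
Variable R : realType.
Local Notation C := (R[i]^o).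
Local Notation leb := (@lebesgue_measure R).
Implicit Types (f g : C -> C) (r : R).

Lemma eq_integral_mean (p : \bar R) f g r : 0 <= r ->
  (forall z, normc z = r -> f z = g z) -> integral_mean p f r = integral_mean p g r.
Proof.
move=> r0 fg; case: p => [s| |//] /=.
  by under eq_integral => theta _ do rewrite fg ?normc_circle_pt ?ger0_norm//.
congr ereal_sup; apply/seteqP; split=> _ [z /= zr <-]; exists z => //=;
  by rewrite fg//; move: zr; rewrite normrCE => -[].
Qed.

Lemma integral_mean_ge0 (p : \bar R) (f : C -> C) (r : R) : 0 <= r ->
  (0 <= integral_mean p f r)%E.
Proof.
move=> r0; case: p => [s| |//]; first exact: poweR_ge0.
apply: le_trans (ereal_sup_ubound _); last first.
  exists (circle_pt r 0); last reflexivity.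
  by rewrite /= normrCE normc_circle_pt ger0_norm.
by rewrite lee_fin normc_ge0.
Qed.

Lemma integral_mean_fin_le (P y r : R) f : 0 < P -> 0 <= y ->
  (integral_mean P%:E f r <= y%:E)%E =
  (\int[leb]_(theta in `[0%R, (2 * pi)%R]%classic)
     (normc (f (circle_pt r theta)) `^ P / (2 * pi))%:E <= (y `^ P)%:E)%E.
Proof.
move=> P0 y0; rewrite /integral_mean poweR_inv_le//.
by apply: integral_ge0 => x _; rewrite lee_fin divr_ge0 ?powR_ge0// mulr_ge0// pi_ge0.
Qed.

Lemma integral_mean_le_scale (p : \bar R) f g r (k y : R) : (1 <= p)%E ->
  disc_analytic f -> 0 <= r < 1 -> 0 <= k -> 0 <= y ->
  (forall z, normc z = r -> normc (g z) <= k * normc (f z)) ->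
  (integral_mean p f r <= y%:E)%E -> (integral_mean p g r <= (k * y)%:E)%E.
Proof.
move=> p1 fa /andP[r0 r1] k0 y0 gf; have ky0 : 0 <= k * y by rewrite mulr_ge0.
have cz theta : normc (circle_pt r theta) = r by rewrite normc_circle_pt ger0_norm.
case: p p1 => [P| |//] p1.
- rewrite lee_fin in p1; have P0 : 0 < P by exact: lt_le_trans p1.
  have pi2 : 0 < 2 * pi :> R by rewrite mulr_gt0// pi_gt0.
  rewrite !integral_mean_fin_le//.
  move=> h; rewrite powRM// EFinM.
  apply: (@le_trans _ _ ((k `^ P)%:E * \int[leb]_(theta in `[0%R, (2 * pi)%R]%classic)
     (normc (f (circle_pt r theta)) `^ P / (2 * pi))%:E)%E); last first.
    by apply: lee_wpmul2l => //; rewrite lee_fin powR_ge0.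
  rewrite -(@ge0_integralZ_EFin R leb _ (fun theta => k `^ P * (normc (f (circle_pt r theta)) `^ P / (2 * pi))))//.
  - apply: ge0_le_integral_sub => // theta _; rewrite !lee_fin; last first.
      by rewrite mulr_ge0 ?divr_ge0 ?powR_ge0// ltW.
    rewrite divr_ge0 ?powR_ge0 ?(ltW pi2)//= mulrA ler_pM2r ?invr_gt0// -powRM ?normc_ge0//.
    by apply: le_powRl; rewrite ?normc_ge0 ?gf ?cz// ltW.
  - apply: measurable_funTS; apply: measurable_funM => //.
    apply: (measurableT_comp (measurable_powR _)).
    apply: (@continuous_measurable_fun R); apply: ccontinuous_normc.
    have -> : (fun theta => f (circle_pt r theta)) = (fun theta => f (1%:C * circle_pt r theta)).
      by apply/funext => theta; rewrite mul1r.
    apply: (disc_analytic_continuous fa _ (ccontinuous_circle_pt 1 r)) => theta.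
    by rewrite mul1r cz.
  - by move=> theta _; rewrite divr_ge0 ?powR_ge0// ltW.
  - exact: powR_ge0.
- rewrite /= => h; apply: ge_ereal_sup => _ [z zr <-].
  have zE : normc z = r by move: zr => /=; rewrite normrCE => -[].
  rewrite lee_fin; apply: (le_trans (gf _ zE)); rewrite ler_wpM2l// -lee_fin.
  by apply: le_trans h; apply: ereal_sup_ubound; exists z.
Qed.

(** The norm is a supremum over [0 < r < 1], whereas the radii [t r] with [t] in [[0, 1[] include 0,
    which is treated apart. *)
Lemma integral_mean0 (p : \bar R) f : (1 <= p)%E ->
  (integral_mean p f 0 <= (normc (f 0))%:E)%E.
Proof.
case: p => [P| |//] p1.
- rewrite lee_fin in p1; have P0 : 0 < P by exact: lt_le_trans p1.
  have pi2 : 0 < 2 * pi :> R by rewrite mulr_gt0// pi_gt0.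
  rewrite integral_mean_fin_le ?normc_ge0//.
  have c0 theta : circle_pt 0 theta = 0 :> C by rewrite /circle_pt !mul0r.
  under eq_integral do rewrite c0.
  rewrite integral_cst//= lebesgue_measure_itv/= lte_fin pi2 oppr0 adde0 -EFinM lee_fin.
  by rewrite divfK// gt_eqF.
- apply: ge_ereal_sup => _ [z /= zr <-]; rewrite lee_fin.
  by move: zr => /eqP; rewrite normr_eq0 => /eqP ->.
Qed.

Lemma normc_1B_ge (z : C) : 1 - normc z <= normc (1 - z).
Proof.
apply: le_trans (normc_Re _); apply: le_trans (ler_norm _).
by rewrite ReB/= lerD2l lerN2; apply: le_trans (normc_Re _); exact: ler_norm.
Qed.

Lemma mixed_space_mean_le (p : \bar R) (gamma : R) f : (1 <= p)%E ->
  mixed_space p +oo%E gamma f ->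
  exists2 K : R, 0 < K & forall r, 0 <= r < 1 ->
    (integral_mean p f r <= (K * (1 - r) `^ (- gamma))%:E)%E.
Proof.
move=> p1 [fa /= N].
set S := ereal_sup _ in N.
have h2 : 0 < (2^-1 : R) < 1 by rewrite invr_gt0 ltr0n invf_lt1// ltr1n.
have SE : (fine S)%:E = S.
  rewrite fineK// ge0_fin_numE//.
  apply: le_trans (ereal_sup_ubound _); last first.
    by exists (2^-1); [rewrite /= in_itv|reflexivity].
  by rewrite mule_ge0 ?lee_fin ?powR_ge0// integral_mean_ge0// ltW//; have /andP[] := h2.
(* [|f(0)|] covers the radius 0, and the added 1 makes [K] positive. *)
pose K := Num.max (fine S) (normc (f 0)) + 1.
exists K.
  by rewrite ltr_wpDl// le_max normc_ge0 orbT.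
move=> r /andP[]; rewrite le_eqVlt => /orP[/eqP <- _|r0 r1].
  rewrite subr0 powR1 mulr1; apply: (le_trans (integral_mean0 f p1)).
  by rewrite lee_fin ler_wpDr// le_max lexx orbT.
have d : 0 < (1 - r) `^ gamma by rewrite powR_gt0// subr_gt0.
have h : (((1 - r) `^ gamma)%:E * integral_mean p f r <= (fine S)%:E)%E.
  by rewrite SE; apply: ereal_sup_ubound; exists r => //=; rewrite in_itv/= r0.
rewrite powRN EFinM lee_pdivlMr// muleC; apply: (le_trans h).
by rewrite lee_fin ler_wpDr// le_max lexx.
Qed.

(** Up to [y = x / 2] the cosine is at least 1/2, because the cosine of the double angle is
    nonnegative. The mean value theorem gives [sin y >= y / 2], and [sin x = 2 sin y cos y]. *)
Lemma sin_ge_quarter (x : R) : 0 <= x <= pi / 2 -> x / 4 <= sin x.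
Proof.
move=> /andP[x0 x1]; pose y := x / 2.
have pi2 := @pihalf_lt2 R.
have y0 : 0 <= y by rewrite divr_ge0.
have cx : 0 <= cos x by apply: cos_ge0_pihalf; rewrite x1 andbT; lra.
have cosh c : 0 <= c <= y -> 2^-1 <= cos c.
  move=> /andP[c0 cy]; have : 0 <= cos (c *+ 2).
    by apply: cos_ge0_pihalf; move: cy x1; rewrite /y -mulr_natr; lra.
  have cc0 : 0 <= cos c by apply: cos_ge0_pihalf; move: cy x1; rewrite /y; lra.
  by rewrite cos_mulr2n -mulr_natr => h; nra.
have sy : y / 2 <= sin y.
  have [c] := @MVT_segment R sin cos 0 y y0 (fun x _ => is_derive_sin x)
    ltac:(by apply: continuous_subspaceT; exact: continuous_sin).
  rewrite in_itv/= sin0 !subr0 => cy ->.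
  by rewrite mulrC ler_wpM2r// cosh.
have cy : 2^-1 <= cos y by apply: cosh; rewrite y0 lexx.
rewrite [in leRHS](_ : x = y *+ 2); last by rewrite /y -mulr_natr; field.
rewrite sin_mulr2n (_ : x / 4 = y / 2); last by rewrite /y; field.
have : 2^-1 * (y / 2) <= cos y * sin y by apply: ler_pM => //; rewrite divr_ge0.
by rewrite -mulr_natr; lra.
Qed.

(** The modulus is at least [1 - r] and at least [theta / 4]; the first bound plus four times the
    second gives the 5. For [theta <= pi / 2] it is at least [sin theta], the distance from 1 to the
    line through 0 and [exp(i theta)]; beyond, the real part is at least 1 and [theta <= pi < 4]. *)
Lemma normc_1B_circle_ge r theta : 0 <= r < 1 -> 0 <= theta <= pi ->
  ((1 - r) + theta) / 5 <= normc (1 - circle_pt r theta).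
Proof.
move=> /andP[r0 r1] /andP[t0 tpi]; set w := 1 - circle_pt _ _.
have pi4 : pi < 4 :> R by have := @pihalf_lt2 R; lra.
have h1 : 1 - r <= normc w.
  by have := normc_1B_ge (circle_pt r theta); rewrite normc_circle_pt ger0_norm.
suff h2 : theta / 4 <= normc w by lra.
have [th|th] := leP theta (pi / 2).
  have th2 : 0 <= theta <= pi / 2 by rewrite t0.
  apply: le_trans (sin_ge_quarter th2) _.
  have s0 : 0 <= sin theta by apply: sin_ge0_pi; rewrite t0.
  rewrite -(@ler_pXn2r _ 2)// ?nnegrE ?normc_ge0// normc_sq.
  rewrite /w ReB ImB /=; have := cos2Dsin2 theta; move: (cos theta) (sin theta) => c s.
  move=> E; rewrite -subr_ge0 (_ : _ - _ = (c - r) ^+ 2 + (c ^+ 2 + s ^+ 2 - 1) * (r ^+ 2 - 1)); last by ring.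
  by rewrite E subrr mul0r addr0 sqr_ge0.
apply: (@le_trans _ _ 1); first by rewrite ler_pdivrMr// mul1r ltW// (le_lt_trans tpi).
apply: le_trans (normc_Re _); apply: le_trans (ler_norm _).
rewrite /w ReB/= lerDl oppr_ge0; apply: mulr_ge0_le0 => //.
rewrite -[theta](subrK (pi / 2)) cosDpihalf oppr_le0.
by apply: sin_ge0_pi; have := @pi_ge0 R; lra.
Qed.

Lemma normc_1B_circle_sym r theta :
  normc (1 - circle_pt r (2 * pi - theta)) = normc (1 - circle_pt r theta).
Proof.
apply/eqP; rewrite -(@eqrXn2 _ 2) ?normc_ge0//; apply/eqP; rewrite !normc_sq !ReB !ImB /=.
rewrite cosB sinB [2 * pi]mulr_natl cos2pi sin2pi; ring.
Qed.


(** The majorants valid on [[0, pi]] and, by symmetry, on [[pi, 2 pi]] are added into one function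
    [g] with explicit primitive [G] on the whole interval, so the integral need not be split. *)
Lemma circle_kernel_le (kappa r : R) : 1 < kappa -> 0 <= r < 1 ->
  (\int[leb]_(theta in `[0%R, (2 * pi)%R]%classic)
     (normc (1 - circle_pt r theta) `^ (- kappa) / (2 * pi))%:E <=
   (5 `^ kappa / (pi * (kappa - 1)) * (1 - r) `^ (- (kappa - 1)))%:E)%E.
Proof.
move=> k1 r01; have /andP[r0 r1] := r01; set d := 1 - r.
have d0 : 0 < d by rewrite subr_gt0.
have p0 := @pi_gt0 R.
have pi2 : 0 < 2 * pi :> R by rewrite mulr_gt0.
have k0 : 0 < kappa by exact: lt_trans k1.
have k10 : 0 < kappa - 1 by rewrite subr_gt0.
pose A : R := 5 `^ kappa / (2 * pi).
have A0 : 0 <= A by rewrite divr_ge0 ?powR_ge0// ltW.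
pose g (theta : R) := A * ((d + theta) `^ (- kappa) + (d + (2 * pi - theta)) `^ (- kappa)).
pose B := A / (kappa - 1).
have B0 : 0 <= B by rewrite divr_ge0// ltW.
pose G (theta : R) := B * ((d + (2 * pi - theta)) `^ (- (kappa - 1)) - (d + theta) `^ (- (kappa - 1))).
have g0 theta : 0 <= g theta by rewrite mulr_ge0// addr_ge0// powR_ge0.
have p1 (theta : R) : 0 <= theta <= 2 * pi -> 0 < d + theta /\ 0 < d + (2 * pi - theta).
  by move=> /andP[t0 t1]; split; rewrite ltr_pwDl// subr_ge0.
have dG (theta : R) : 0 <= theta <= 2 * pi -> is_derive theta 1 G (g theta).
  move=> th; have [h1 h2] := p1 theta th.
  have a1 : is_derive theta 1 (fun u : R => d + u) 1.
    have := is_derive_affine d 1 theta.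
    by rewrite (_ : (fun u => _) = (fun u => d + u))//; apply/funext => u; rewrite mulr1.
  have a2 : is_derive theta 1 (fun u : R => d + (2 * pi - u)) (-1).
    have := is_derive_affine (d + 2 * pi) (-1) theta.
    by rewrite (_ : (fun u => _) = (fun u => d + (2 * pi - u)))//; apply/funext => u; rewrite mulrN1 addrA.
  have b1 := is_derive_compf (g := fun u => d + u) (is_derive1_powR (- (kappa - 1)) h1) a1.
  have b2 := is_derive_compf (g := fun u => d + (2 * pi - u)) (is_derive1_powR (- (kappa - 1)) h2) a2.
  have := is_derive_mulfl B (is_derive_subf b2 b1).
  move/is_derive_eq; apply; rewrite (_ : - (kappa - 1) - 1 = - kappa); last by ring.
  by rewrite /g /B; field; rewrite gt_eqF.
have cg (theta : R) : 0 <= theta <= 2 * pi -> {for theta, continuous g}.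
  move=> th; have [h1 h2] := p1 theta th.
  apply: cvgM; first exact: cvg_cst.
  apply: cvgD.
    apply: (@continuous_comp _ _ _ (fun u : R => d + u) (fun y : R => y `^ (- kappa))).
      by apply: cvgD; [exact: cvg_cst|exact: cvg_id].
    exact: continuous_powRl.
  apply: (@continuous_comp _ _ _ (fun u : R => d + (2 * pi - u)) (fun y : R => y `^ (- kappa))).
    by apply: cvgD; [exact: cvg_cst|apply: cvgB; [exact: cvg_cst|exact: cvg_id]].
  exact: continuous_powRl.
apply: (@le_trans _ _ (\int[leb]_(theta in `[0%R, (2 * pi)%R]%classic) (g theta)%:E)%E).
  apply: ge0_le_integral_sub => // theta; last by move=> _; rewrite lee_fin.
  rewrite /= in_itv/= => /andP[t0 t1].
  rewrite !lee_fin; apply/andP; split; first by rewrite divr_ge0 ?powR_ge0 ?(ltW pi2).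
  have low (x : R) : 0 < x -> x / 5 <= normc (1 - circle_pt r theta) ->
      normc (1 - circle_pt r theta) `^ (- kappa) <= 5 `^ kappa * x `^ (- kappa).
    move=> x0 hx; have -> : 5 `^ kappa * x `^ (- kappa) = (x / 5) `^ (- kappa).
      rewrite powRM ?invr_ge0 ?(ltW x0)// mulrC; congr (_ * _).
      by rewrite -powR_inv1// -powRrM mulN1r opprK.
    by apply: ge_powRNl; rewrite ?divr_gt0// ltW.
  rewrite /g /A mulrAC ler_pM2r ?invr_gt0//.
  have [h1 h2] := p1 theta ltac:(by rewrite t0).
  have [tp|tp] := leP theta pi.
    apply: (le_trans (low _ h1 _)); first by apply: normc_1B_circle_ge; rewrite ?t0.
    by rewrite ler_wpM2l ?powR_ge0// lerDl powR_ge0.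
  apply: (le_trans (low _ h2 _)).
    rewrite -normc_1B_circle_sym; apply: normc_1B_circle_ge => //.
    by apply/andP; split; lra.
  by rewrite ler_wpM2l ?powR_ge0// lerDr powR_ge0.
rewrite (integral_FTC2 pi2 dG cg) lee_fin /G subrr !addr0 subr0.
have -> : 5 `^ kappa / (pi * (kappa - 1)) = 2 * B.
  have aux (x y P : R) : 0 < P -> 0 < y -> x / (P * y) = 2 * (x / (2 * P) / y).
    by move=> P0 y0; field; rewrite !gt_eqF.
  exact: aux.
have x0 : 0 <= B * (d + 2 * pi) `^ (- (kappa - 1)) by rewrite mulr_ge0 ?powR_ge0.
rewrite !mulrBr; move: x0; lra.
Qed.

(** For finite [p] the exponent of [|1 - z|] in the mean is [kappa = gamma p + 1];
    [circle_kernel_le] yields [(1 - r)^(- gamma p)], whose [p]-th root is the required growth. For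
    [p = oo], [|1 - z| >= 1 - r] suffices. *)
Lemma test_fun_mixed (p : \bar R) (gamma : R) : (1 <= p)%E -> 0 < gamma ->
  mixed_space p +oo%E gamma (fun z : C => cpowR (1 - z) (- (gamma + fine p^-1))).
Proof.
move=> p1 g0; set f := fun z : C => _.
have s0 : 0 <= fine p^-1.
  by rewrite fine_ge0// inve_ge0; apply: le_trans p1.
split; first by apply: disc_analytic_cpowR; rewrite ltr_wpDr.
suff [A hA] : exists A : R, forall r, 0 <= r < 1 ->
    (integral_mean p f r <= (A * (1 - r) `^ (- gamma))%:E)%E.
  apply: (@le_lt_trans _ _ A%:E); last exact: ltry.
  rewrite /mixed_norm; apply: ge_ereal_sup => _ [r + <-].
  rewrite /= in_itv/= => /andP[r0 r1].
  have d0 : 0 < 1 - r by rewrite subr_gt0.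
  apply: (le_trans (lee_wpmul2l _ (hA r _))); first by rewrite lee_fin powR_ge0.
    by rewrite ltW.
  by rewrite -EFinM lee_fin mulrCA -powR_posD// subrr powRr0 mulr1.
have nf z : normc (f z) = normc (1 - z) `^ (- (gamma + fine p^-1)) by exact: normc_cpowR.
case: p p1 f s0 nf => [P| |//] p1 f s0 nf.
- rewrite lee_fin in p1; have P0 : 0 < P by exact: lt_le_trans p1.
  rewrite fine_invr in nf; pose kappa := (gamma + P^-1) * P.
  have kE : kappa - 1 = gamma * P by rewrite /kappa mulrDl mulVf ?addrK// gt_eqF.
  have k1 : 1 < kappa by rewrite -subr_gt0 kE mulr_gt0.
  exists ((5 `^ kappa / (pi * (kappa - 1))) `^ P^-1) => r r01.
  have /andP[r0 r1] := r01; have d0 : 0 < 1 - r by rewrite subr_gt0.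
  have c0 : 0 <= 5 `^ kappa / (pi * (kappa - 1)).
    by rewrite divr_ge0 ?powR_ge0// mulr_ge0 ?pi_ge0// subr_ge0 ltW.
  rewrite integral_mean_fin_le//; last by rewrite mulr_ge0 ?powR_ge0.
  rewrite powRM ?powR_ge0// -!powRrM mulVf ?gt_eqF// powRr1// mulNr -kE.
  under eq_integral do rewrite nf -powRrM mulNr.
  exact: circle_kernel_le.
- rewrite invey addr0 in nf; exists 1 => r /andP[r0 r1].
  have d0 : 0 < 1 - r by rewrite subr_gt0.
  rewrite mul1r; apply: ge_ereal_sup => _ [z zr <-].
  have zE : normc z = r by move: zr => /=; rewrite normrCE => -[].
  rewrite lee_fin nf; apply: ge_powRNl; rewrite ?(ltW g0)//.
  by rewrite -zE; exact: normc_1B_ge.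
Qed.

End IntegralMeans.

(** * Upper bound for the means of the operator *)

Section CesaroMean.
Variable R : realType.
Local Notation C := (R[i]^o).
Local Notation Rm := (measurableTypeR R).
Variable mu : {finite_measure set Rm -> \bar R}.
Local Notation I01 := (`[0, 1[%classic : set Rm).
Local Notation leb := (@lebesgue_measure R).

(** On [|z| = t r] the factor [|1 - z|^(- beta)] is at most [(1 - t r)^(- beta)] and the mean of [f]
    at most [K (1 - t r)^(- gamma)]; Minkowski's inequality integrates the product. *)
Lemma cesaro_mean_le (p : \bar R) (beta gamma : R) (f : C -> C) :
  (1 <= p)%E -> 0 < beta -> 0 < gamma -> mixed_space p +oo%E gamma f ->
  exists2 K : R, 0 < K & forall r, 0 <= r < 1 ->
    (integral_mean p (cesaro_op mu beta f) r <= (K * kernel_int mu 0 (beta + gamma) r)%:E)%E.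
Proof.
move=> p1 b0 g0 fs; have [K K0 hK] := mixed_space_mean_le p1 fs.
have fa : disc_analytic f by case: fs.
exists K => // r r01; have /andP[r0 r1] := r01.
set a := beta + gamma; have a0 : 0 < a by rewrite addr_gt0.
have mI := @measurable_I01 R.
pose phi (z : C) : C := f z * cpowR (1 - z) (- beta).
have pa : disc_analytic phi by exact: disc_analyticM fa (disc_analytic_cpowR b0).
rewrite (@eq_integral_mean _ _ _ (fun z => cint mu I01 (fun t => phi (t%:C * z))))//; last first.
  by move=> z zr; rewrite cesaro_opE// zr.
pose psi (t : R) := K * (t ^+ 0 * (1 - t * r) `^ (- a)).
have psib t : I01 t -> K <= psi t <= K * (1 - r) `^ (- a).
  move=> It; have [p0 /andP[_ h]] := @kernel_le R 0 a r r t (ltW a0) r01 (lexx r) It.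
  rewrite /psi !ler_pM2l// h andbT ler_pMr// expr0 mul1r.
  have {1}<- : 1 `^ (- a) = 1 by rewrite powR1.
  apply: ge_powRNl; rewrite ?(ltW a0)// gerBl.
  by rewrite mulr_ge0//; have /andP[] := I01_le It.
have hm t : I01 t -> (integral_mean p phi (t * r) <= (psi t)%:E)%E.
  move=> It; have /andP[t0 t1] := I01_le It.
  have tr01 : 0 <= t * r < 1 by rewrite mulr_ge0//= (le_lt_trans _ r1)// ler_piMl.
  have d0 : 0 < 1 - t * r by have /andP[] := tr01; rewrite subr_gt0.
  have := @integral_mean_le_scale R p f phi (t * r) ((1 - t * r) `^ (- beta))
    (K * (1 - t * r) `^ (- gamma)) p1 fa tr01 (powR_ge0 _ _).
  rewrite /psi expr0 mul1r mulrCA -powR_posD// -opprD; apply; last exact: hK.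
    by rewrite mulr_ge0 ?powR_ge0// ltW.
  move=> z zr; rewrite /phi normcM mulrC ler_wpM2r ?normc_ge0// normc_cpowR.
  by apply: ge_powRNl; rewrite ?(ltW b0)// -zr; exact: normc_1B_ge.
have mpsi : measurable_fun setT (psi : Rm -> R).
  by apply: measurable_funM => //; exact: measurable_kernel.
have := @minkowski_dilation R mu p phi r psi K _ p1 pa r01 K0 mpsi psib hm.
by rewrite RintegralZl//; exact: integrable_kernel (ltW a0) r1.
Qed.

Lemma mixed_norm_fin (p : \bar R) (q gamma : R) (f : C -> C) : 0 < q ->
  (mixed_norm p q%:E gamma f < +oo)%E <->
  (\int[leb]_(r in `]0%R, 1%R[%classic)
     (((1 - r) `^ (gamma * q - 1))%R%:E * integral_mean p f r `^ q) < +oo)%E.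
Proof.
move=> q0; rewrite /mixed_norm; split => h.
  by apply: (@lty_poweRy R _ q^-1) => //; rewrite invr_eq0 gt_eqF.
exact: poweR_lty.
Qed.

Lemma ge0_integral_lty_scale (D : set Rm) (F : R -> \bar R) (f : R -> R) (k : R) :
  measurable D -> measurable_fun D (f : Rm -> R) -> 0 <= k -> (forall r, D r -> 0 <= f r) ->
  (forall r, D r -> (0 <= F r <= (k * f r)%:E)%E) ->
  (\int[leb]_(r in D) (f r)%:E < +oo)%E -> (\int[leb]_(r in D) F r < +oo)%E.
Proof.
move=> mD mf k0 f0 Ff fy; apply: (@le_lt_trans _ _ (k%:E * \int[leb]_(r in D) (f r)%:E)%E).
  rewrite -(@ge0_integralZ_EFin R leb D (fun r => k * f r))//.
  by apply: ge0_le_integral_sub => // r Dr; rewrite lee_fin mulr_ge0// f0.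
by apply: lte_mul_pinfty; rewrite ?lee_fin.
Qed.

Lemma le_poweR (X Y : \bar R) (q : R) : 0 <= q -> (0 <= X)%E -> (X <= Y)%E ->
  (X `^ q <= Y `^ q)%E.
Proof.
move=> q0 X0 XY; apply: gt0_ler_poweR => //; rewrite in_itv/= leey andbT//.
exact: le_trans XY.
Qed.

End CesaroMean.

Theorem theorem7p5 (R : realType)
  (mu : {finite_measure set (measurableTypeR R) -> \bar R})
  (beta gamma q : R) (p p' : \bar R)
  (hbeta : 0 < beta) (hgamma : 0 < gamma)
  (hp : (1 <= p)%E) (hp' : (p'^-1 = 1 - p^-1)%E) (hq : 0 < q) :
  (forall f : R[i]^o -> R[i]^o,
      mixed_space p +oo%E gamma f ->
      mixed_space p q%:E gamma (cesaro_op mu beta f)) <->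
  mixed_space p q%:E gamma
    (fracD (beta + gamma - fine (p'^-1)%E) (moment_gf mu)).
Proof.
pose s := fine p^-1.
have p0 : (0 <= p)%E by exact: le_trans hp.
(* The inverse of [+oo] is 0, so [p = oo] enters as [s = 0]. *)
have [s01 sE] : 0 <= s <= 1 /\ fine (p'^-1)%E = 1 - s.
  rewrite hp' /s; case: p hp p0 {hp' s} => [P| |//] hp _.
    rewrite lee_fin in hp; have P0 : 0 < P by exact: lt_le_trans hp.
    rewrite inver gt_eqF//= invr_ge0 (ltW P0) invf_le1//.
  by rewrite invey oppe0 adde0 /= lexx ler01 subr0.
rewrite sE; have /andP[s0 s1] := s01.
have aE : beta + gamma - (1 - s) = beta + (gamma + s) - 1 by ring.
have gs0 : 0 < gamma + s by rewrite ltr_wpDr.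
pose sigma := beta + gamma + s.
have sigma0 : 0 < sigma by rewrite /sigma -addrA addr_gt0.
have DE z : normc z < 1 -> fracD (beta + gamma - (1 - s)) (moment_gf mu) z =
    cint mu `[0, 1[%classic (fun t => cpowR (1 - t%:C * z) (- sigma)).
  by move=> z1; rewrite aE fracD_moment_gf ?subrK ?addrA.
split.
  move=> /(_ _ (test_fun_mixed hp hgamma)) [ca cn].
  have E z : normc z < 1 -> cesaro_op mu beta (fun w => cpowR (1 - w) (- (gamma + s))) z =
      fracD (beta + gamma - (1 - s)) (moment_gf mu) z.
    by move=> z1; rewrite aE; exact: (cesaro_cpowR mu (addr_gt0 hbeta gs0) z1).
  split; first exact: eq_disc_analytic E ca.
  apply/mixed_norm_fin => //; move/(mixed_norm_fin _ _ _ hq): cn.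
  congr (_ < _)%E; apply: eq_integral => r; rewrite inE/= in_itv/= => /andP[r0 r1].
  congr (_ * _ `^ _)%E; apply: eq_integral_mean; first exact: ltW.
  by move=> z zr; rewrite E// zr.
move=> [Da Dn] f fs; have [fa _] := fs.
split; first exact: disc_analytic_cesaro.
have [kap kap0 hkap] := kernel_int_le_mean mu hp sigma0.
have [K K0 hK] := cesaro_mean_le mu hp hbeta hgamma fs.
apply/mixed_norm_fin => //; move/(mixed_norm_fin _ _ _ hq): Dn => Dn.
have as0 : 0 <= beta + gamma + s by exact: ltW.
have a0 : 0 < beta + gamma by rewrite addr_gt0.
have mJ : measurable (`]0%R, 1%R[%classic : set (measurableTypeR R)) by exact: measurable_itv.
have W0 (T u b r : R) : 0 <= (1 - r) `^ (T - 1) * ((1 - r) `^ u * kernel_int mu 0 b r) `^ q.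
  by rewrite mulr_ge0 ?powR_ge0.
pose J := `]0%R, 1%R[%classic : set (measurableTypeR R).
have W : (\int[lebesgue_measure]_(r in J)
     ((1 - r) `^ (gamma * q - 1) * ((1 - r) `^ s * kernel_int mu 0 (beta + gamma + s) r) `^ q)%:E < +oo)%E.
  (* With the factor [kap^q] included, [g] lies below the integrand of the hypothesis. *)
  pose g r := kap `^ q * ((1 - r) `^ (gamma * q - 1) * ((1 - r) `^ s * kernel_int mu 0 (beta + gamma + s) r) `^ q).
  have mk := measurable_kernel_int mu (gamma * q) s q as0.
  apply: (@ge0_integral_lty_scale _ J _ g ((kap `^ q)^-1)) => //.
  - exact: measurable_funM.
  - by rewrite invr_ge0 powR_ge0.
  - by move=> r _; rewrite /g mulr_ge0 ?powR_ge0.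
  - by move=> r _; rewrite /g mulKf ?gt_eqF ?powR_gt0// lexx lee_fin W0.
  apply: le_lt_trans Dn; apply: ge0_le_integral_sub => // r; last first.
    by move=> _; rewrite mule_ge0 ?poweR_ge0// lee_fin powR_ge0.
  rewrite /J/= in_itv/= => r01; have /andP[r0 r1] := r01.
  rewrite lee_fin /g mulr_ge0 ?powR_ge0//= mulrCA EFinM.
  apply: lee_wpmul2l; first by rewrite lee_fin powR_ge0.
  rewrite -powRM ?(ltW kap0)//; last by rewrite mulr_ge0 ?powR_ge0 ?kernel_int_ge0.
  rewrite -poweR_EFin; apply: le_poweR; rewrite ?(ltW hq)//.
    by rewrite lee_fin !mulr_ge0 ?powR_ge0 ?kernel_int_ge0// ltW.
  rewrite (@eq_integral_mean _ _ _ _ _ (ltW r0) (fun z zr => DE z _)); first exact: hkap.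
  by move=> z ->.
(* The exponent 0 yields the measurability needed for [h_a], as [(1 - r)^0 = 1]. *)
have mk := measurable_kernel_int mu (gamma * q) 0 q (ltW a0).
have := kernel_hardy a0 s01 (mulr_gt0 hgamma hq) hq W.
apply: (@ge0_integral_lty_scale _ J _ _ (K `^ q)) => //.
- move: mk; congr (measurable_fun _ _); apply/funext => r.
  by rewrite powRr0 mul1r.
- exact: powR_ge0.
- by move=> r _; rewrite mulr_ge0 ?powR_ge0.
rewrite /J => r; rewrite /= in_itv/= => /andP[r0 r1].
rewrite mule_ge0 ?poweR_ge0 ?lee_fin ?powR_ge0//= mulrCA EFinM.
apply: lee_wpmul2l; first by rewrite lee_fin powR_ge0.
rewrite -powRM ?(ltW K0) ?kernel_int_ge0// -poweR_EFin.
apply: le_poweR; [exact: ltW|exact/integral_mean_ge0/ltW|].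
by apply: hK; rewrite ltW.
Qed.
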